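(* Let $T>0$ be a fixed time, and suppose that the exact solution $u$ of the nonlocal Cahn-Hilliard equation on $\Omega=(0,L)\times(0,L)$ with periodic boundary conditions is smooth enough and satisfies, for some $\delta>0$, the separation property $\|u\|_\infty\le 1-2\delta$ at a point-wise level. If $\tau\le\frac12$ and $h$ is sufficiently small, then the numerical solution $u^n$ generated by the P-ETD1 scheme with time step $\tau$, mesh size $h$ and initial data $u^0=I^hu_N(\cdot,0)$ has the error estimate $$\|u^n-I^hu(t_n)\|\le C(\tau+h^2),\qquad t_n=n\tau\le T,$$ where the constant $C>0$ depends on $T$, $\epsilon$, $\kappa$, $\theta_c$ and $\theta$, but is independent of $\tau$ and $h$.
   Context: **Equation.** The nonlocal Cahn-Hilliard equation is $u_t=\Delta\mu$, $\mu=\frac\theta2\ln(1+u)-\frac\theta2\ln(1-u)-\theta_cu-\epsilon^2\Delta u+\sigma(-\Delta)^{-1}(u-\overline u)$, with $\epsilon>0$, $\sigma>0$, $0<\theta<\theta_c$, and $\overline u$ the spatial mean of $u$. **Grid functions.** Let $M$ be a positive integer, $h=L/M$, and let $\mathcal{M}_h$ be the space of real grid functions $v=(v_{ij})$ on the mesh points $(x_i,y_j)=(ih,jh)$, $1\le i,j\le M$, extended $M$-periodically in each index. Set $\langle v,w\rangle=h^2\sum_{i,j=1}^M v_{ij}w_{ij}$, $\|v\|=\sqrt{\langle v,v\rangle}$, $\|v\|_\infty=\max_{i,j}|v_{ij}|$, $\overline v$ the mean of $v$ over the mesh points, and $\Delta_hv_{ij}=h^{-2}(v_{i+1,j}+v_{i-1,j}+v_{i,j-1}+v_{i,j+1}-4v_{ij})$.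 $I^h$ restricts a function to the mesh: $(I^h\varphi)_{ij}=\varphi(x_i,y_j)$. Linear operators on $\mathcal{M}_h$ are regarded as matrices, and functions of symmetric matrices are understood spectrally; products and inequalities of grid functions are pointwise. **Fourier projection.** $u_N(\cdot,t)=\mathcal P_Nu(\cdot,t)$ is the spatial Fourier projection of the exact solution into the space $\mathcal{B}^N$ of (periodic) trigonometric polynomials of degree up to $N$. The degree $N$ is tied to the mesh so that the standard estimate $\|u_N-u\|_{L^\infty(0,T;H^k)}\le Ch^{l-k}\|u\|_{L^\infty(0,T;H^l)}$ for $0\le k\le l$ holds and so that $\int_\Omega u_N(\bm{x},t_n)\,d\bm{x}=h^2\sum_{i,j=1}^M u_N(x_i,y_j,t_n)$. **Operators.** With a stabilizing constant $\kappa>0$, $L_h=\epsilon^2\Delta_h^2-\kappa\Delta_h+\sigma I$ and $F(v)=\frac\theta2\Delta_h[\ln(1+v)-\ln(1-v)]-\theta_c\Delta_hv-\kappa\Delta_hv+\sigma\overline v$. Let $\varphi_0(a)=e^{-a}$, $\varphi_1(a)=\frac{1-e^{-a}}a$. **P-ETD1 scheme.** Given $u^n\in\mathcal{M}_h$, the prediction is $\widetilde u^{n+1}=\varphi_0(\tau L_h)u^n+\tau\varphi_1(\tau L_h)F(u^n)$. The corrected solution $u^{n+1}$ is the minimizer of $\frac12\|\phi-\widetilde u^{n+1}\|^2$ over all $\phi\in\mathcal{M}_h$ with $\|\phi\|_\infty\le1-\delta$ and $\langle\phi,1\rangle=\langle\widetilde u^{n+1},1\rangle$, with the same $\delta$ as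 in the separation property. It is computed from the Karush-Kuhn-Tucker system: with $g(u)=(1-\delta)^2-u^2$ and Lagrange multipliers $\lambda_h^{n+1}\in\mathcal{M}_h$, $\xi_h^{n+1}\in\mathbb{R}$, $u^{n+1}=\widetilde u^{n+1}+\lambda_h^{n+1}g'(u^{n+1})+\xi_h^{n+1}$, $\lambda_h^{n+1}g(u^{n+1})=0$, $\lambda_h^{n+1}\ge0$, $g(u^{n+1})\ge0$, $\langle u^{n+1},1\rangle=\langle\widetilde u^{n+1},1\rangle$. *)

(* Defs.v *)
From HB Require Import structures.
From mathcomp Require Import all_boot all_order all_algebra.
From mathcomp Require Import complex.
From mathcomp Require Import all_classical all_reals all_analysis.

Set Implicit Arguments.
Unset Strict Implicit.
Unset Printing Implicit Defensive.

Import Order.TTheory GRing.Theory Num.Theory.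
Import numFieldNormedType.Exports.

Local Open Scope classical_set_scope.
Local Open Scope ring_scope.

(* Functions on the torus (R/LZ)^2 are L-periodic functions v : R -> R -> R.  *)
(* Time-dependent functions take the time first: u t x y.                     *)
Section continuous_problem.
Variable R : realType.
Implicit Types (v psi : R -> R -> R) (u : R -> R -> R -> R) (L T : R).

Definition partial_x v : R -> R -> R := fun x y => derive1 (fun s => v s y) x.
Definition partial_y v : R -> R -> R := fun x y => derive1 (v x) y.
Definition laplacian v : R -> R -> R :=
  fun x y => partial_x (partial_x v) x y + partial_y (partial_y v) x y.

Definition periodic L v : Prop :=
  forall x y, v (x + L) y = v x y /\ v x (y + L) = v x y.

(* Iterated form of the integral over (0,L) x (0,L); it is only applied to    *)
(* continuous integrands, for which the order of integration is irrelevant.   *)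
Definition integral_Omega L v : R :=
  \int[lebesgue_measure]_(x in `[0, L])
    \int[lebesgue_measure]_(y in `[0, L]) v x y.

Definition mean L v : R := integral_Omega L v / L ^+ 2.

Fixpoint classCk (k : nat) v : Prop :=
  continuous (fun p : R * R => v p.1 p.2) /\
  (if k is k'.+1 then
     [/\ forall x y, derivable (fun s => v s y) x 1,
         forall x y, derivable (v x) y 1,
         classCk k' (partial_x v) & classCk k' (partial_y v)]
   else True).

(* Class C^k on [0,T] x R x R: all the mixed derivatives of total order at    *)
(* most k exist (in time: on the open interval) and extend continuously to    *)
(* the closed slab.  Values of u outside [0,T] play no role.                  *)
Fixpoint classCk_slab T (k : nat) u : Prop :=
  {within [set p : R * R * R | 0 <= p.1.1 <= T],
     continuous (fun p => u p.1.1 p.1.2 p.2)} /\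
  (if k is k'.+1 then
     [/\ forall t x y, 0 <= t <= T -> derivable (fun s => u t s y) x 1,
         forall t x y, 0 <= t <= T -> derivable (u t x) y 1,
         classCk_slab T k' (fun t => partial_x (u t)),
         classCk_slab T k' (fun t => partial_y (u t)) &
         exists ut : R -> R -> R -> R,
           (forall t x y, 0 < t < T ->
              is_derive t 1 (fun s => u s x y) (ut t x y)) /\
           classCk_slab T k' ut]
   else True).

(* psi = (- Delta)^{-1} g, for g periodic of mean zero *)
Definition is_inv_neg_laplacian L (g psi : R -> R -> R) : Prop :=
  [/\ classCk 2 psi, periodic L psi, mean L psi = 0 &
      forall x y, - laplacian psi x y = g x y].

Definition chemical_potential (eps sigma theta thetac : R) v psi :
    R -> R -> R :=
  fun x y => theta / 2 * ln (1 + v x y) - theta / 2 * ln (1 - v x y)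
             - thetac * v x y - eps ^+ 2 * laplacian v x y + sigma * psi x y.

Definition nonlocal_CH_solution (L T eps sigma theta thetac : R) u : Prop :=
  (forall t, 0 <= t <= T -> periodic L (u t)) /\
  (forall t, 0 < t < T -> exists psi,
     is_inv_neg_laplacian L (fun x y => u t x y - mean L (u t)) psi /\
     forall x y,
       is_derive t 1 (fun s => u s x y)
         (laplacian (chemical_potential eps sigma theta thetac (u t) psi) x y)).

(* The frequencies -N, ..., N *)
Definition freq (N : nat) (i : 'I_(N.*2.+1)) : R := (i : nat)%:R - N%:R.

Definition phase L (k l x y : R) : R := 2 * pi * (k * x + l * y) / L.

(* With a - i b the complex Fourier coefficient of the real function v at the *)
(* frequency (k,l), the real part of (a - i b) exp(i phase) is the summand    *)
(* below; the imaginary parts of (k,l) and (-k,-l) cancel.                    *)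
Definition fourier_proj L (N : nat) v : R -> R -> R := fun x y =>
  \sum_(i < N.*2.+1) \sum_(j < N.*2.+1)
    let k := freq i in let l := freq j in
    (mean L (fun x' y' => v x' y' * cos (phase L k l x' y'))
       * cos (phase L k l x y) +
     mean L (fun x' y' => v x' y' * sin (phase L k l x' y'))
       * sin (phase L k l x y)).

Definition Hnorm L (k : nat) v : R :=
  Num.sqrt (\sum_(i < k.+1) \sum_(j < k.+1 | (i + j <= k)%N)
    integral_Omega L
      (fun x y => (iter i partial_x (iter j partial_y v)) x y ^+ 2)).

(* L^oo(0,T;H^k) norm; a plain supremum suffices for functions continuous in  *)
(* time with values in H^k.                                                   *)
Definition LinftyHnorm L T (k : nat) u : \bar R :=
  ereal_sup [set (Hnorm L k (u t))%:E | t in `[0, T]].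

End continuous_problem.

(* The grid function v is the matrix whose entry (i,j), with 0 <= i, j < M,   *)
(* is the value at the mesh point ((i+1)h, (j+1)h); ordS and ord_pred are the *)
(* cyclic successor and predecessor, i.e. the M-periodic extension.           *)
Section grid_functions.
Variables (R : realType) (M : nat).
Implicit Types (h : R) (v w : 'M[R]_M).

Definition grid_restrict h (f : R -> R -> R) : 'M[R]_M :=
  \matrix_(i, j) f (i.+1%:R * h) (j.+1%:R * h).

Definition grid_inner h v w : R := h ^+ 2 * \sum_i \sum_j v i j * w i j.
Definition grid_norm h v : R := Num.sqrt (grid_inner h v v).
Definition grid_norm_infty v : R :=
  \big[Num.max/0]_i \big[Num.max/0]_j `|v i j|.
Definition grid_mean v : R := (\sum_i \sum_j v i j) / (M ^ 2)%:R.

Definition grid_laplacian h v : 'M[R]_M :=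
  \matrix_(i, j) (h ^- 2 * (v (ordS i) j + v (ord_pred i) j
                            + v i (ord_pred j) + v i (ordS j) - 4 * v i j)).

(* f(A) for a real symmetric A, through the unitary diagonalization of A over *)
(* R[i], whose eigenvalues and result are real.                               *)
Definition spectral_fun (n : nat) (f : R -> R) (A : 'M[R]_n) : 'M[R]_n :=
  let Ac := map_mx (real_complex R) A in
  let P := spectralmx Ac in
  let D := map_mx (fun z : R[i] => real_complex R (f (complex.Re z)))
             (spectral_diag Ac) in
  map_mx (fun z : R[i] => complex.Re z) (invmx P *m diag_mx D *m P).

Definition phi0 (a : R) : R := expR (- a).
Definition phi1 (a : R) : R := (1 - expR (- a)) / a.

(* f(tau A) applied to v, for A a linear operator on grid functions *)
Definition op_fun (f : R -> R) (tau : R) (A : 'M[R]_M -> 'M[R]_M) v : 'M[R]_M :=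
  vec_mx (mxvec v *m spectral_fun f (tau *: lin_mx A)).

Definition Lh_op (eps kappa sigma h : R) v : 'M[R]_M :=
  eps ^+ 2 *: grid_laplacian h (grid_laplacian h v)
  - kappa *: grid_laplacian h v + sigma *: v.

Definition F_op (theta thetac kappa sigma h : R) v : 'M[R]_M :=
  (theta / 2) *: grid_laplacian h
      (map_mx (fun a => ln (1 + a)) v - map_mx (fun a => ln (1 - a)) v)
  - thetac *: grid_laplacian h v - kappa *: grid_laplacian h v
  + sigma *: const_mx (grid_mean v).

Definition ETD1_predict (eps sigma theta thetac kappa h tau : R) v : 'M[R]_M :=
  op_fun phi0 tau (Lh_op eps kappa sigma h) v
  + tau *: op_fun phi1 tau (Lh_op eps kappa sigma h)
             (F_op theta thetac kappa sigma h v).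

Definition admissible h (delta : R) (util phi : 'M[R]_M) : Prop :=
  grid_norm_infty phi <= 1 - delta /\
  grid_inner h phi (const_mx 1) = grid_inner h util (const_mx 1).

Definition is_correction h (delta : R) (util w : 'M[R]_M) : Prop :=
  admissible h delta util w /\
  forall phi, admissible h delta util phi ->
    grid_norm h (w - util) ^+ 2 / 2 <= grid_norm h (phi - util) ^+ 2 / 2.

Definition is_PETD1 (eps sigma theta thetac kappa delta h tau : R)
    (un : nat -> 'M[R]_M) : Prop :=
  forall n, is_correction h delta
    (ETD1_predict eps sigma theta thetac kappa h tau (un n)) (un n.+1).

End grid_functions.

(* The two requirements tying the degree N = deg M of the Fourier projection  *)
(* to the mesh with M points per direction.                                   *)
Section degree.
Variable R : realType.
Implicit Types (L T : R) (u : R -> R -> R -> R).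

Definition projection_estimate L T (m : nat) (deg : nat -> nat) u : Prop :=
  forall k l : nat, (k <= l)%N -> (l <= m)%N ->
  exists2 C : R, 0 < C & forall M : nat, (0 < M)%N ->
    (LinftyHnorm L T k
       (fun t x y => (fourier_proj L (deg M) (u t) x y - u t x y)%R)
     <= (C * (L / M%:R) ^+ (l - k))%R%:E * LinftyHnorm L T l u)%E.

Definition quadrature_exact L T (deg : nat -> nat) u : Prop :=
  forall (M : nat) (t : R), (0 < M)%N -> 0 <= t <= T ->
  let h := L / M%:R in
  integral_Omega L (fourier_proj L (deg M) (u t))
  = h ^+ 2 * \sum_i \sum_j
      @grid_restrict R M h (fourier_proj L (deg M) (u t)) i j.

End degree.

(* Main.v *)
(* W(t) denotes the restriction of the exact solution u(t) to the mesh.  Write L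
   for L_h and A for tau L_h.  The predictor preserves the grid mean, so the
   errors are measured against W(t_n) + c_n, where the constant c_n restores the
   mean of the initial data; this grid function is admissible for the correction
   step when h is small, and the correction is the projection onto a convex set,
   hence nonexpansive.

   Stability: phi0(A) e + tau phi1(A) Delta_h g = phi0(A) e + (1 - phi0(A)) w with
   L w = Delta_h g.  By convexity and 1 - e^{-a} <= a its squared norm is at most
   |e|^2 + tau <L w, w>, and <L w, w> <= |g|^2 / eps^2 because L dominates
   eps^2 Delta_h^2.

   Consistency: the predictor maps W to W + tau phi1(A) (W' - r), where r = O(h^2)
   is the defect of W in the semidiscrete equation, and |q - phi1(A) q| is bounded
   both by |A q| (used for q = W') and by |q| (used for q = r).  The mean of W'
   equals the mean of r, so c_n varies by O(tau h^2) per step.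

   A discrete Sobolev inequality bounds the error of the initial data on the
   grid by the H^2 norm of the projection error. *)

Require Import Defs.
From HB Require Import structures.
From mathcomp Require Import all_boot all_order all_algebra.
From mathcomp Require Import complex.
From mathcomp Require Import all_classical all_reals all_analysis.
From mathcomp Require Import ring lra.

Set Implicit Arguments.
Unset Strict Implicit.
Unset Printing Implicit Defensive.

Import Order.TTheory GRing.Theory Num.Theory.
Import numFieldNormedType.Exports.

Local Open Scope classical_set_scope.
Local Open Scope ring_scope.

(** * Spectral calculus of symmetric matrices *)

(** The flux is merely Lipschitz and stands under Delta_h, whose norm is of order h^-2. The
    stability bound removes this factor: the flux difference g enters only as tau |g|^2 / eps^2,
    while |e|^2 keeps the coefficient 1, which is what a discrete Gronwall argument uniform in h and
    tau requires. The flux is Lipschitz only away from the singularities of the logarithms; the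
    correction supplies |u^n| <= 1 - delta at every step, so no sup-norm error bound has to be
    propagated, and the separation margin 2 delta leaves room for the shift c_n. The matrix
    functions come from a complex unitary diagonalization, whereas grid functions are real. The real
    and imaginary parts of the complex eigenvectors are twice as many real eigenvectors as the
    dimension; they are not independent but form a Parseval frame, through which every operator
    bound is reduced to an inequality between scalars. Constants uniform in time, in a frozen
    coordinate and in h are obtained by stating all derivative bounds for families over an arbitrary
    index type. *)

Section spectral_frame.
Variable R : realType.

Lemma complex_Re_mul (x y : R[i]) :
  complex.Re (x * y) = complex.Re x * complex.Re y - complex.Im x * complex.Im y.
Proof. by case: x; case: y. Qed.

Lemma complex_Im_mul (x y : R[i]) :
  complex.Im (x * y) = complex.Re x * complex.Im y + complex.Im x * complex.Re y.
Proof. by case: x; case: y. Qed.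

Lemma complex_Re_conj (x : R[i]) : complex.Re (x^*)%R = complex.Re x.
Proof. by case: x. Qed.

Lemma complex_Im_conj (x : R[i]) : complex.Im (x^*)%R = - complex.Im x.
Proof. by case: x. Qed.

Lemma complex_Re_sum (I : finType) (F : I -> R[i]) :
  complex.Re (\sum_k F k) = \sum_k complex.Re (F k).
Proof. by apply: (big_morph (fun z : R[i] => complex.Re z)) => // -[? ?] [? ?]. Qed.

Lemma complex_Im_sum (I : finType) (F : I -> R[i]) :
  complex.Im (\sum_k F k) = \sum_k complex.Im (F k).
Proof. by apply: (big_morph (fun z : R[i] => complex.Im z)) => // -[? ?] [? ?]. Qed.

Lemma complexI_part (x y : R[i]) :
  complex.Re x = complex.Re y -> complex.Im x = complex.Im y -> x = y.
Proof. by case: x y => [a b] [c d] /= -> ->. Qed.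

(** Since the eigenvalues are real, the real and imaginary parts of each row of the unitary matrix
    are separately left eigenvectors of [A]. One of the two parts may vanish, but not both, as [P]
    is invertible: the last clause gives each eigenvalue a genuine eigenvector, from which
    positivity of the spectrum is deduced. *)
Lemma spectral_frame (n : nat) (A : 'M[R]_n) : A^T = A ->
  exists (a : 'I_n * bool -> R) (b : 'I_n * bool -> 'rV[R]_n),
  [/\ forall f, spectral_fun f A = \sum_k f (a k) *: ((b k)^T *m b k),
      forall k, b k *m A = a k *: b k,
      \sum_k ((b k)^T *m b k) = 1%:M &
      forall k, exists2 k', a k' = a k & b k' != 0].
Proof.
move=> symA.
pose Ac := map_mx (real_complex R) A.
pose P := spectralmx Ac; pose d := spectral_diag Ac.
have hermA : Ac \is hermsymmx.
  apply: realsym_hermsym.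
    apply/is_hermitianmxP.
    by rewrite expr0 scale1r map_mx_id // /Ac map_trmx symA.
  by apply/mxOverP => i j; rewrite mxE; apply/complex_realP; exists (A i j).
have Pu : P \is unitarymx := spectral_unitarymx Ac.
have Punit := unitarymx_unit Pu.
have AE : Ac = invmx P *m diag_mx d *m P.
  by apply/orthomx_spectralP/hermitian_normalmx.
have dreal : forall k, complex.Im (d 0 k) = 0.
  move=> k; have /mxOverP /(_ 0 k) := hermitian_spectral_diag_real hermA.
  by move=> /complex_realP [x]; rewrite -/d => ->.
have PA : P *m Ac = diag_mx d *m P.
  by rewrite AE !mulmxA mulmxV // mul1mx.
pose a (k : 'I_n * bool) := complex.Re (d 0 k.1).
pose b (k : 'I_n * bool) : 'rV[R]_n :=
  \row_j (if k.2 then complex.Im (P k.1 j) else complex.Re (P k.1 j)).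
have split_sum (F : 'I_n * bool -> 'M[R]_n) :
    \sum_k F k = \sum_(k : 'I_n) (F (k, true) + F (k, false)).
  under eq_bigr do rewrite [X in F X]surjective_pairing.
  rewrite -(pair_bigA _ (fun k c => F (k, c))) /=.
  by apply: eq_bigr => k _; rewrite big_bool.
have outerE k i j : ((b k)^T *m b k) i j = b k 0 i * b k 0 j.
  by rewrite !mxE big_ord1 !mxE.
have scaleE c (X : 'M[R]_n) i j : (c *: X) i j = c * X i j by rewrite mxE.
exists a, b; split.
- move=> f; rewrite split_sum /spectral_fun -/Ac -/P -/d; apply/matrixP => i j.
  rewrite mxE (invmx_unitary Pu) summxE.
  rewrite [X in complex.Re X]mxE complex_Re_sum; apply: eq_bigr => k _.
  rewrite [in LHS]mul_mx_diag [RHS]mxE !scaleE !outerE /b /a !mxE /=.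
  rewrite !complex_Re_mul complex_Im_mul complex_Re_conj complex_Im_conj /=.
  ring.
- move=> [k c]; apply/rowP => j; rewrite !mxE /a /b /=.
  have := congr1 (fun X : 'M[_]_n => X k j) PA.
  rewrite mul_diag_mx !mxE => E.
  case: c => /=.
    have := congr1 (fun z => complex.Im z) E.
    rewrite complex_Im_sum complex_Im_mul dreal mul0r addr0 => <-.
    by apply: eq_bigr => i _; rewrite !mxE complex_Im_mul /= mulr0 add0r.
  have := congr1 (fun z => complex.Re z) E.
  rewrite complex_Re_sum complex_Re_mul dreal mul0r subr0 => <-.
  by apply: eq_bigr => i _; rewrite !mxE complex_Re_mul /= mulr0 subr0.
- have PP : (P ^t*)%sesqui *m P = 1%:M by rewrite -(invmx_unitary Pu) mulVmx.
  rewrite split_sum; apply/matrixP => i j.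
  have := congr1 (fun X : 'M[_]_n => complex.Re (X i j)) PP.
  rewrite /= mxE complex_Re_sum summxE => E.
  transitivity (complex.Re ((1%:M : 'M[R[i]]_n) i j)); last first.
    by rewrite !mxE; case: eqP.
  rewrite -E; apply: eq_bigr => k _.
  rewrite [LHS]mxE !outerE /b !mxE complex_Re_mul complex_Re_conj complex_Im_conj /=.
  by ring.
- move=> k; exists (if b (k.1, true) != 0 then (k.1, true) else (k.1, false)).
    by case: ifP.
  case: ifPn => // /negPn/eqP b0; apply/eqP => b1.
  have P0 : row k.1 P = 0.
    apply/rowP => j; rewrite !mxE; apply: complexI_part => /=.
      by have := congr1 (fun X : 'rV[_]_n => X 0 j) b1; rewrite !mxE.
    by have := congr1 (fun X : 'rV[_]_n => X 0 j) b0; rewrite !mxE.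
  have : row k.1 (P *m invmx P) = 0 by rewrite row_mul P0 mul0mx.
  rewrite mulmxV // => /(congr1 (fun X : 'rV[_]_n => X 0 k.1)).
  by rewrite !mxE !eqxx /= => /eqP; rewrite oner_eq0.
Qed.
End spectral_frame.

(** * Exponential integrator functions of a positive definite matrix *)

Section etd_functions.
Variables (R : realType) (n : nat).
Implicit Types (x y : 'rV[R]_n) (A : 'M[R]_n).

Definition dotr x y : R := \sum_i x 0 i * y 0 i.

Lemma dotrC x y : dotr x y = dotr y x.
Proof. by apply: eq_bigr => i _; rewrite mulrC. Qed.

Lemma dotrDl x y z : dotr (x + y) z = dotr x z + dotr y z.
Proof. by rewrite /dotr -big_split; apply: eq_bigr => i _; rewrite mxE mulrDl. Qed.

Lemma dotrZl c x y : dotr (c *: x) y = c * dotr x y.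
Proof. by rewrite /dotr mulr_sumr; apply: eq_bigr => i _; rewrite mxE mulrA. Qed.

Lemma dotrZr c x y : dotr y (c *: x) = c * dotr y x.
Proof. by rewrite dotrC dotrZl dotrC. Qed.

Lemma dotr_sumr (K : finType) (F : K -> 'rV[R]_n) x :
  dotr x (\sum_k F k) = \sum_k dotr x (F k).
Proof.
rewrite /dotr exchange_big; apply: eq_bigr => i _ /=.
by rewrite summxE mulr_sumr.
Qed.

Lemma dotr_mx x y : x *m y^T = (dotr x y)%:M.
Proof.
by apply/matrixP => i j; rewrite !ord1 !mxE mulr1n; apply: eq_bigr => k _; rewrite mxE.
Qed.

Lemma dotr_ge0 x : 0 <= dotr x x.
Proof. by apply: sumr_ge0 => i _; rewrite -expr2 sqr_ge0. Qed.

Lemma dotr_gt0 x : x != 0 -> 0 < dotr x x.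
Proof.
move=> x0; rewrite lt_neqAle dotr_ge0 andbT; apply: contra x0 => /eqP/esym.
move=> /psumr_eq0P E; apply/eqP/rowP => i; apply/eqP.
rewrite mxE -(orbb (x 0 i == 0)) -mulf_eq0 E // => j _.
by rewrite -expr2 sqr_ge0.
Qed.

Lemma dotr_outer x y : x *m (y^T *m y) = dotr x y *: y.
Proof. by rewrite mulmxA dotr_mx mul_scalar_mx. Qed.

Lemma dotr_sym A x y : A^T = A -> dotr (x *m A) y = dotr x (y *m A).
Proof.
move=> symA; have : (dotr (x *m A) y)%:M = (dotr x (y *m A))%:M :> 'M[R]_1.
  by rewrite -!dotr_mx trmx_mul symA mulmxA.
by move=> /matrixP/(_ 0 0); rewrite !mxE.
Qed.

Section tight_frame.
Variables (K : finType) (b : K -> 'rV[R]_n).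

Lemma frame_expand x : \sum_k ((b k)^T *m b k) = 1%:M ->
  x = \sum_k dotr x (b k) *: b k.
Proof.
move=> b1; rewrite -[LHS]mulmx1 -b1 mulmx_sumr.
by apply: eq_bigr => k _; rewrite dotr_outer.
Qed.

Lemma frame_parseval x : \sum_k ((b k)^T *m b k) = 1%:M ->
  dotr x x = \sum_k dotr x (b k) ^+ 2.
Proof.
move=> b1; rewrite {2}(frame_expand x b1) dotr_sumr.
by apply: eq_bigr => k _; rewrite dotrZr expr2.
Qed.

(** The frame is redundant, so [c k] need not equal [dotr y (b k)]. Summing the squares of their
    differences gives 0 <= sum c_k^2 - 2 |y|^2 + |y|^2. *)
Lemma frame_synthesis_le (c : K -> R) : \sum_k ((b k)^T *m b k) = 1%:M ->
  dotr (\sum_k c k *: b k) (\sum_k c k *: b k) <= \sum_k c k ^+ 2.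
Proof.
move=> b1; set y := \sum_k _.
have E : dotr y y = \sum_k c k * dotr y (b k).
  by rewrite {2}/y dotr_sumr; apply: eq_bigr => k _; rewrite dotrZr.
suff : 2 * dotr y y <= \sum_k c k ^+ 2 + dotr y y by lra.
rewrite {1}E (frame_parseval y b1) mulr_sumr -big_split /=.
by apply: ler_sum => k _; have := sqr_ge0 (c k - dotr y (b k)); nra.
Qed.

End tight_frame.

Lemma phi0_gt0 (a : R) : 0 < phi0 a.
Proof. exact: expR_gt0. Qed.

Lemma phi0_le1 (a : R) : 0 <= a -> phi0 a <= 1.
Proof. by move=> a0; rewrite /phi0 -expR0 ler_expR; lra. Qed.

Lemma phi0_ge (a : R) : 1 - a <= phi0 a.
Proof. exact: expR_ge1Dx. Qed.

(** Follows from e^a >= 1 + a and (1 - a + a^2)(1 + a) = 1 + a^3 >= 1. *)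
Lemma phi0_le (a : R) : 0 <= a -> phi0 a <= 1 - a + a ^+ 2.
Proof.
move=> a0; rewrite /phi0 expRN -[leRHS]mulr1 -[X in _ <= _ * X](@mulfV _ (expR a)) ?gt_eqF ?expR_gt0//.
rewrite mulrA ler_peMl ?invr_ge0 ?expR_ge0//.
have q0 : 0 <= 1 - a + a ^+ 2 by have := sqr_ge0 (a - 1); nra.
have := ler_wpM2l q0 (expR_ge1Dx a); have := exprn_ge0 3 a0; lra.
Qed.

(** At a = 0 the quotient is 0 by convention, not the limit 1, but both sides vanish there. *)
Lemma mul_phi1 (a : R) : a * phi1 a = 1 - phi0 a.
Proof.
rewrite /phi1 /phi0; case: (eqVneq a 0) => [->|a0]; last by field.
by rewrite mul0r oppr0 expR0 subrr.
Qed.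

Lemma phi1_ge0 (a : R) : 0 <= a -> 0 <= phi1 a.
Proof.
move=> a0; rewrite /phi1 divr_ge0// subr_ge0; exact: phi0_le1.
Qed.

Lemma phi1_le1 (a : R) : 0 < a -> phi1 a <= 1.
Proof. by move=> a0; rewrite /phi1 ler_pdivrMr// mul1r; have := phi0_ge a; rewrite /phi0; lra. Qed.

Lemma phi1_ge (a : R) : 0 < a -> 1 - a <= phi1 a.
Proof.
by move=> a0; rewrite /phi1 ler_pdivlMr//; have := phi0_le (ltW a0); rewrite /phi0; nra.
Qed.

Section spectral_calculus.
Variables (A : 'M[R]_n).

(** Strict positivity keeps 0 out of the spectrum, where the conventional value [phi1 0 = 0] would
    break 1 - a <= phi1 a and with it the bound of x - phi1(A) x by A x. *)
Definition posdefmx : Prop := A^T = A /\ forall x, x != 0 -> 0 < dotr (x *m A) x.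

Lemma spectral_fun_frame : posdefmx ->
  exists (a : 'I_n * bool -> R) (b : 'I_n * bool -> 'rV[R]_n),
  [/\ forall f x, x *m spectral_fun f A = \sum_k (f (a k) * dotr x (b k)) *: b k,
      forall k x, dotr (x *m A) (b k) = a k * dotr x (b k),
      \sum_k ((b k)^T *m b k) = 1%:M &
      forall k, 0 < a k].
Proof.
move=> [symA posA]; have [a [b [SE bA b1 bnz]]] := spectral_frame symA.
exists a, b; split => //.
- move=> f x; rewrite SE mulmx_sumr; apply: eq_bigr => k _.
  by rewrite -scalemxAr dotr_outer scalerA.
- by move=> k x; rewrite dotr_sym // bA dotrZr.
- move=> k; have [k' <- b0] := bnz k.
  by have := posA _ b0; rewrite bA dotrZl pmulr_lgt0 // dotr_gt0.
Qed.

Lemma spectral_fun_sym f x y : posdefmx ->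
  dotr (x *m spectral_fun f A) y = dotr x (y *m spectral_fun f A).
Proof.
move=> pA; have [a [b [SE _ _ _]]] := spectral_fun_frame pA.
rewrite dotrC !SE !dotr_sumr; apply: eq_bigr => k _.
by rewrite !dotrZr; ring.
Qed.

(** Symmetry gives (l - a_k) <v, b_k> = 0, so only the frame vectors with a_k = l contribute to
    v. *)
Lemma spectral_fun_eigen f (v : 'rV[R]_n) l : posdefmx ->
  v *m A = l *: v -> v *m spectral_fun f A = f l *: v.
Proof.
move=> pA vA; have [a [b [SE bA b1 _]]] := spectral_fun_frame pA.
rewrite SE [in RHS](frame_expand v b1) scaler_sumr; apply: eq_bigr => k _.
rewrite scalerA; have := bA k v; rewrite vA dotrZl.
case: (eqVneq (dotr v (b k)) 0) => [->|v0]; first by rewrite !mulr0.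
by move=> /(mulIf v0) ->.
Qed.

Lemma spectral_phi0E x : posdefmx ->
  x *m spectral_fun (@phi0 R) A = x - x *m A *m spectral_fun (@phi1 R) A.
Proof.
move=> pA; have [a [b [SE bA b1 _]]] := spectral_fun_frame pA.
rewrite [in X in _ = X - _](frame_expand x b1) !SE -sumrB.
apply: eq_bigr => k _; rewrite -scalerBl bA.
by rewrite mulrA (mulrC (phi1 _)) mul_phi1; congr (_ *: _); ring.
Qed.

(* Jensen's inequality for the convex combination with weight phi0(a) of the
   coefficients of x and y, followed by 1 - phi0(a) <= a. *)
Lemma etd_stable x y z : posdefmx ->
  z = x *m spectral_fun (@phi0 R) A + y *m A *m spectral_fun (@phi1 R) A ->
  dotr z z <= dotr x x + dotr (y *m A) y.
Proof.
move=> pA zE; have [a [b [SE bA b1 a0]]] := spectral_fun_frame pA.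
have -> : z = \sum_k (phi0 (a k) * dotr x (b k) + (1 - phi0 (a k)) * dotr y (b k)) *: b k.
  rewrite zE !SE -big_split /=; apply: eq_bigr => k _.
  by rewrite -scalerDl bA mulrA (mulrC (phi1 _)) mul_phi1.
apply: le_trans (frame_synthesis_le _ b1) _.
rewrite (frame_parseval x b1) [X in _ + dotr _ X](frame_expand y b1) dotr_sumr -big_split /=.
apply: ler_sum => k _; rewrite dotrZr bA.
have := phi0_gt0 (a k); have := phi0_le1 (ltW (a0 k)); have := phi0_ge (a k).
move: (a k) (a0 k) (dotr y _) (dotr x _) (phi0 _) => c c0 t s p h1 h2 h3.
have J : (p * s + (1 - p) * t) ^+ 2 <= p * s ^+ 2 + (1 - p) * t ^+ 2.
  suff : 0 <= p * (1 - p) * (s - t) ^+ 2 by lra.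
  by apply: mulr_ge0; [apply: mulr_ge0; lra | exact: sqr_ge0].
have : (1 - p) * t ^+ 2 <= c * t ^+ 2 by rewrite ler_wpM2r ?sqr_ge0//; lra.
have : p * s ^+ 2 <= s ^+ 2 by rewrite ler_piMl ?sqr_ge0.
lra.
Qed.

Lemma etd_phi1_consistent x : posdefmx ->
  let z := x - x *m spectral_fun (@phi1 R) A in
  dotr z z <= dotr (x *m A) (x *m A) /\ dotr z z <= dotr x x.
Proof.
move=> pA z; have [a [b [SE bA b1 a0]]] := spectral_fun_frame pA.
have -> : z = \sum_k ((1 - phi1 (a k)) * dotr x (b k)) *: b k.
  rewrite /z SE [in X in X - _](frame_expand x b1) -sumrB.
  by apply: eq_bigr => k _; rewrite -scalerBl; congr (_ *: _); ring.
split; apply: le_trans (frame_synthesis_le _ b1) _; rewrite (frame_parseval _ b1);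
  apply: ler_sum => k _; rewrite ?bA.
all: have := phi1_ge0 (ltW (a0 k)); have := phi1_le1 (a0 k); have := phi1_ge (a0 k).
all: rewrite !exprMn => h1 h2 h3.
  rewrite ler_wpM2r ?sqr_ge0// ler_sqr ?nnegrE ?(ltW (a0 k))//; lra.
rewrite ler_piMl ?sqr_ge0// expr_le1//; lra.
Qed.

End spectral_calculus.
End etd_functions.

(** * Grid operators and the ETD1 step *)

Section grid_operators.
Variables (R : realType) (M : nat).
Implicit Types (u v w e g : 'M[R]_M) (h c : R).

Definition gsum v w : R := \sum_i \sum_j v i j * w i j.

Lemma gsumE v w : gsum v w = dotr (mxvec v) (mxvec w).
Proof.
rewrite /gsum /dotr pair_bigA /= [RHS](reindex _ (curry_mxvec_bij M M)) /=.
by apply: eq_bigr => -[i j] _ /=; rewrite !mxvecE.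
Qed.

Lemma gsumC v w : gsum v w = gsum w v.
Proof. by rewrite !gsumE dotrC. Qed.

Lemma gsumDl v w u : gsum (v + w) u = gsum v u + gsum w u.
Proof. by rewrite !gsumE linearD dotrDl. Qed.

Lemma gsumZl c v u : gsum (c *: v) u = c * gsum v u.
Proof. by rewrite !gsumE linearZ dotrZl. Qed.

Lemma gsumDr v w u : gsum u (v + w) = gsum u v + gsum u w.
Proof. by rewrite gsumC gsumDl !(gsumC _ u). Qed.

Lemma gsumZr c v u : gsum u (c *: v) = c * gsum u v.
Proof. by rewrite gsumC gsumZl gsumC. Qed.

Lemma gsum_ge0 v : 0 <= gsum v v.
Proof. by rewrite gsumE dotr_ge0. Qed.

Lemma gsum1 v : gsum v (const_mx 1) = \sum_i \sum_j v i j.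
Proof. by apply: eq_bigr => i _; apply: eq_bigr => j _; rewrite mxE mulr1. Qed.

Lemma sum_ordS (F : 'I_M -> R) : \sum_i F (ordS i) = \sum_i F i.
Proof. by rewrite [RHS](reindex (@ordS M))//; exists (@ord_pred M) => i _; rewrite ?ordSK ?ord_predK. Qed.


Definition shift_row v : 'M[R]_M := \matrix_(i, j) v (ordS i) j.
Definition unshift_row v : 'M[R]_M := \matrix_(i, j) v (ord_pred i) j.
Definition shift_col v : 'M[R]_M := \matrix_(i, j) v i (ordS j).
Definition unshift_col v : 'M[R]_M := \matrix_(i, j) v i (ord_pred j).

Lemma grid_laplacianE h v : grid_laplacian h v =
  h ^- 2 *: (shift_row v + unshift_row v + unshift_col v + shift_col v - 4 *: v).
Proof. by apply/matrixP => i j; rewrite !mxE. Qed.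

Lemma shift_row_adj v w : gsum (shift_row v) w = gsum v (unshift_row w).
Proof.
rewrite /gsum -[RHS]sum_ordS; apply: eq_bigr => i _; apply: eq_bigr => j _.
by rewrite !mxE ordSK.
Qed.

Lemma shift_col_adj v w : gsum (shift_col v) w = gsum v (unshift_col w).
Proof.
rewrite /gsum; apply: eq_bigr => i _; rewrite -[RHS]sum_ordS.
by apply: eq_bigr => j _; rewrite !mxE ordSK.
Qed.

Lemma unshift_row_adj v w : gsum (unshift_row v) w = gsum v (shift_row w).
Proof. by rewrite gsumC -shift_row_adj gsumC. Qed.

Lemma unshift_col_adj v w : gsum (unshift_col v) w = gsum v (shift_col w).
Proof. by rewrite gsumC -shift_col_adj gsumC. Qed.

Lemma shift_row_isometry v : gsum (shift_row v) (shift_row v) = gsum v v.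
Proof.
rewrite shift_row_adj; congr gsum.
by apply/matrixP => i j; rewrite !mxE ord_predK.
Qed.

Lemma shift_col_isometry v : gsum (shift_col v) (shift_col v) = gsum v v.
Proof.
rewrite shift_col_adj; congr gsum.
by apply/matrixP => i j; rewrite !mxE ord_predK.
Qed.

Lemma gsum_young v w : 2 * gsum v w <= gsum v v + gsum w w.
Proof.
have := gsum_ge0 (v - w).
rewrite -scaleN1r !gsumDl !gsumDr !gsumZl !gsumZr (gsumC w v); lra.
Qed.

Lemma grid_laplacian_sym h v w :
  gsum (grid_laplacian h v) w = gsum v (grid_laplacian h w).
Proof.
rewrite !grid_laplacianE -!scaleNr gsumZl gsumZr !gsumDl !gsumDr !gsumZl !gsumZr.
rewrite shift_row_adj shift_col_adj unshift_row_adj unshift_col_adj.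
by congr (_ * _); ring.
Qed.

(** Shifts are isometries, so by Young's inequality the two neighbours in each direction contribute
    at most 2 |v|^2 against the central term 4 |v|^2. *)
Lemma grid_laplacian_le0 h v : gsum (grid_laplacian h v) v <= 0.
Proof.
rewrite grid_laplacianE -!scaleNr gsumZl !gsumDl !gsumZl.
rewrite unshift_row_adj unshift_col_adj (gsumC v (shift_row v)) (gsumC v (shift_col v)).
rewrite mulr_ge0_le0 ?invr_ge0 ?sqr_ge0//.
have := gsum_young (shift_row v) v; have := gsum_young (shift_col v) v.
rewrite shift_row_isometry shift_col_isometry; lra.
Qed.

Lemma grid_laplacianD h v w :
  grid_laplacian h (v + w) = grid_laplacian h v + grid_laplacian h w.
Proof. by apply/matrixP => i j; rewrite !mxE; ring. Qed.

Lemma grid_laplacianZ h c v : grid_laplacian h (c *: v) = c *: grid_laplacian h v.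
Proof. by apply/matrixP => i j; rewrite !mxE; ring. Qed.

Lemma grid_laplacianB h v w :
  grid_laplacian h (v - w) = grid_laplacian h v - grid_laplacian h w.
Proof. by rewrite grid_laplacianD -scaleN1r grid_laplacianZ scaleN1r. Qed.

Lemma grid_laplacian_const h c : grid_laplacian h (const_mx c) = 0 :> 'M[R]_M.
Proof. by apply/matrixP => i j; rewrite !mxE; ring. Qed.

Lemma grid_laplacian_mean h v : grid_mean (grid_laplacian h v) = 0.
Proof.
rewrite /grid_mean -gsum1 grid_laplacian_sym grid_laplacian_const.
by rewrite -[0](scale0r 0) gsumZr !mul0r.
Qed.

Section semidiscrete.
Variables (eps kappa sigma h : R).
Local Notation Lh := (@Lh_op R M eps kappa sigma h).

Lemma Lh_linear : linear Lh.
Proof.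
move=> c v w; rewrite /Lh_op !grid_laplacianD !grid_laplacianZ.
by apply/matrixP => i j; rewrite !mxE; ring.
Qed.

HB.instance Definition _ := GRing.isLinear.Build R 'M[R]_M 'M[R]_M *:%R
  Lh Lh_linear.

Lemma Lh_sym v w : gsum (Lh v) w = gsum v (Lh w).
Proof.
rewrite /Lh_op -!scaleNr !gsumDl !gsumDr !gsumZl !gsumZr.
by rewrite !grid_laplacian_sym.
Qed.

Lemma Lh_coercive v : 0 < kappa ->
  eps ^+ 2 * gsum (grid_laplacian h v) (grid_laplacian h v) + sigma * gsum v v
    <= gsum (Lh v) v.
Proof.
move=> k0; rewrite /Lh_op -!scaleNr !gsumDl !gsumZl.
rewrite (grid_laplacian_sym _ (grid_laplacian h v)).
have : kappa * gsum (grid_laplacian h v) v <= 0.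
  by rewrite mulr_ge0_le0 ?grid_laplacian_le0// ltW.
lra.
Qed.

Lemma Lh_const c : Lh (const_mx c) = sigma *: const_mx c.
Proof.
by rewrite /Lh_op !grid_laplacian_const !scaler0 subr0 add0r.
Qed.

Lemma mxvec_Lh tau v : mxvec v *m (tau *: lin_mx Lh) = mxvec (tau *: Lh v).
Proof. by rewrite -scalemxAr mul_vec_lin linearZ. Qed.

Lemma Lh_posdefmx tau : 0 < kappa -> 0 < sigma -> 0 < tau ->
  posdefmx (tau *: lin_mx Lh).
Proof.
move=> k0 s0 t0; have vecE x : x = mxvec (vec_mx x : 'M[R]_M) by rewrite vec_mxK.
have dotE x y : dotr (x *m (tau *: lin_mx Lh)) y
    = tau * gsum (Lh (vec_mx x)) (vec_mx y).
  by rewrite {1}(vecE x) {1}(vecE y) mxvec_Lh -gsumE gsumZl.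
split.
- apply/matrixP => i j.
  have entry (B : 'M[R]_(M * M)) (a b : 'I_(M * M)) : B a b = dotr (delta_mx 0 a *m B) (delta_mx 0 b).
    rewrite -rowE /dotr (bigD1 b) //= !mxE !eqxx mulr1 big1 ?addr0// => k kb.
    by rewrite !mxE (negbTE kb) andbF mulr0.
  by rewrite mxE !(entry (tau *: _)) !dotE Lh_sym gsumC.
- move=> x x0; rewrite dotE pmulr_rgt0//.
  apply: lt_le_trans (Lh_coercive _ k0).
  apply: ltr_wpDl; first by rewrite mulr_ge0 ?sqr_ge0 ?gsum_ge0.
  by rewrite pmulr_rgt0// gsumE vec_mxK dotr_gt0.
Qed.

Lemma Lh_surj v : 0 < kappa -> 0 < sigma -> exists w, Lh w = v.
Proof.
move=> k0 s0; have [_ pA] := Lh_posdefmx k0 s0 ltr01.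
rewrite scale1r in pA.
have uA : lin_mx Lh \in unitmx.
  rewrite -row_free_unit -kermx_eq0; apply/rowV0P => x /sub_kermxP xA.
  apply/eqP; apply: contraT => /pA; rewrite xA.
  by rewrite /dotr big1 ?ltxx// => i _; rewrite mxE mul0r.
exists (vec_mx (mxvec v *m invmx (lin_mx Lh))); apply: (can_inj mxvecK).
by rewrite -mul_vec_lin vec_mxK mulmxKV.
Qed.

End semidiscrete.
End grid_operators.

(** * Mass conservation and stability of one ETD1 step *)

Section etd_step.
Variables (R : realType) (M : nat).
Variables (eps kappa sigma theta thetac h tau : R).
Implicit Types (u v w e g q : 'M[R]_M) (c : R).
Local Notation Lh := (@Lh_op R M eps kappa sigma h).
Local Notation op0 := (op_fun (@phi0 R) tau Lh).
Local Notation op1 := (op_fun (@phi1 R) tau Lh).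
Local Notation Fh := (@F_op R M theta thetac kappa sigma h).
Local Notation predict := (@ETD1_predict R M eps sigma theta thetac kappa h tau).

(** Contains the explicit half of the stabilization; with kappa = 0 it is the local, derivative-free
    part of the chemical potential. *)
Definition flux (a : R) : R :=
  theta / 2 * (ln (1 + a) - ln (1 - a)) - (thetac + kappa) * a.

Lemma F_opE v :
  Fh v = grid_laplacian h (map_mx flux v) + sigma *: const_mx (grid_mean v).
Proof.
rewrite /F_op; congr (_ + _).
rewrite -!grid_laplacianZ -!grid_laplacianB; congr grid_laplacian.
by apply/matrixP => i j; rewrite !mxE /flux; ring.
Qed.

Lemma op_funD f v w : op_fun f tau Lh (v + w) = op_fun f tau Lh v + op_fun f tau Lh w.
Proof. by rewrite /op_fun !linearD /= mulmxDl linearD. Qed.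

Lemma op_funZ f c v : op_fun f tau Lh (c *: v) = c *: op_fun f tau Lh v.
Proof. by rewrite /op_fun linearZ /= -scalemxAl linearZ. Qed.

Lemma op_funB f v w : op_fun f tau Lh (v - w) = op_fun f tau Lh v - op_fun f tau Lh w.
Proof. by rewrite op_funD -scaleN1r op_funZ scaleN1r. Qed.

Hypotheses (k0 : 0 < kappa) (s0 : 0 < sigma) (t0 : 0 < tau).
Let pA := @Lh_posdefmx R M eps kappa sigma h tau k0 s0 t0.

Lemma op_phi0E v : op0 v = v - tau *: op1 (Lh v).
Proof.
rewrite /op_fun (spectral_phi0E _ pA) linearB /= mxvecK mxvec_Lh.
by rewrite linearZ /= -scalemxAl linearZ.
Qed.

(** Substituting phi0(a) = 1 - a phi1(a) exhibits the predictor as an Euler step with a smoothed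
    right-hand side. Mass conservation and the truncation error are both read off this form. *)
Lemma ETD1_predictE v : predict v = v + tau *: op1 (Fh v - Lh v).
Proof. by rewrite /ETD1_predict op_phi0E op_funB scalerBr [RHS]addrA addrAC. Qed.

Lemma gsum_mean v : (0 < M)%N -> gsum v (const_mx 1) = M%:R ^+ 2 * grid_mean v.
Proof.
move=> M0; rewrite gsum1 /grid_mean natrX mulrC divfK//.
by rewrite expf_neq0// pnatr_eq0 -lt0n.
Qed.

Lemma gsum_const c d : gsum (const_mx c : 'M[R]_M) (const_mx d) = M%:R ^+ 2 * (c * d).
Proof.
rewrite /gsum (eq_bigr (fun=> \sum_(j < M) c * d)); last first.
  by move=> i _; apply: eq_bigr => j _; rewrite !mxE.
by rewrite !sumr_const !card_ord -mulrnA -[LHS]mulr_natl natrM expr2.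
Qed.

Lemma grid_meanD v w : grid_mean (v + w) = grid_mean v + grid_mean w.
Proof. by rewrite /grid_mean -!gsum1 gsumDl mulrDl. Qed.

Lemma grid_meanZ c v : grid_mean (c *: v) = c * grid_mean v.
Proof. by rewrite /grid_mean -!gsum1 gsumZl mulrA. Qed.

Lemma grid_meanB v w : grid_mean (v - w) = grid_mean v - grid_mean w.
Proof. by rewrite grid_meanD -scaleN1r grid_meanZ mulN1r. Qed.

Lemma grid_mean_const c : (0 < M)%N -> grid_mean (const_mx c : 'M[R]_M) = c.
Proof.
move=> M0; apply: (@mulfI _ (M%:R ^+ 2)); first by rewrite expf_neq0// pnatr_eq0 -lt0n.
by rewrite -gsum_mean// gsum_const mulr1.
Qed.

Lemma grid_mean_residual v : (0 < M)%N -> grid_mean (Fh v - Lh v) = 0.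
Proof.
move=> M0; rewrite grid_meanB F_opE /Lh_op -(scaleNr kappa).
rewrite !grid_meanD !grid_meanZ !grid_laplacian_mean grid_mean_const//; ring.
Qed.

(** Constants are eigenvectors of the symmetric [tau *: lin_mx Lh] for tau sigma, so phi1 only
    multiplies the mean of the residual by a scalar. That mean is zero: Laplacians have no mean and
    the two sigma terms cancel. *)
Lemma ETD1_predict_mass v : (0 < M)%N ->
  gsum (predict v) (const_mx 1) = gsum v (const_mx 1).
Proof.
move=> M0; rewrite ETD1_predictE gsumDl gsumZl; set q := _ - _.
suff -> : gsum (op1 q) (const_mx 1) = 0 by rewrite mulr0 addr0.
rewrite gsumE /op_fun vec_mxK (spectral_fun_sym _ _ _ pA).
rewrite (spectral_fun_eigen (l := tau * sigma) _ pA); last first.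
  by rewrite mxvec_Lh Lh_const scalerA linearZ.
by rewrite dotrZr -gsumE gsum_mean// grid_mean_residual// !mulr0.
Qed.

Lemma mxvec_etd e v : mxvec (op0 e + tau *: op1 v) =
  mxvec e *m spectral_fun (@phi0 R) (tau *: lin_mx Lh)
  + mxvec (tau *: v) *m spectral_fun (@phi1 R) (tau *: lin_mx Lh).
Proof.
have mxvecD (x y : 'M[R]_M) : mxvec (x + tau *: y) = mxvec x + tau *: mxvec y.
  by rewrite linearD linearZ.
have mxvecZ (y : 'M[R]_M) : mxvec (tau *: y) = tau *: mxvec y by rewrite linearZ.
rewrite mxvecD mxvecZ -scalemxAl.
congr (_ + _ *: _).
exact: vec_mxK.
exact: vec_mxK.
Qed.

Lemma ETD1_stable e g z : z = op0 e + tau *: op1 (grid_laplacian h g) -> 0 < eps ->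
  gsum z z <= gsum e e + tau / eps ^+ 2 * gsum g g.
Proof.
move=> zE e0; have [w wE] := Lh_surj eps h (grid_laplacian h g) k0 s0.
have zE' : mxvec z = mxvec e *m spectral_fun (@phi0 R) (tau *: lin_mx Lh)
    + mxvec w *m (tau *: lin_mx Lh) *m spectral_fun (@phi1 R) (tau *: lin_mx Lh).
  by rewrite zE mxvec_Lh wE mxvec_etd.
rewrite gsumE; apply: le_trans (etd_stable pA zE') _.
rewrite -gsumE mxvec_Lh -gsumE gsumZl lerD2l -mulrA ler_wpM2l ?(ltW t0)//.
have := Lh_coercive eps sigma h w k0.
have e2 : 0 < eps ^+ 2 by rewrite exprn_gt0.
rewrite wE (mulrC _^-1) ler_pdivlMr //.
have SE : gsum (grid_laplacian h g) w = gsum g (grid_laplacian h w).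
  exact: grid_laplacian_sym.
(* With S = <Delta_h g, w> = <g, Delta_h w>, this square gives 2 eps^2 S <= |g|^2 + eps^4 |Delta_h
   w|^2, and coercivity bounds the last term by eps^2 S. *)
have := gsum_ge0 (g - eps ^+ 2 *: grid_laplacian h w).
rewrite -scaleNr !gsumDl !gsumDr !gsumZl !gsumZr (gsumC (grid_laplacian h w) g) -SE.
have : 0 <= sigma * gsum w w by rewrite mulr_ge0 ?gsum_ge0// ltW.
move: (gsum (grid_laplacian h g) w) (gsum g g) (gsum w w) => S G W W0 young co.
have : eps ^+ 2 * (eps ^+ 2 * gsum (grid_laplacian h w) (grid_laplacian h w)) <= eps ^+ 2 * S.
  by rewrite ler_pM2l//; lra.
lra.
Qed.

Lemma ETD1_phi1_consistent q z : z = q - op1 q ->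
  gsum z z <= tau ^+ 2 * gsum (Lh q) (Lh q) /\ gsum z z <= gsum q q.
Proof.
move=> zE; have := etd_phi1_consistent (mxvec q) pA.
rewrite mxvec_Lh -[_ *m _]vec_mxK -/(op_fun _ _ _ _) -linearB -zE -!gsumE.
by rewrite /= -!gsumE gsumZl gsumZr [X in _ <= X /\ _ -> _]mulrA -expr2.
Qed.

(** The shift passes through the predictor unchanged: the loss tau phi1(A) (sigma c) of [op0] on the
    constant c is returned by the term sigma times the mean in [F_op]. Hence the remaining error e
    meets only the flux difference. *)
Lemma ETD1_predict_diff u w e c : (0 < M)%N ->
  c = grid_mean u - grid_mean w -> e = u - w - const_mx c ->
  predict u - predict w - const_mx c =
  op0 e + tau *: op1 (grid_laplacian h (map_mx flux u - map_mx flux w)).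
Proof.
move=> M0 cE eE; have -> : op0 e = op0 u - op0 w - const_mx c + tau *: op1 (sigma *: const_mx c).
  rewrite eE !op_funB [op0 (const_mx c)]op_phi0E Lh_const.
  by rewrite opprB addrA addrAC.
rewrite /ETD1_predict !F_opE grid_laplacianB.
have -> : const_mx c = const_mx (grid_mean u) - const_mx (grid_mean w) :> 'M[R]_M.
  by apply/matrixP => i j; rewrite !mxE cE.
rewrite !(op_funB, op_funD, op_funZ).
move: (const_mx (grid_mean u)) (const_mx (grid_mean w)) (op0 u) (op0 w)
  (op1 (const_mx (grid_mean u))) (op1 (const_mx (grid_mean w)))
  (op1 (grid_laplacian h (map_mx flux u))) (op1 (grid_laplacian h (map_mx flux w))).
move=> ? ? ? ? ? ? ? ?.
by apply/matrixP => i j; rewrite !mxE; ring.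
Qed.

End etd_step.

(** * Lipschitz bound for the flux away from the logarithmic singularities *)

Section flux_lipschitz.
Variable R : realType.
Implicit Types (x y d : R).

Lemma ln_lipschitz d x y : 0 < d -> d <= x -> d <= y ->
  `|ln x - ln y| <= `|x - y| / d.
Proof.
move=> d0; wlog xy : x y / y <= x => [H|] dx dy.
  by case: (leP y x) => [/H//|/ltW/H]; [exact|rewrite distrC (distrC x); exact].
have [x0 y0] := (lt_le_trans d0 dx, lt_le_trans d0 dy).
rewrite !ger0_norm ?subr_ge0 ?ler_ln ?posrE//.
rewrite -ln_div ?posrE//; have -> : x / y = 1 + (x - y) / y by field; rewrite gt_eqF.
have r0 : 0 <= (x - y) / y by rewrite divr_ge0 ?subr_ge0// ltW.
apply: le_trans (le_ln1Dx _) _; first lra.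
by rewrite ler_wpM2l ?subr_ge0// lef_pV2 ?posrE.
Qed.

Lemma flux_lipschitz theta thetac kappa d x y : 0 < theta -> 0 < thetac -> 0 < kappa ->
  0 < d -> `|x| <= 1 - d -> `|y| <= 1 - d ->
  `|flux kappa theta thetac x - flux kappa theta thetac y|
    <= (theta / d + thetac + kappa) * `|x - y|.
Proof.
move=> th0 tc0 k0 d0; rewrite (ler_norml x) (ler_norml y) => /andP[x1 x2] /andP[y1 y2].
have h1 := @ln_lipschitz d (1 + x) (1 + y) d0 ltac:(lra) ltac:(lra).
have h2 := @ln_lipschitz d (1 - x) (1 - y) d0 ltac:(lra) ltac:(lra).
have -> : flux kappa theta thetac x - flux kappa theta thetac y =
  theta / 2 * ((ln (1 + x) - ln (1 + y)) - (ln (1 - x) - ln (1 - y))) - (thetac + kappa) * (x - y).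
  by rewrite /flux; ring.
apply: le_trans (ler_normB _ _) _; have th2 : 0 <= theta / 2 by lra.
have tk : 0 <= thetac + kappa by lra.
rewrite (normrM (theta / 2)) (normrM (thetac + kappa)) (ger0_norm th2) (ger0_norm tk).
have e1 : 1 + x - (1 + y) = x - y by ring.
have e2 : 1 - x - (1 - y) = - (x - y) by ring.
rewrite e1 in h1; rewrite e2 normrN in h2.
have h3 : `|ln (1 + x) - ln (1 + y) - (ln (1 - x) - ln (1 - y))| <= 2 * (`|x - y| / d).
  by apply: le_trans (ler_normB _ _) _; lra.
have := ler_wpM2l th2 h3.
have -> : theta / 2 * (2 * (`|x - y| / d)) = theta / d * `|x - y| by field; rewrite gt_eqF.
lra.
Qed.

End flux_lipschitz.

(** * Convergence for grid-level data *)

Section grid_norms.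
Variables (R : realType) (M : nat).
Implicit Types (u v w : 'M[R]_M) (h c B : R).

Lemma grid_innerE h v w : grid_inner h v w = h ^+ 2 * gsum v w.
Proof. by []. Qed.

Lemma grid_norm_sqr h v : grid_norm h v ^+ 2 = h ^+ 2 * gsum v v.
Proof. by rewrite /grid_norm sqr_sqrtr// mulr_ge0 ?sqr_ge0 ?gsum_ge0. Qed.

Lemma grid_norm_ge0 h v : 0 <= grid_norm h v.
Proof. exact: sqrtr_ge0. Qed.

Lemma grid_normZ h c v : grid_norm h (c *: v) = `|c| * grid_norm h v.
Proof.
rewrite /grid_norm !grid_innerE gsumZl gsumZr.
have -> : h ^+ 2 * (c * (c * gsum v v)) = c ^+ 2 * (h ^+ 2 * gsum v v) by ring.
by rewrite sqrtrM ?sqr_ge0// sqrtr_sqr.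
Qed.

Lemma grid_normN h v : grid_norm h (- v) = grid_norm h v.
Proof. by rewrite -scaleN1r grid_normZ normrN1 mul1r. Qed.

Lemma gsum_sqrD v w c : gsum (v + c *: w) (v + c *: w) =
  gsum v v + 2 * c * gsum v w + c ^+ 2 * gsum w w.
Proof. rewrite !gsumDl !gsumDr !gsumZl !gsumZr (gsumC w v); ring. Qed.

Lemma gsum_cauchy_schwarz v w : gsum v w ^+ 2 <= gsum v v * gsum w w.
Proof.
have [w0|w0] := eqVneq (gsum w w) 0.
  have Q t : 0 <= gsum v v + 2 * t * gsum v w.
    have := gsum_ge0 (v + t *: w).
    rewrite !gsumDl !gsumDr !gsumZl !gsumZr w0 (gsumC w v); lra.
  have [->|P0] := eqVneq (gsum v w) 0; first by rewrite w0 mulr0 expr0n.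
  (* At this t the affine function of t that [Q] declares nonnegative takes the value -1. *)
  have := Q (- (gsum v v + 1) / (2 * gsum v w)).
  have -> : 2 * (- (gsum v v + 1) / (2 * gsum v w)) * gsum v w = - (gsum v v + 1) by field.
  by rewrite opprD addNKr oppr_ge0 ler10.
have w1 : 0 < gsum w w by rewrite lt_neqAle eq_sym w0 gsum_ge0.
have := gsum_ge0 (gsum w w *: v - gsum v w *: w).
rewrite -scaleNr !gsumDl !gsumDr !gsumZl !gsumZr (gsumC w v) => H.
have : 0 <= gsum w w * (gsum v v * gsum w w - gsum v w ^+ 2) by lra.
by rewrite pmulr_rge0// subr_ge0.
Qed.

Lemma grid_normD h v w : grid_norm h (v + w) <= grid_norm h v + grid_norm h w.
Proof.
rewrite -(@ler_sqr R) ?nnegrE ?addr_ge0 ?grid_norm_ge0// sqrrD !grid_norm_sqr.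
rewrite !gsumDl !gsumDr (gsumC w v).
suff : h ^+ 2 * gsum v w <= grid_norm h v * grid_norm h w by lra.
apply: le_trans (ler_norm _) _.
rewrite -(@ler_sqr R) ?nnegrE ?mulr_ge0 ?grid_norm_ge0// real_normK ?num_real//.
rewrite exprMn [leRHS]exprMn !grid_norm_sqr.
have := ler_wpM2l (exprn_ge0 2 (sqr_ge0 h)) (gsum_cauchy_schwarz v w); lra.
Qed.

Lemma grid_normB h v w : grid_norm h (v - w) <= grid_norm h v + grid_norm h w.
Proof. by apply: le_trans (grid_normD _ _ _) _; rewrite grid_normN. Qed.

Lemma grid_norm_const h c : grid_norm h (const_mx c : 'M[R]_M) = `|h * M%:R * c|.
Proof.
rewrite /grid_norm grid_innerE gsum_const -sqrtr_sqr; congr Num.sqrt; ring.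
Qed.

Lemma gsum_le v w : (forall i j, `|v i j| <= `|w i j|) -> gsum v v <= gsum w w.
Proof.
move=> vw; apply: ler_sum => i _; apply: ler_sum => j _.
by rewrite -!expr2 -real_normK ?num_real// -[leRHS]real_normK ?num_real// ler_sqr ?nnegrE.
Qed.

Lemma grid_norm_le h v w : (forall i j, `|v i j| <= `|w i j|) ->
  grid_norm h v <= grid_norm h w.
Proof.
by move=> vw; rewrite ler_wsqrtr// !grid_innerE ler_wpM2l ?sqr_ge0 ?gsum_le.
Qed.

Lemma grid_norm_sup h v B : 0 <= B -> (forall i j, `|v i j| <= B) ->
  grid_norm h v <= `|h * M%:R| * B.
Proof.
move=> B0 vB; rewrite -[X in _ <= _ * X](ger0_norm B0) -normrM -grid_norm_const.
by apply: grid_norm_le => i j; rewrite mxE (ger0_norm B0).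
Qed.

(** Inverse estimate: a single mesh value carries the weight h^2. It costs a factor 1/h, so a grid
    norm of order h^2 still forces smallness at every mesh point. *)
Lemma grid_norm_entry h v i j : `|h| * `|v i j| <= grid_norm h v.
Proof.
rewrite -normrM -sqrtr_sqr ler_wsqrtr// exprMn ler_wpM2l ?sqr_ge0//.
rewrite /gsum (bigD1 i)//= (bigD1 j)//= expr2 -addrA lerDl.
by rewrite addr_ge0// ?sumr_ge0// => k _; rewrite ?sumr_ge0// -?expr2 ?sqr_ge0// => l _;
  rewrite -expr2 sqr_ge0.
Qed.

Lemma grid_mean_le h v : 0 < h * M%:R -> (0 < M)%N ->
  `|grid_mean v| * (h * M%:R) <= grid_norm h v.
Proof.
move=> L0 M0; have lhs0 : 0 <= `|grid_mean v| * (h * M%:R) by apply: mulr_ge0 => //; exact: ltW.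
rewrite -(@ler_sqr R) ?nnegrE ?grid_norm_ge0//.
rewrite grid_norm_sqr.
rewrite [leLHS]exprMn real_normK ?num_real// [X in _ * X]exprMn mulrCA.
rewrite ler_wpM2l ?sqr_ge0//.
have := gsum_cauchy_schwarz v (const_mx 1).
rewrite gsum_mean// gsum_const mulr1 mulr1 exprMn.
have M2 : (0 : R) < M%:R ^+ 2 by rewrite exprn_gt0// ltr0n.
have -> : (M%:R ^+ 2) ^+ 2 * grid_mean v ^+ 2 = (grid_mean v ^+ 2 * M%:R ^+ 2) * M%:R ^+ 2 by ring.
by rewrite ler_pM2r.
Qed.

Lemma grid_norm_inftyP v B : 0 <= B ->
  grid_norm_infty v <= B <-> forall i j, `|v i j| <= B.
Proof.
move=> B0; split=> [H i j|H].
  apply: le_trans H; rewrite /grid_norm_infty.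
  apply: le_trans (le_bigmax _ _ i) => /=.
  exact: (le_bigmax _ (fun j => `|v i j|) j).
by apply: bigmax_le => // i _; apply: bigmax_le => // j _; exact: H.
Qed.

Lemma is_correction_nonexpansive h delta util w phi :
  is_correction h delta util w -> admissible h delta util phi ->
  grid_norm h (w - phi) <= grid_norm h (util - phi).
Proof.
move=> [[wb wm] opt] [pb pm].
have d1 : 0 <= 1 - delta.
  by apply: le_trans wb; exact: bigmax_ge_id.
move/(grid_norm_inftyP _ d1) : wb => wb; move/(grid_norm_inftyP _ d1) : pb => pb.
(* Minimality of [w] compared with the point at parameter s of the segment from [w] to [phi], which
   is admissible by convexity. *)
have key s : 0 <= s -> s <= 1 ->
    0 <= 2 * s * gsum (w - util) (phi - w) * h ^+ 2 + s ^+ 2 * gsum (phi - w) (phi - w) * h ^+ 2.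
  move=> s0 s1.
  have adm : admissible h delta util (w + s *: (phi - w)).
    split.
      apply/(grid_norm_inftyP _ d1) => i j; rewrite !mxE.
      have -> : w i j + s * (phi i j - w i j) = (1 - s) * w i j + s * phi i j by ring.
      apply: le_trans (ler_normD _ _) _; rewrite !normrM (ger0_norm s0) ger0_norm ?subr_ge0//.
      have := ler_wpM2l s0 (pb i j).
      have := ler_wpM2l (_ : 0 <= 1 - s) (wb i j); rewrite subr_ge0 s1 => /(_ isT).
      lra.
    rewrite -scaleN1r !grid_innerE !gsumDl !gsumZl gsumDl gsumZl.
    rewrite !grid_innerE in wm pm.
    have : s * (h ^+ 2 * gsum phi (const_mx 1)) = s * (h ^+ 2 * gsum w (const_mx 1)).
      by rewrite pm wm.
    lra.
  have := opt _ adm; rewrite !grid_norm_sqr.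
  have -> : w + s *: (phi - w) - util = (w - util) + s *: (phi - w) by rewrite addrAC.
  rewrite gsum_sqrD; lra.
rewrite ler_wsqrtr// !grid_innerE.
have E : gsum (util - phi) (util - phi) = gsum (w - phi) (w - phi)
    + gsum (w - util) (w - util) + 2 * gsum (w - util) (phi - w).
  have -> : util - phi = - (1 : R) *: ((w - util) + (phi - w)).
    by rewrite scaleN1r opprD !opprB addrC addrA subrK addrC.
  have -> : w - phi = - (1 : R) *: (phi - w) by rewrite scaleN1r opprB.
  rewrite !gsumZl !gsumZr -[X in gsum (_ + X)]scale1r -[X in gsum _ (_ + X)]scale1r gsum_sqrD; ring.
rewrite E; set I := gsum (w - util) (phi - w) in key E *.
suff : 0 <= h ^+ 2 * I.
  by have := mulr_ge0 (sqr_ge0 h) (gsum_ge0 (w - util)); lra.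
rewrite leNgt; apply/negP => I0.
set G := gsum (phi - w) (phi - w) in key.
have G0 : 0 <= h ^+ 2 * G by rewrite mulr_ge0 ?sqr_ge0 ?gsum_ge0.
(* If h^2 I were negative, this s would make the linear term beat the quadratic one: s h^2 G <= -
   h^2 I - s. The 1 in the denominator covers G = 0. *)
pose s := Num.min 1 (- (h ^+ 2 * I) / (h ^+ 2 * G + 1)).
have D1 : 0 < h ^+ 2 * G + 1 by lra.
have s0 : 0 < s by rewrite lt_min ltr01 divr_gt0// oppr_gt0.
have s1 : s <= 1 by rewrite ge_min lexx.
have s2 : s * (h ^+ 2 * G + 1) <= - (h ^+ 2 * I).
  by rewrite -ler_pdivlMr// ge_min lexx orbT.
have := key s (ltW s0) s1.
have -> : 2 * s * I * h ^+ 2 + s ^+ 2 * G * h ^+ 2 = s * (2 * (h ^+ 2 * I) + s * (h ^+ 2 * G)) by ring.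
rewrite pmulr_rge0//; nra.
Qed.

End grid_norms.

(** * Error recursion and discrete Gronwall argument *)

Section grid_convergence.
Variable R : realType.

Section one_step.
Variables (M : nat) (L eps sigma theta thetac kappa delta tau B : R).
Let h : R := L / M%:R.
Local Notation N := (grid_norm h).
Local Notation Lh := (@Lh_op R M eps kappa sigma h).
Local Notation Fh := (@F_op R M theta thetac kappa sigma h).
Local Notation predict := (@ETD1_predict R M eps sigma theta thetac kappa h tau).
Local Notation op1 := (op_fun (@phi1 R) tau Lh).
Implicit Types (u w dw e : 'M[R]_M) (c : R).

Hypotheses (M0 : (0 < M)%N) (L0 : 0 < L) (eps0 : 0 < eps) (sigma0 : 0 < sigma)
  (theta0 : 0 < theta) (thetac0 : 0 < thetac) (kappa0 : 0 < kappa)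
  (delta0 : 0 < delta) (tau0 : 0 < tau) (B0 : 0 <= B).

Lemma mesh_size : `|h * M%:R| = L.
Proof. by rewrite /h divfK ?pnatr_eq0 -?lt0n// gtr0_norm. Qed.

Lemma grid_norm_sup_mesh (v : 'M[R]_M) b : 0 <= b -> (forall i j, `|v i j| <= b) -> N v <= L * b.
Proof. by move=> b0 vb; rewrite -{1}mesh_size grid_norm_sup. Qed.

Lemma grid_norm_const_mesh c : N (const_mx c : 'M[R]_M) = L * `|c|.
Proof. by rewrite grid_norm_const normrM mesh_size. Qed.

Lemma op_phi1_consistent_norm q :
  N (q - op1 q) <= tau * N (Lh q) /\ N (q - op1 q) <= N q.
Proof.
have [H1 H2] := ETD1_phi1_consistent kappa0 sigma0 tau0 (erefl (q - op1 q)).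
split.
  rewrite -{2}(gtr0_norm tau0) -grid_normZ /grid_norm !grid_innerE ler_wsqrtr//.
  by rewrite ler_wpM2l ?sqr_ge0// gsumZl gsumZr mulrA -expr2.
by rewrite /grid_norm !grid_innerE ler_wsqrtr// ler_wpM2l ?sqr_ge0.
Qed.

Lemma truncation_error w w1 dw :
  (forall i j, `|(w1 - w - tau *: dw) i j| <= B * tau ^+ 2) ->
  (forall i j, `|(dw - (Fh w - Lh w)) i j| <= B * h ^+ 2) ->
  (forall i j, `|(Lh dw) i j| <= B) ->
  N (predict w - w1) <= 2 * L * B * tau * (tau + h ^+ 2).
Proof.
move=> H1 H2 H3; rewrite ETD1_predictE//.
set q := Fh w - Lh w in H2 *.
have [r rE] : exists r, r = dw - q by exists (dw - q).
rewrite -rE in H2; have qE : q = dw - r by rewrite rE opprB addrC subrK.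
(* The gap q - phi1(A) q is split because only [Lh dw] is under control; applying [Lh] to the defect
   r could cost negative powers of h. *)
have -> : w + tau *: op1 q - w1 =
    - (w1 - w - tau *: dw) - tau *: ((dw - op1 dw) - (r - op1 r) + r).
  rewrite {1}qE op_funB.
  move: (op1 dw) (op1 r) => a b.
  by apply/matrixP => i j; rewrite !mxE; ring.
apply: le_trans (grid_normB _ _ _) _; rewrite grid_normN grid_normZ (gtr0_norm tau0).
have N1 := grid_norm_sup_mesh (mulr_ge0 B0 (sqr_ge0 tau)) H1.
have Nr := grid_norm_sup_mesh (mulr_ge0 B0 (sqr_ge0 h)) H2.
have Nl := grid_norm_sup_mesh B0 H3.
have [A1 _] := op_phi1_consistent_norm dw.
have [_ A2] := op_phi1_consistent_norm r.
have A1' : N (dw - op1 dw) <= tau * (L * B) by apply: le_trans A1 _; rewrite ler_pM2l.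
have T1 := grid_normD h (dw - op1 dw - (r - op1 r)) r.
have T2 := grid_normB h (dw - op1 dw) (r - op1 r).
have : tau * N (dw - op1 dw - (r - op1 r) + r) <= tau * (tau * (L * B) + 2 * (L * (B * h ^+ 2))).
  rewrite ler_pM2l//; lra.
lra.
Qed.

Lemma grid_mean_constB u w c : c = grid_mean u - grid_mean w -> grid_mean (w + const_mx c) = grid_mean u.
Proof. by move=> ->; rewrite grid_meanD grid_mean_const// addrC subrK. Qed.

(** The flux sees u - w = e + c rather than e, so the shift reappears as a source of size B h^2. The
    factor 2 comes from (x + y)^2 <= 2 x^2 + 2 y^2. *)
Lemma nonlinear_stability u w c :
  (forall i j, `|u i j| <= 1 - delta) -> (forall i j, `|w i j| <= 1 - delta) ->
  c = grid_mean u - grid_mean w -> `|c| <= B * h ^+ 2 ->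
  N (predict u - predict w - const_mx c) ^+ 2 <=
  (1 + 2 * (theta / delta + thetac + kappa) ^+ 2 / eps ^+ 2 * tau)
    * N (u - w - const_mx c) ^+ 2
  + 2 * (theta / delta + thetac + kappa) ^+ 2 / eps ^+ 2 * tau
    * (L ^+ 2 * B ^+ 2) * (tau + h ^+ 2) ^+ 2.
Proof.
move=> ub wb cE cB; have [K KE] : exists K, K = theta / delta + thetac + kappa by eexists.
rewrite -KE; have K0 : 0 <= K by rewrite KE !addr_ge0 ?divr_ge0 ?ltW.
set e := u - w - const_mx c.
set g := map_mx (flux kappa theta thetac) u - map_mx (flux kappa theta thetac) w.
have zE := ETD1_predict_diff eps theta thetac h kappa0 sigma0 tau0 M0 cE (erefl e).
have := ETD1_stable kappa0 sigma0 tau0 zE eps0 => /(ler_wpM2l (sqr_ge0 h)).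
rewrite -grid_norm_sqr mulrDr -grid_norm_sqr mulrCA -grid_norm_sqr -/g => H.
have Ng : N g <= K * (N e + L * (B * h ^+ 2)).
  have uwE : N (u - w) <= N e + L * (B * h ^+ 2).
    have -> : u - w = e + const_mx c by rewrite /e subrK.
    apply: le_trans (grid_normD _ _ _) _; rewrite lerD2l grid_norm_const_mesh.
    by rewrite ler_pM2l.
  apply: le_trans (ler_wpM2l K0 uwE).
  rewrite -[X in _ <= X * _](ger0_norm K0) -grid_normZ; apply: grid_norm_le => i j.
  rewrite !mxE [leRHS]normrM (ger0_norm K0) KE.
  exact: flux_lipschitz.
have Ng2 : N g ^+ 2 <= 2 * K ^+ 2 * (N e ^+ 2 + L ^+ 2 * B ^+ 2 * (tau + h ^+ 2) ^+ 2).
  have Ne0 := grid_norm_ge0 h e; have h2 := sqr_ge0 h.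
  have LB : 0 <= L * B by rewrite mulr_ge0// ltW.
  have b1 : L * (B * h ^+ 2) <= L * B * (tau + h ^+ 2).
    by rewrite mulrA ler_wpM2l// lerDr ltW.
  have b2 : N g <= K * (N e + L * B * (tau + h ^+ 2)).
    by apply: le_trans Ng _; rewrite ler_wpM2l// lerD2l.
  have b3 : N g ^+ 2 <= (K * (N e + L * B * (tau + h ^+ 2))) ^+ 2.
    by rewrite ler_sqr ?nnegrE ?grid_norm_ge0//; apply: le_trans b2; exact: grid_norm_ge0.
  apply: le_trans b3 _; have := mulr_ge0 (sqr_ge0 K) (sqr_ge0 (N e - L * B * (tau + h ^+ 2))).
  lra.
apply: le_trans H _.
have e2 : 0 < eps ^+ 2 by rewrite exprn_gt0.
have te : 0 <= tau / eps ^+ 2 by rewrite divr_ge0 ?ltW.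
have := ler_wpM2l te Ng2.
set Q := (N e ^+ 2 + _).
have -> : tau / eps ^+ 2 * (2 * K ^+ 2 * Q) = 2 * K ^+ 2 / eps ^+ 2 * tau * Q.
  by field; rewrite gt_eqF.
rewrite /Q; set a := _ / _ * tau; lra.
Qed.

(* a is the squared Lipschitz constant of the nonlinear flux divided by eps^2, the
   smoothing gain of phi1(tau L_h) Delta_h. *)
Lemma error_recursion u un w w1 dw c c1 :
  let rho := tau + h ^+ 2 in
  let a := 2 * (theta / delta + thetac + kappa) ^+ 2 / eps ^+ 2 in
  tau <= 1 -> B * h ^+ 2 <= delta ->
  is_correction h delta (predict u) un ->
  (forall i j, `|u i j| <= 1 - delta) ->
  (forall i j, `|w i j| <= 1 - 2 * delta) -> (forall i j, `|w1 i j| <= 1 - 2 * delta) ->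
  c = grid_mean u - grid_mean w -> `|c| <= B * h ^+ 2 ->
  c1 = grid_mean u - grid_mean w1 -> `|c1| <= B * h ^+ 2 ->
  `|c - c1| <= B * tau * h ^+ 2 ->
  (forall i j, `|(w1 - w - tau *: dw) i j| <= B * tau ^+ 2) ->
  (forall i j, `|(dw - (Fh w - Lh w)) i j| <= B * h ^+ 2) ->
  (forall i j, `|(Lh dw) i j| <= B) ->
  N (un - w1 - const_mx c1) ^+ 2 <=
    (1 + (1 + 2 * a) * tau) * N (u - w - const_mx c) ^+ 2
    + (1 + 2 * a) * tau * (19 * L ^+ 2 * B ^+ 2) * rho ^+ 2.
Proof.
move=> rho a t1 Bd corr ub wb w1b cE cB c1E c1B ccB H1 H2 H3.
have a0 : 0 <= a.
  by rewrite /a mulr_ge0 ?invr_ge0 ?sqr_ge0// mulr_ge0 ?sqr_ge0.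
have rho0 : 0 <= rho by rewrite addr_ge0 ?sqr_ge0 ?ltW.
have adm : admissible h delta (predict u) (w1 + const_mx c1).
  have d1 : 0 <= 1 - delta.
    by case: corr => -[+ _] _; apply: le_trans; exact: bigmax_ge_id.
  split.
    apply/(grid_norm_inftyP _ d1) => i j; rewrite !mxE.
    apply: le_trans (ler_normD _ _) _; apply: le_trans (lerD (w1b i j) c1B) _. lra.
  rewrite !grid_innerE ETD1_predict_mass// !gsum_mean//.
  by rewrite (grid_mean_constB c1E).
have := is_correction_nonexpansive corr adm; rewrite !opprD !addrA => nonexp.
have d0 := delta0.
have wb' i j : `|w i j| <= 1 - delta by apply: le_trans (wb i j) _; lra.
have zB := nonlinear_stability ub wb' cE cB.
rewrite -/a -/rho in zB; set z := predict u - predict w - const_mx c in zB.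
have yB := truncation_error H1 H2 H3; rewrite -/rho in yB.
(* Everything that does not depend on the numerical error: the truncation error and the change of
   the shift over one step. Both carry a factor tau. *)
set y := (predict w - w1) + const_mx (c - c1).
have yN : N y <= 3 * L * B * tau * rho.
  apply: le_trans (grid_normD _ _ _) _; rewrite grid_norm_const_mesh.
  have : L * `|c - c1| <= L * (B * tau * h ^+ 2) by rewrite ler_pM2l.
  have : 0 <= L * B * tau ^+ 2 by rewrite mulr_ge0 ?sqr_ge0// mulr_ge0// ltW.
  by rewrite /rho in yB *; lra.
have zyE : predict u - w1 - const_mx c1 = z + y.
  rewrite /z /y; move: (predict u) (predict w) => a1 a2.
  by apply/matrixP => i j; rewrite !mxE; ring.
rewrite zyE in nonexp.
have N1 : N (un - w1 - const_mx c1) ^+ 2 <= (N z + N y) ^+ 2.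
  rewrite ler_sqr ?nnegrE ?addr_ge0 ?grid_norm_ge0//.
  exact: le_trans nonexp (grid_normD _ _ _).
apply: le_trans N1 _.
have [Nz0 Ny0] := (grid_norm_ge0 h z, grid_norm_ge0 h y).
have tau0' := ltW tau0.
have [Y YE] : exists Y, Y = 3 * L * B * rho by eexists.
have Y0 : 0 <= Y by rewrite YE; do 3 apply: mulr_ge0 => //; exact: ltW.
have yN' : N y <= tau * Y by rewrite YE; lra.
have Ny2 : N y ^+ 2 <= tau * Y ^+ 2.
  have : N y ^+ 2 <= (tau * Y) ^+ 2 by rewrite ler_sqr ?nnegrE ?mulr_ge0.
  have : (tau * Y) ^+ 2 <= tau * Y ^+ 2.
    by rewrite exprMn ler_wpM2r ?sqr_ge0// expr2 ler_piMl.
  lra.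
(* Because N y carries a factor tau, Young's inequality weighted by tau only multiplies N z ^ 2 by 1
   + tau; the unweighted one would double the error at each step. *)
have cross : 2 * (N z * N y) <= tau * (N z ^+ 2 + Y ^+ 2).
  have : N z * N y <= N z * (tau * Y) by rewrite ler_wpM2l.
  have := mulr_ge0 tau0' (sqr_ge0 (N z - Y)); lra.
have step : (N z + N y) ^+ 2 <= (1 + tau) * N z ^+ 2 + 2 * tau * Y ^+ 2 by lra.
apply: le_trans step _.
have t10 : 0 <= 1 + tau by lra.
have zB' := ler_wpM2l t10 zB.
set E := N (u - w - const_mx c) ^+ 2 in zB' *.
have E0 : 0 <= E := sqr_ge0 _.
have [q qE] : exists q, q = L ^+ 2 * B ^+ 2 * rho ^+ 2 by eexists.
have q0 : 0 <= q by rewrite qE; do 2 (apply: mulr_ge0; last exact: sqr_ge0); exact: sqr_ge0.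
(* Here 2 Y^2 = 18 q, and the source of the stability bound adds at most 2 a q; 19 (1 + 2 a) q
   covers both. *)
have Y2 : Y ^+ 2 = 9 * q by rewrite YE qE; ring.
rewrite Y2; have zB2 : (1 + tau) * N z ^+ 2 <= (1 + tau) * ((1 + a * tau) * E + a * tau * q).
  by apply: le_trans zB' _; rewrite qE; lra.
have -> : (1 + 2 * a) * tau * (19 * L ^+ 2 * B ^+ 2) * rho ^+ 2 = (1 + 2 * a) * tau * 19 * q.
  by rewrite qE; ring.
have at0 : 0 <= a * tau by rewrite mulr_ge0.
have t2 : a * tau * tau <= a * tau by rewrite ler_piMr.
have := ler_wpM2r E0 t2; have := ler_wpM2r q0 t2.
have := mulr_ge0 at0 q0; have := mulr_ge0 tau0' q0; have := mulr_ge0 tau0' E0.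
lra.
Qed.

End one_step.

(** The differential equation is absent here: [W] and [W'] are arbitrary sequences of grid
    functions, and the exact solution is represented only by B. As [C] is chosen before [M] and
    [tau], uniformity in the mesh reduces to finding one B for all meshes. *)
Theorem grid_convergence (L T eps sigma theta thetac kappa delta B : R) :
  0 < L -> 0 < eps -> 0 < sigma -> 0 < theta -> 0 < thetac -> 0 < kappa ->
  0 < delta -> 0 <= B ->
  exists2 C : R, 0 < C &
  forall (M : nat) (tau : R) (un W W' : nat -> 'M[R]_M),
  let h := L / M%:R in
  (0 < M)%N -> 0 < tau -> tau <= 1 -> B * h ^+ 2 <= delta ->
  is_PETD1 eps sigma theta thetac kappa delta h tau un ->
  (forall i j, `|un 0%N i j| <= 1 - delta) ->
  grid_norm h (un 0%N - W 0%N) <= B * h ^+ 2 ->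
  (forall n, n%:R * tau <= T ->
     (forall i j, `|W n i j| <= 1 - 2 * delta) /\ `|grid_mean (un 0%N) - grid_mean (W n)| <= B * h ^+ 2) ->
  (forall n, n.+1%:R * tau <= T ->
     [/\ forall i j, `|(W n.+1 - W n - tau *: W' n) i j| <= B * tau ^+ 2,
         forall i j, `|(W' n - (F_op theta thetac kappa sigma h (W n)
                                - Lh_op eps kappa sigma h (W n))) i j| <= B * h ^+ 2,
         forall i j, `|(Lh_op eps kappa sigma h (W' n)) i j| <= B &
         `|grid_mean (W n.+1) - grid_mean (W n)| <= B * tau * h ^+ 2]) ->
  forall n, n%:R * tau <= T -> grid_norm h (un n - W n) <= C * (tau + h ^+ 2).
Proof.
move=> L0 eps0 sigma0 theta0 thetac0 kappa0 delta0 B0.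
pose a := 2 * (theta / delta + thetac + kappa) ^+ 2 / eps ^+ 2.
pose b := 1 + 2 * a; pose Q := 19 * L ^+ 2 * B ^+ 2.
(* [X0] bounds the initial value of [E n + Q * rho ^+ 2] in units of rho^2; (1 + L) B accounts for
   the initial error and the shift. The 1 in [C1] replaces a square root, by x <= (x + 1)^2, and the
   later summand L B restores the shift at the end. *)
pose X0 := (1 + L) ^+ 2 * B ^+ 2 + Q.
pose C1 := expR (b * `|T|) * X0 + 1.
have a0 : 0 <= a by rewrite /a mulr_ge0 ?invr_ge0 ?sqr_ge0// mulr_ge0 ?sqr_ge0.
have b0 : 0 <= b by rewrite /b; lra.
have Q0 : 0 <= Q by do 2 (apply: mulr_ge0; last exact: sqr_ge0).
have X00 : 0 <= X0 by apply: addr_ge0 => //; apply: mulr_ge0; exact: sqr_ge0.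
have C10 : 0 <= expR (b * `|T|) * X0 by rewrite mulr_ge0 ?expR_ge0.
have LB0 : 0 <= L * B by rewrite mulr_ge0// ltW.
exists (C1 + L * B); first by rewrite /C1; lra.
move=> M tau un W W' h M0 tau0 tau1 Bd scheme u0b u0W HW Hstep.
have tau0' := ltW tau0.
pose c n := grid_mean (un 0%N) - grid_mean (W n).
pose rho := tau + h ^+ 2.
have h2 : h ^+ 2 <= rho by rewrite lerDr.
have rho0 : 0 <= rho by rewrite addr_ge0 ?sqr_ge0.
pose E n := grid_norm h (un n - W n - const_mx (c n)) ^+ 2.
have mass n : grid_mean (un n) = grid_mean (un 0%N).
  elim: n => // n <-; have [[_ /eqP]] := scheme n.
  rewrite !grid_innerE ETD1_predict_mass// => /eqP Hm _.
  rewrite /grid_mean -!gsum1; congr (_ / _); apply: mulfI Hm.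
  by rewrite expf_neq0// mulf_neq0 ?invr_eq0 ?gt_eqF// ltr0n.
have ub n : forall i j, `|un n i j| <= 1 - delta.
  case: n => // n; have [[wb _] _] := scheme n.
  have d1 : 0 <= 1 - delta by apply: le_trans wb; exact: bigmax_ge_id.
  exact/(grid_norm_inftyP _ d1).
have lastT n : n.+1%:R * tau <= T -> n%:R * tau <= T.
  by apply: le_trans; rewrite ler_pM2r// ler_nat.
(* The source of the recursion is b tau Q rho^2, so adding the fixed quantity Q rho^2 makes the
   recursion homogeneous. *)
have recE n : n.+1%:R * tau <= T -> E n.+1 + Q * rho ^+ 2 <= (1 + b * tau) * (E n + Q * rho ^+ 2).
  move=> nT; have [wb cB] := HW n (lastT n nT); have [w1b c1B] := HW n.+1 nT.
  have [H1 H2 H3 H4] := Hstep n nT.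
  have cc : `|c n - c n.+1| <= B * tau * h ^+ 2.
    by have -> : c n - c n.+1 = grid_mean (W n.+1) - grid_mean (W n) by rewrite /c; ring.
  have cE : c n = grid_mean (un n) - grid_mean (W n) by rewrite mass.
  have c1E : c n.+1 = grid_mean (un n) - grid_mean (W n.+1) by rewrite mass.
  have := @error_recursion M L eps sigma theta thetac kappa delta tau B M0 L0 eps0
    sigma0 theta0 thetac0 kappa0 delta0 tau0 B0 (un n) (un n.+1) (W n) (W n.+1) (W' n) (c n) (c n.+1)
    tau1 Bd (scheme n) (ub n) wb w1b cE cB c1E c1B cc H1 H2 H3.
  rewrite -/h -/(E _) -/(E _) -/rho -/a -/b -/Q; lra.
have powE n : n%:R * tau <= T -> E n + Q * rho ^+ 2 <= expR (b * (n%:R * tau)) * (X0 * rho ^+ 2).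
  elim: n => [T0|n IH nT].
    rewrite mul0r mulr0 expR0 mul1r /X0 mulrDl lerD2r /E.
    have [_ c0] := HW 0%N T0.
    have e0 : grid_norm h (un 0%N - W 0%N - const_mx (c 0%N)) <= (1 + L) * B * rho.
      apply: le_trans (grid_normB _ _ _) _; rewrite (grid_norm_const_mesh M0 L0).
      have := ler_wpM2l (ltW L0) c0; have := ler_wpM2l B0 h2; have := ler_wpM2l LB0 h2.
      rewrite /c; lra.
    apply: (@le_trans _ _ (((1 + L) * B * rho) ^+ 2)); last by rewrite !exprMn.
    rewrite ler_sqr ?nnegrE ?grid_norm_ge0//.
    by apply: le_trans e0; exact: grid_norm_ge0.
  apply: le_trans (recE n nT) _.
  have bt : 0 <= 1 + b * tau by rewrite addr_ge0// mulr_ge0.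
  apply: le_trans (ler_wpM2l bt (IH (lastT n nT))) _.
  have Xr0 : 0 <= X0 * rho ^+ 2 by apply: mulr_ge0 => //; exact: sqr_ge0.
  rewrite [leLHS]mulrA; apply: ler_wpM2r => //.
  have -> : b * (n.+1%:R * tau) = b * tau + b * (n%:R * tau) by rewrite -natr1; ring.
  by rewrite expRD ler_wpM2r ?expR_ge0// expR_ge1Dx.
move=> n nT; have En := powE n nT.
have ET : E n <= (C1 * rho) ^+ 2.
  have : expR (b * (n%:R * tau)) * (X0 * rho ^+ 2) <= expR (b * `|T|) * (X0 * rho ^+ 2).
    have Xr0 : 0 <= X0 * rho ^+ 2 by apply: mulr_ge0 => //; exact: sqr_ge0.
    rewrite ler_wpM2r// ler_expR ler_wpM2l//.
    exact: le_trans nT (ler_norm _).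
  have : 0 <= Q * rho ^+ 2 by apply: mulr_ge0 => //; exact: sqr_ge0.
  have : expR (b * `|T|) * X0 * rho ^+ 2 <= C1 ^+ 2 * rho ^+ 2.
    by rewrite ler_wpM2r ?sqr_ge0// /C1; nra.
  rewrite exprMn; lra.
have C1r : 0 <= C1 * rho by rewrite mulr_ge0// /C1; lra.
have eN : grid_norm h (un n - W n - const_mx (c n)) <= C1 * rho.
  by rewrite -(@ler_sqr R) ?nnegrE ?grid_norm_ge0.
have [_ cB] := HW n nT.
have -> : un n - W n = (un n - W n - const_mx (c n)) + const_mx (c n) by rewrite subrK.
apply: le_trans (grid_normD _ _ _) _; rewrite (grid_norm_const_mesh M0 L0).
rewrite -/(c n) in cB; rewrite -/rho; have := ler_wpM2l (ltW L0) cB; have := ler_wpM2l LB0 h2; lra.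
Qed.

End grid_convergence.

(** * Families with uniformly bounded derivatives *)

Section bounded_derivatives.
Variable R : realType.

Implicit Types (f g : R -> R) (x a b c : R).

Lemma is_derive_derive1 f x a : is_derive x 1 f a -> derive1 f x = a.
Proof. by move=> H; rewrite derive1E; exact: derive_val. Qed.

Lemma derivable_is_derive f x : derivable f x 1 -> is_derive x 1 f (derive1 f x).
Proof. by move=> H; rewrite derive1E; exact: derivableP. Qed.

Lemma is_derive_continuous f x a : is_derive x 1 f a -> {for x, continuous f}.
Proof. by move=> [H _]; apply/differentiable_continuous/derivable1_diffP. Qed.

Lemma is_derive1_add f g x a b : is_derive x 1 f a -> is_derive x 1 g b ->
  is_derive x 1 (fun s => f s + g s) (a + b).
Proof. by move=> ? ?; exact: is_deriveD. Qed.

Lemma is_derive1_sub f g x a b : is_derive x 1 f a -> is_derive x 1 g b ->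
  is_derive x 1 (fun s => f s - g s) (a - b).
Proof. by move=> ? ?; exact: is_deriveB. Qed.

Lemma is_derive1_mul f g x a b : is_derive x 1 f a -> is_derive x 1 g b ->
  is_derive x 1 (fun s => f s * g s) (f x * b + g x * a).
Proof. by move=> ? ?; exact: is_deriveM. Qed.

Lemma is_derive1_scale c f x a : is_derive x 1 f a -> is_derive x 1 (fun s => c * f s) (c * a).
Proof. by move=> ?; exact: is_deriveZ. Qed.

Lemma is_derive1_translate f x c a : is_derive (x + c) 1 f a ->
  is_derive x 1 (fun s => f (s + c)) a.
Proof.
move=> H; rewrite -[a]mulr1; apply: (@is_derive1_comp R f (fun s => s + c)) => //.
have := is_derive1_add (is_derive_id x (1 : R)) (is_derive_cst c x (1 : R)).
by rewrite addr0.
Qed.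

Lemma is_derive1_reflect f x c a : is_derive (c - x) 1 f a ->
  is_derive x 1 (fun s => f (c - s)) (- a).
Proof.
move=> H; rewrite -mulrN1; apply: (@is_derive1_comp R f (fun s => c - s)) => //.
have := is_derive1_sub (is_derive_cst c x (1 : R)) (is_derive_id x (1 : R)).
by rewrite sub0r.
Qed.

(** Each use of the mean value theorem gains one power of s for a function vanishing at 0. Iterated,
    this replaces Taylor's formula in the finite-difference and quadrature errors. *)
Lemma derive_power_bound f (f' : R -> R) (h B : R) n :
  (forall s : R, 0 <= s -> is_derive s 1 f (f' s)) -> f 0 = 0 -> 0 <= B ->
  (forall s, 0 <= s -> s <= h -> `|f' s| <= B * s ^+ n) ->
  forall s, 0 <= s -> s <= h -> `|f s| <= B * s ^+ n.+1.
Proof.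
move=> df f0 B0 bound s s0 sh.
have cf : {within `[0, s], continuous f}.
  apply: continuous_in_subspaceT => x; rewrite inE /= in_itv /= => /andP[x0 _].
  exact: is_derive_continuous (df x x0).
have df' x : x \in `]0, s[%R -> is_derive x 1 f (f' x).
  by rewrite in_itv /= => /andP[x0 _]; exact: df (ltW x0).
have [c] := MVT_segment s0 df' cf.
rewrite in_itv /= f0 !subr0 => /andP[c0 cs] ->.
rewrite normrM (ger0_norm s0) exprSr mulrA ler_wpM2r//.
apply: le_trans (bound c c0 (le_trans cs sh)) _.
by rewrite ler_wpM2l// lerXn2r ?nnegrE// (le_trans c0 cs).
Qed.

Section families.
Variable I : Type.
Implicit Types (w : I -> R -> R) (k : nat).

(* Uniformity in the index i is what makes the finite-difference constants below
   independent of time and of the other space variable. *)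
Fixpoint Cb k w : Prop :=
  (exists B, forall i x, `|w i x| <= B) /\
  (if k is k'.+1 then
     exists w', (forall i x, is_derive x 1 (w i) (w' i x)) /\ Cb k' w'
   else True).

Lemma Cb_bounded k w : Cb k w -> exists2 B, 0 <= B & forall i x, `|w i x| <= B.
Proof.
case: k => [|k] [[B wB] _]; exists `|B| => // i x; exact: le_trans (wB i x) (ler_norm _).
Qed.

Lemma CbS k w : Cb k.+1 w -> Cb k w.
Proof.
elim: k w => [|k IH] w [wB [w' [dw Cw]]]; first by split.
by split => //; exists w'; split => //; exact: IH.
Qed.

Lemma Cb_derive k w : Cb k.+1 w ->
  (forall i x, is_derive x 1 (w i) (derive1 (w i) x)) /\ Cb k (fun i => derive1 (w i)).
Proof.
move=> [_ [w' [dw Cw]]]; have -> : (fun i => derive1 (w i)) = w'.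
  by apply/funext => i; apply/funext => x; exact: is_derive_derive1.
split => // i x; have -> // : derive1 (w i) x = w' i x by exact: is_derive_derive1.
Qed.

Lemma Cb_cst k (c : I -> R) B : (forall i, `|c i| <= B) -> Cb k (fun i _ => c i).
Proof.
elim: k c B => [|k IH] c B cB; first by split => //; exists B => i _.
split; first by exists B => i _.
exists (fun _ _ => 0); split; last by apply: (IH _ 0) => i; rewrite normr0.
by move=> i x; exact: is_derive_cst.
Qed.

Lemma CbD k w1 w2 : Cb k w1 -> Cb k w2 -> Cb k (fun i x => w1 i x + w2 i x).
Proof.
elim: k w1 w2 => [|k IH] w1 w2 [[B1 b1] H1] [[B2 b2] H2].
  split=> //; exists (B1 + B2) => i x; apply: le_trans (ler_normD _ _) _; exact: lerD.
split.
  exists (B1 + B2) => i x; apply: le_trans (ler_normD _ _) _; exact: lerD.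
case: H1 H2 => [w1' [d1 C1]] [w2' [d2 C2]].
exists (fun i x => w1' i x + w2' i x); split; last exact: IH.
by move=> i x; apply: is_derive1_add.
Qed.

Lemma CbM k w1 w2 : Cb k w1 -> Cb k w2 -> Cb k (fun i x => w1 i x * w2 i x).
Proof.
have bM w3 w4 : (exists B, forall i x, `|w3 i x| <= B) -> (exists B, forall i x, `|w4 i x| <= B) ->
    exists B, forall i x, `|w3 i x * w4 i x| <= B.
  by move=> [B1 b1] [B2 b2]; exists (B1 * B2) => i x; rewrite normrM ler_pM.
elim: k w1 w2 => [|k IH] w1 w2 H1 H2; first by split=> //; apply: bM; [case: H1|case: H2].
split; first by apply: bM; [case: H1|case: H2].
have [C1 C2] := (CbS H1, CbS H2).
case: H1 H2 => [_ [w1' [d1 D1]]] [_ [w2' [d2 D2]]].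
exists (fun i x => w1 i x * w2' i x + w2 i x * w1' i x); split; last first.
  by apply: CbD; exact: IH.
by move=> i x; apply: is_derive1_mul.
Qed.

Lemma CbZ k (c : I -> R) B w : (forall i, `|c i| <= B) -> Cb k w ->
  Cb k (fun i x => c i * w i x).
Proof. by move=> cB; apply: CbM; exact: Cb_cst cB. Qed.

Lemma CbN k w : Cb k w -> Cb k (fun i x => - w i x).
Proof.
move=> Cw; have -> : (fun i x => - w i x) = (fun i x => -1 * w i x).
  by apply/funext => i; apply/funext => x; rewrite mulN1r.
by apply: (@CbZ k (fun=> -1) 1) => // i; rewrite normrN1.
Qed.

Lemma CbV k w d : 0 < d -> (forall i x, d <= w i x) -> Cb k w ->
  Cb k (fun i x => (w i x)^-1).
Proof.
move=> d0 wd.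
have w0 i x : 0 < w i x by exact: lt_le_trans (wd i x).
have bV : exists B, forall i x, `|(w i x)^-1| <= B.
  exists d^-1 => i x; rewrite gtr0_norm ?invr_gt0//.
  by rewrite lef_pV2 ?posrE.
elim: k => [|k IH] Cw; first by split.
split => //; have Ck := IH (CbS Cw).
case: (Cw) => _ [w' [dw Dw]].
exists (fun i x => - (w i x) ^- 2 * w' i x); split.
  by move=> i x; have := dw i x => ?; apply: is_deriveV; rewrite gt_eqF.
have -> : (fun i x => - (w i x) ^- 2 * w' i x) =
    (fun i x => - ((w i x)^-1 * ((w i x)^-1 * w' i x))).
  by apply/funext => i; apply/funext => x; rewrite -exprVn expr2 mulNr mulrA.
by apply: CbN; do 2 apply: CbM => //.
Qed.

Lemma Cb_ln k w d : 0 < d -> (forall i x, d <= w i x) -> Cb k w ->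
  Cb k (fun i x => ln (w i x)).
Proof.
move=> d0 wd Cw.
have w0 i x : 0 < w i x by exact: lt_le_trans (wd i x).
have bln : exists B, forall i x, `|ln (w i x)| <= B.
  have [B B0 wB] := Cb_bounded Cw; exists (`|ln d| + B) => i x.
  have l1 : ln d <= ln (w i x) by rewrite ler_ln ?posrE.
  have l2 : ln (w i x) <= B.
    by apply: le_trans (ltW (ln_sublinear (w0 i x))) (le_trans (ler_norm _) (wB i x)).
  rewrite ler_norml; apply/andP; split; have := ler_norm (- ln d); rewrite ?normrN;
    by have := normr_ge0 (ln d); lra.
case: k Cw => [|k] Cw; first by split.
split => //; have Ck := CbV d0 wd (CbS Cw).
case: (Cw) => _ [w' [dw Dw]].
exists (fun i x => (w i x)^-1 * w' i x); split; last exact: CbM.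
move=> i x; have := dw i x => ?.
apply: (@is_derive1_comp R (@ln R) (w i)) => //.
exact: is_derive1_ln.
Qed.

End families.
End bounded_derivatives.

(** * Consistency of the five-point Laplacian and of its square *)

Section finite_differences.
Variable R : realType.

Section second_difference.
Variable I : Type.
Implicit Types (w : I -> R -> R).

Lemma second_difference_bound w : Cb 2 w -> exists2 C, 0 <= C &
  forall i x h, 0 <= h -> `|w i (h + x) + w i (x - h) - 2 * w i x| <= C * h ^+ 2.
Proof.
move=> Cw; have [dw Cw1] := Cb_derive Cw; have [dw1 Cw2] := Cb_derive Cw1.
have [b b0 wb] := Cb_bounded Cw2.
pose w1 i := derive1 (w i); pose w2 i := derive1 (w1 i).
exists (2 * b); first by rewrite mulr_ge0.
move=> i x h h0.
have D1 (s : R) : is_derive s 1 (fun s => w1 i (s + x) - w1 i (x - s)) (w2 i (s + x) + w2 i (x - s)).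
  have := is_derive1_sub (is_derive1_translate (dw1 i (s + x))) (is_derive1_reflect (dw1 i (x - s))).
  by rewrite opprK.
have D0 (s : R) : is_derive s 1 (fun s => w i (s + x) + w i (x - s) - 2 * w i x)
    (w1 i (s + x) - w1 i (x - s)).
  have := is_derive1_sub (is_derive1_add (is_derive1_translate (dw i (s + x)))
      (is_derive1_reflect (dw i (x - s))))
    (is_derive_cst (2 * w i x) s (1 : R)).
  by rewrite subr0.
apply: (derive_power_bound (fun s _ => D0 s) _ _ _ h0 (lexx h)).
- by rewrite add0r subr0; ring.
- by rewrite mulr_ge0.
apply: (derive_power_bound (fun s _ => D1 s)).
- by rewrite add0r subr0 subrr.
- by rewrite mulr_ge0.
move=> s _ _; rewrite expr0 mulr1; apply: le_trans (ler_normD _ _) _.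
by rewrite mulr_natl mulr2n; apply: lerD; exact: wb.
Qed.

(** Differentiated twice in h, the error becomes the second difference of w'' itself, which is
    O(h^2) by the preceding bound; two integrations from 0 raise this to O(h^4). *)
Lemma second_difference_consistent w : Cb 4 w -> exists2 C, 0 <= C &
  forall i x h, 0 <= h ->
    `|w i (h + x) + w i (x - h) - 2 * w i x - h ^+ 2 * derive1 (derive1 (w i)) x| <= C * h ^+ 4.
Proof.
move=> Cw; have [dw Cw1] := Cb_derive Cw; have [dw1 Cw2] := Cb_derive Cw1.
have [C C0 bound] := second_difference_bound Cw2.
exists C => // i x h h0.
pose w1 i := derive1 (w i); pose w2 i := derive1 (w1 i).
have D1 (s : R) : is_derive s 1 (fun s => w1 i (s + x) - w1 i (x - s) - 2 * w2 i x * s)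
    (w2 i (s + x) + w2 i (x - s) - 2 * w2 i x).
  have := is_derive1_sub (is_derive1_sub (is_derive1_translate (dw1 i (s + x)))
    (is_derive1_reflect (dw1 i (x - s)))) (is_derive1_scale (2 * w2 i x) (is_derive_id s (1 : R))).
  by rewrite opprK mulr1.
have D0 (s : R) : is_derive s 1 (fun s => w i (s + x) + w i (x - s) - 2 * w i x - w2 i x * (s * s))
    (w1 i (s + x) - w1 i (x - s) - 2 * w2 i x * s).
  have := is_derive1_sub (is_derive1_sub (is_derive1_add (is_derive1_translate (dw i (s + x)))
    (is_derive1_reflect (dw i (x - s)))) (is_derive_cst (2 * w i x) s (1 : R)))
    (is_derive1_scale (w2 i x) (is_derive1_mul (is_derive_id s (1 : R)) (is_derive_id s (1 : R)))).
  rewrite subr0 mulr1; have -> // : w2 i x * (s + s) = 2 * w2 i x * s by ring.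
rewrite [h ^+ 2 * _]mulrC expr2 -/(w1 i) -/(w2 i).
apply: (derive_power_bound (fun s _ => D0 s) _ _ _ h0 (lexx h)) => //.
  by rewrite add0r subr0; ring.
apply: (derive_power_bound (fun s _ => D1 s)) => //.
  by rewrite add0r subr0 mulr0 !subrr.
by move=> s s0 _; exact: bound.
Qed.

End second_difference.

(** The five-point Laplacian on functions of the plane. Unlike its matrix version, it can be
    differentiated and composed with [laplacian]. *)
Definition laph (h : R) (f : R -> R -> R) : R -> R -> R := fun x y =>
  h ^- 2 * (f (x + h) y + f (x - h) y + f x (y - h) + f x (y + h) - 4 * f x y).

Section plane_families.
Variable I : Type.
Implicit Types (u v : I -> R -> R -> R).

Definition Xb k u := Cb k (fun (p : I * R) x => u p.1 x p.2).
Definition Yb k u := Cb k (fun (p : I * R) y => u p.1 p.2 y).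

Lemma laph_consistent u : Xb 4 u -> Yb 4 u -> exists2 C, 0 <= C &
  forall i x y h, 0 < h -> `|laph h (u i) x y - laplacian (u i) x y| <= C * h ^+ 2.
Proof.
move=> /second_difference_consistent [C1 C10 H1] /second_difference_consistent [C2 C20 H2].
exists (C1 + C2); first by rewrite addr_ge0.
move=> i x y h h0.
have := H1 (i, y) x h (ltW h0); have := H2 (i, x) y h (ltW h0) => /=.
rewrite /laplacian /partial_x /partial_y.
set a := derive1 _ y; set b := derive1 _ x => B2 B1.
have -> : laph h (u i) x y - (b + a) = h ^- 2 *
    ((u i (h + x) y + u i (x - h) y - 2 * u i x y - h ^+ 2 * b)
    + (u i x (h + y) + u i x (y - h) - 2 * u i x y - h ^+ 2 * a)).
  by rewrite /laph (addrC h x) (addrC h y); field; rewrite gt_eqF.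
rewrite normrM gtr0_norm ?invr_gt0 ?exprn_gt0// mulrC ler_pdivrMr ?exprn_gt0//.
apply: le_trans (ler_normD _ _) (le_trans (lerD B1 B2) _).
by rewrite -mulrDl -mulrA -exprD.
Qed.

Lemma laph_bounded u : Xb 2 u -> Yb 2 u -> exists2 C, 0 <= C &
  forall i x y h, 0 < h -> `|laph h (u i) x y| <= C.
Proof.
move=> /second_difference_bound [C1 C10 H1] /second_difference_bound [C2 C20 H2].
exists (C1 + C2); first by rewrite addr_ge0.
move=> i x y h h0.
have := H1 (i, y) x h (ltW h0); have := H2 (i, x) y h (ltW h0) => /= B2 B1.
have -> : laph h (u i) x y = h ^- 2 *
    ((u i (h + x) y + u i (x - h) y - 2 * u i x y)
    + (u i x (h + y) + u i x (y - h) - 2 * u i x y)).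
  by rewrite /laph (addrC h x) (addrC h y); ring.
rewrite normrM gtr0_norm ?invr_gt0 ?exprn_gt0// mulrC ler_pdivrMr ?exprn_gt0//.
apply: le_trans (ler_normD _ _) (le_trans (lerD B1 B2) _).
by rewrite -mulrDl.
Qed.

(** Controls mixed derivatives as well, which [Xb] and [Yb] do not; they occur as soon as two
    Laplacians are composed. *)
Fixpoint Sb k u : Prop :=
  (exists B, forall i x y, `|u i x y| <= B) /\
  (if k is k'.+1 then
     exists ux uy : I -> R -> R -> R, [/\ forall i (x y : R), is_derive x 1 (fun s => u i s y) (ux i x y),
       forall i (x y : R), is_derive y 1 (u i x) (uy i x y), Sb k' ux & Sb k' uy]
   else True).

Lemma SbS k u : Sb k.+1 u -> Sb k u.
Proof.
elim: k u => [|k IH] u [uB [ux [uy [dx dy Sx Sy]]]]; first by split.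
by split => //; exists ux, uy; split => //; exact: IH.
Qed.

Lemma Sb_le k k' u : (k <= k')%N -> Sb k' u -> Sb k u.
Proof.
move=> /subnK <-; elim: (k' - k)%N => [|n IH] //.
by rewrite addSn => /SbS.
Qed.

Lemma Sb_bounded k u : Sb k u -> exists2 B, 0 <= B & forall i x y, `|u i x y| <= B.
Proof.
case: k => [|k] [[B uB] _]; exists `|B| => // i x y; exact: le_trans (uB i x y) (ler_norm _).
Qed.

Lemma Sb_partial k u : Sb k.+1 u ->
  [/\ forall i (x y : R), is_derive x 1 (fun s => u i s y) (partial_x (u i) x y),
      forall i (x y : R), is_derive y 1 (u i x) (partial_y (u i) x y),
      Sb k (fun i => partial_x (u i)) & Sb k (fun i => partial_y (u i))].
Proof.
move=> [_ [ux [uy [dx dy Sx Sy]]]].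
have Ex : (fun i => partial_x (u i)) = ux.
  apply/funext => i; apply/funext => x; apply/funext => y.
  exact: is_derive_derive1 (dx i x y).
have Ey : (fun i => partial_y (u i)) = uy.
  apply/funext => i; apply/funext => x; apply/funext => y.
  exact: is_derive_derive1 (dy i x y).
rewrite Ex Ey; split; [| |exact: Sx|exact: Sy] => i x y.
- by have := congr1 (fun F => F i x y) Ex => /= ->.
- by have := congr1 (fun F => F i x y) Ey => /= ->.
Qed.

Lemma Sb_Xb k u : Sb k u -> Xb k u.
Proof.
elim: k u => [|k IH] u; first by move=> [[B uB] _]; split => //; exists B => -[i y] x.
move=> Su; split; first by have [B _ uB] := Sb_bounded Su; exists B => -[i y] x.
have [dx _ Sx _] := Sb_partial Su.
exists (fun (p : I * R) x => partial_x (u p.1) x p.2); split; last exact: (IH _ Sx).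
by move=> [i y] x.
Qed.

Lemma Sb_Yb k u : Sb k u -> Yb k u.
Proof.
elim: k u => [|k IH] u; first by move=> [[B uB] _]; split => //; exists B => -[i x] y.
move=> Su; split; first by have [B _ uB] := Sb_bounded Su; exists B => -[i x] y.
have [_ dy _ Sy] := Sb_partial Su.
exists (fun (p : I * R) y => partial_y (u p.1) p.2 y); split; last exact: (IH _ Sy).
by move=> [i x] y.
Qed.

Lemma SbD k u v : Sb k u -> Sb k v -> Sb k (fun i x y => u i x y + v i x y).
Proof.
elim: k u v => [|k IH] u v [[B uB] Hu] [[B' vB] Hv]; split => //.
- by exists (B + B') => i x y; apply: le_trans (ler_normD _ _) _; exact: lerD.
- by exists (B + B') => i x y; apply: le_trans (ler_normD _ _) _; exact: lerD.
- case: Hu => ux [uy [dx dy Sx Sy]]; case: Hv => vx [vy [dx' dy' Sx' Sy']].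
  exists (fun i x y => ux i x y + vx i x y), (fun i x y => uy i x y + vy i x y).
  split; [| |exact: IH|exact: IH] => i x y; first exact: is_derive1_add.
  by apply: (@is_derive1_add _ (u i x) (v i x)).
Qed.

Lemma SbZ k c u : Sb k u -> Sb k (fun i x y => c * u i x y).
Proof.
elim: k u => [|k IH] u [[B uB] Hu]; split => //.
- by exists (`|c| * B) => i x y; rewrite normrM ler_wpM2l.
- by exists (`|c| * B) => i x y; rewrite normrM ler_wpM2l.
- case: Hu => ux [uy [dx dy Sx Sy]].
  exists (fun i x y => c * ux i x y), (fun i x y => c * uy i x y).
  split; [| |exact: IH|exact: IH] => i x y; first exact: is_derive1_scale.
  by apply: (@is_derive1_scale _ _ (u i x)).
Qed.

Lemma Sb_laplacian k u : Sb k.+2 u -> Sb k (fun i => laplacian (u i)).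
Proof.
move=> Su; have [_ _ Sx Sy] := Sb_partial Su.
have [_ _ Sxx _] := Sb_partial Sx; have [_ _ _ Syy] := Sb_partial Sy.
exact: (SbD Sxx Syy).
Qed.

End plane_families.

Lemma laphD h (f g : R -> R -> R) x y :
  laph h (fun x y => f x y + g x y) x y = laph h f x y + laph h g x y.
Proof. by rewrite /laph; ring. Qed.

Section laph_derivatives.
Variables (h : R) (f g : R -> R -> R).

Lemma laph_is_derive_x : (forall x y : R, is_derive x 1 (fun s => f s y) (g x y)) ->
  forall x y : R, is_derive x 1 (fun s => laph h f s y) (laph h g x y).
Proof.
move=> df x y.
have d0 := is_derive1_scale 4 (df x y).
have d1 := is_derive1_translate (df (x + h) y).
have d2 := is_derive1_translate (df (x - h) y).
exact: (is_derive1_scale (h ^- 2) (is_derive1_sub (is_derive1_add (is_derive1_add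
  (is_derive1_add d1 d2) (df x (y - h))) (df x (y + h))) d0)).
Qed.

Lemma laph_is_derive_y : (forall x y : R, is_derive y 1 (f x) (g x y)) ->
  forall x y : R, is_derive y 1 (laph h f x) (laph h g x y).
Proof.
move=> df x y.
have d0 := is_derive1_scale 4 (df x y).
have d1 := is_derive1_translate (df x (y + h)).
have d2 := is_derive1_translate (df x (y - h)).
exact: (is_derive1_scale (h ^- 2) (is_derive1_sub (is_derive1_add (is_derive1_add
  (is_derive1_add (df (x + h) y) (df (x - h) y)) d2) d1) d0)).
Qed.

End laph_derivatives.

(** The mesh size becomes part of the index, so that Delta_h u is a family with bounds uniform in h
    to which consistency applies again. Its derivatives are Delta_h of the derivatives of u. *)
Lemma Sb_laph (I : Type) k (u : I -> R -> R -> R) : Sb k.+2 u ->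
  Sb k (fun (p : I * {posnum R}) => laph p.2%:num (u p.1)).
Proof.
elim: k u => [|k IH] u Su.
  have [C C0 bound] := laph_bounded (Sb_Xb Su) (Sb_Yb Su).
  by split => //; exists C => -[i h] x y; exact: bound.
have S2 := Sb_le (isT : (2 <= k.+3)%N) Su.
have [C C0 bound] := laph_bounded (Sb_Xb S2) (Sb_Yb S2).
split; first by exists C => -[i h] x y; exact: bound.
have [dx dy Sx Sy] := Sb_partial Su.
exists (fun p => laph p.2%:num (partial_x (u p.1))), (fun p => laph p.2%:num (partial_y (u p.1))).
split; [| |exact: (IH _ Sx)|exact: (IH _ Sy)] => -[i h] x y.
- exact: (laph_is_derive_x _ (dx i)).
- exact: (laph_is_derive_y _ (dy i)).
Qed.

Lemma laplacian_laph (I : Type) (u : I -> R -> R -> R) i h : Sb 2 u ->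
  laplacian (laph h (u i)) = laph h (laplacian (u i)).
Proof.
move=> Su; have [dx dy Sx Sy] := Sb_partial Su.
have [dxx _ _ _] := Sb_partial Sx; have [_ dyy _ _] := Sb_partial Sy.
have px (f g : R -> R -> R) : (forall x y : R, is_derive x 1 (fun s => f s y) (g x y)) ->
    partial_x (laph h f) = laph h g.
  move=> df; apply/funext => x; apply/funext => y.
  by have /is_derive_derive1 := laph_is_derive_x h df x y.
have py (f g : R -> R -> R) : (forall x y : R, is_derive y 1 (f x) (g x y)) ->
    partial_y (laph h f) = laph h g.
  move=> df; apply/funext => x; apply/funext => y.
  by have /is_derive_derive1 := laph_is_derive_y h df x y.
apply/funext => x; apply/funext => y; rewrite {1}/laplacian.
rewrite (px _ _ (dx i)) (px _ _ (dxx i)) (py _ _ (dy i)) (py _ _ (dyy i)).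
exact/esym/laphD.
Qed.

(** Since Delta and Delta_h commute, the error is (Delta_h - Delta) Delta_h u + (Delta_h - Delta)
    Delta u, and each term is an instance of [laph_consistent]. Four derivatives of a function
    already using two of u: this is where six derivatives are needed. *)
Lemma biharmonic_consistent (I : Type) (u : I -> R -> R -> R) : Sb 6 u ->
  exists2 C, 0 <= C & forall i x y h, 0 < h ->
  `|laph h (laph h (u i)) x y - laplacian (laplacian (u i)) x y| <= C * h ^+ 2.
Proof.
move=> Su; have S4 := Sb_laph Su; have S4' := Sb_laplacian Su.
have [C1 C10 H1] := laph_consistent (Sb_Xb S4) (Sb_Yb S4).
have [C2 C20 H2] := laph_consistent (Sb_Xb S4') (Sb_Yb S4').
exists (C1 + C2) => [|i x y h h0]; first exact: addr_ge0.
have := H1 (i, PosNum h0) x y h h0 => /=.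
rewrite (laplacian_laph _ _ (Sb_le (isT : (2 <= 6)%N) Su)).
have := H2 i x y h h0.
move: (laph h (laph h (u i)) x y) (laph h (laplacian (u i)) x y) (laplacian (laplacian (u i)) x y).
move=> a b c b2 b1; rewrite mulrDl -(subrKA b).
exact: le_trans (ler_normD _ _) (lerD b1 b2).
Qed.

Lemma laph_laph_bounded (I : Type) (u : I -> R -> R -> R) : Sb 4 u ->
  exists2 C, 0 <= C & forall i x y h, 0 < h -> `|laph h (laph h (u i)) x y| <= C.
Proof.
move=> Su; have S2 := Sb_laph Su.
have [C C0 H] := laph_bounded (Sb_Xb S2) (Sb_Yb S2).
by exists C => // i x y h h0; exact: (H (i, PosNum h0)).
Qed.

End finite_differences.

(** * Quadrature and the discrete Sobolev inequality *)

Section interval_integral.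
Variable R : realType.
Implicit Types (f g P : R -> R) (L : R).

Definition Iint L f : R := \int[lebesgue_measure]_(x in `[0, L]) f x.

Lemma Iint_FTC2 L f P : 0 < L -> continuous f ->
  (forall x : R, 0 <= x -> is_derive x 1 P (f x)) -> Iint L f = P L - P 0.
Proof.
move=> L0 cf dP; rewrite /Iint /Rintegral (@continuous_FTC2 R f P) //.
- exact: continuous_subspaceT.
- have cP x : 0 <= x -> {for x, continuous P}.
    by move=> x0; exact: is_derive_continuous (dP x x0).
  split.
  + by move=> x; rewrite in_itv /= => /andP[/ltW x0 _]; have [] := dP x x0.
  + by apply: cvg_at_right_filter; exact: cP.
  + by apply: cvg_at_left_filter; apply: cP; exact: ltW.
- move=> x; rewrite in_itv /= => /andP[/ltW x0 _].
  exact: is_derive_derive1 (dP x x0).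
Qed.

Lemma antiderivative f : continuous f ->
  exists P, forall x : R, 0 <= x -> is_derive x 1 P (f x).
Proof.
move=> cf; exists (fun x => \int[lebesgue_measure]_(t in `[-1, x]) f t) => x x0.
have int u : (@lebesgue_measure R).-integrable `[-1, u] (EFin \o f).
  by apply: continuous_compact_integrable; [exact: segment_compact|exact: continuous_subspaceT].
have [xx1 x1] : x < x + 1 /\ -1 < x by split; lra.
have [dP <-] := continuous_FTC1_closed xx1 (int _) x1 (cf x).
exact: derivable_is_derive.
Qed.

Lemma IintD L f g : 0 < L -> continuous f -> continuous g ->
  Iint L (fun x => f x + g x) = Iint L f + Iint L g.
Proof.
move=> L0 cf cg; have [P dP] := antiderivative cf; have [Q dQ] := antiderivative cg.
rewrite (Iint_FTC2 L0 cf dP) (Iint_FTC2 L0 cg dQ).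
have cfg : continuous (fun x => f x + g x) by move=> x; exact: cvgD (cf x) (cg x).
rewrite (Iint_FTC2 L0 cfg (fun x x0 => is_derive1_add (dP x x0) (dQ x x0))); ring.
Qed.

Lemma IintZ L c f : 0 < L -> continuous f -> Iint L (fun x => c * f x) = c * Iint L f.
Proof.
move=> L0 cf; have [P dP] := antiderivative cf; rewrite (Iint_FTC2 L0 cf dP).
have cc : continuous (fun x => c * f x) by move=> x; exact: cvgM (cvg_cst _) (cf x).
rewrite (Iint_FTC2 L0 cc (fun x x0 => is_derive1_scale c (dP x x0))); ring.
Qed.

Lemma Iint_cst L c : 0 < L -> Iint L (fun=> c) = L * c.
Proof.
move=> L0; have d (x : R) : 0 <= x -> is_derive x 1 (fun x => c * x) c.
  by move=> _; have := is_derive1_scale c (is_derive_id x (1 : R)); rewrite mulr1.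
rewrite (Iint_FTC2 L0 _ d); first ring.
by move=> x; exact: cvg_cst.
Qed.

Lemma Iint_le L f g : 0 < L -> continuous f -> continuous g ->
  (forall x, 0 <= x -> x <= L -> f x <= g x) -> Iint L f <= Iint L g.
Proof.
move=> L0 cf cg fg; have [P dP] := antiderivative cf; have [Q dQ] := antiderivative cg.
rewrite (Iint_FTC2 L0 cf dP) (Iint_FTC2 L0 cg dQ).
pose k x := Q x - P x.
have dk (x : R) : 0 <= x -> is_derive x 1 k (g x - f x).
  by move=> x0; exact: is_derive1_sub (dQ x x0) (dP x x0).
have ck : {within `[0, L], continuous k}.
  apply: continuous_in_subspaceT => x; rewrite inE /= in_itv /= => /andP[x0 _].
  exact: is_derive_continuous (dk x x0).
have dk' x : x \in `]0, L[%R -> is_derive x 1 k (g x - f x).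
  by rewrite in_itv /= => /andP[x0 _]; exact: dk (ltW x0).
have [c] := MVT_segment (ltW L0) dk' ck.
rewrite in_itv /= /k subr0 => /andP[c0 cL] E.
have : 0 <= (g c - f c) * L by rewrite mulr_ge0 ?(ltW L0)// subr_ge0 fg.
rewrite -E; lra.
Qed.

Lemma Iint_abs_le L f B : 0 < L -> continuous f ->
  (forall x, 0 <= x -> x <= L -> `|f x| <= B) -> `|Iint L f| <= L * B.
Proof.
move=> L0 cf fB; rewrite ler_norml -mulrN -!Iint_cst//.
have cc (c : R) : continuous (fun _ : R => c) by move=> x; exact: cvg_cst.
apply/andP; split; apply: Iint_le => // x x0 xL;
  by have := fB x x0 xL; rewrite ler_norml => /andP[].
Qed.

Lemma Iint_sum L n (F : 'I_n -> R -> R) : 0 < L -> (forall i, continuous (F i)) ->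
  continuous (fun x => \sum_i F i x) /\
  Iint L (fun x => \sum_i F i x) = \sum_i Iint L (F i).
Proof.
move=> L0; elim: n F => [|n IH] F cF.
  have -> : (fun x => \sum_(i < 0) F i x) = fun=> 0.
    by apply/funext => x; rewrite big_ord0.
  by rewrite big_ord0 Iint_cst// mulr0; split=> //; by move=> x; exact: cvg_cst.
have [c E] := IH (fun i => F (lift ord0 i)) (fun i => cF _).
have -> : (fun x => \sum_(i < n.+1) F i x) =
    (fun x => F ord0 x + \sum_(i < n) F (lift ord0 i) x).
  by apply/funext => x; rewrite big_ord_recl.
rewrite big_ord_recl IintD// E; split => // x.
exact: cvgD (cF ord0 x) (c x).
Qed.

Lemma lipschitz_continuous f B : (forall x y, `|f x - f y| <= B * `|x - y|) -> continuous f.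
Proof.
move=> lip x; apply/cvgrPdist_le => /= e e0.
have B1 : 0 < `|B| + 1 by rewrite ltr_wpDl.
near=> y; apply: le_trans (lip x y) _.
have : `|x - y| <= e / (`|B| + 1).
  near: y; apply: cvgr_dist_le; [exact: cvg_id|exact: divr_gt0].
rewrite ler_pdivlMr// mulrC => H; apply: le_trans H.
by apply: ler_wpM2r => //; apply: le_trans (ler_norm B) _; rewrite lerDl.
Unshelve. all: by end_near. Qed.

End interval_integral.

(** * Trapezoid rule and discrete trace inequality *)

Section quadrature.
Variable R : realType.

Lemma sum_telescope M (F : nat -> R) : \sum_(j < M) (F j.+1 - F j) = F M - F 0%N.
Proof. by rewrite -(big_mkord xpredT (fun j => F j.+1 - F j)) telescope_sumr. Qed.

Section one_dimension.
Variables (L : R) (M : nat).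
Hypotheses (L0 : 0 < L) (M0 : (0 < M)%N).
Let h : R := L / M%:R.

Let h0 : 0 < h. Proof. by rewrite divr_gt0// ltr0n. Qed.
Let hM : M%:R * h = L. Proof. by rewrite mulrC divfK// pnatr_eq0 -lt0n. Qed.

(** On a cell, trapezoid value minus integral vanishes together with its derivative in the cell
    length s, and its second derivative is s w''/2; hence b/2 h^3 per cell. *)
Lemma trapezoid_error (w w1 w2 : R -> R) b : 0 <= b ->
  (forall x : R, is_derive x 1 w (w1 x)) -> (forall x : R, is_derive x 1 w1 (w2 x)) ->
  (forall x, `|w2 x| <= b) -> w L = w 0 ->
  `|Iint L w - h * \sum_(j < M) w (j.+1%:R * h)| <= b / 2 * L * h ^+ 2.
Proof.
move=> b0 d0 d1 wb wL; have cw : continuous w.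
  by move=> x; exact: is_derive_continuous (d0 x).
have [P dP] := antiderivative cw.
pose x (j : nat) := j%:R * h.
have x0 j : 0 <= x j by rewrite mulr_ge0// ltW.
have xS j : x j.+1 = h + x j by rewrite /x -natr1 mulrDl mul1r addrC.
have cell (a : R) : 0 <= a ->
    `|2^-1 * (h * (w a + w (h + a))) - (P (h + a) - P a)| <= b / 2 * h ^+ 3.
  move=> a0.
  have dk (s : R) : 0 <= s ->
      is_derive s 1 (fun s => 2^-1 * (s * (w a + w (s + a))) - (P (s + a) - P a))
      (2^-1 * (s * w1 (s + a) + (w a + w (s + a))) - w (s + a)).
    move=> s0; have := is_derive1_sub (is_derive1_scale 2^-1 (is_derive1_mul (is_derive_id s (1 : R))
      (is_derive1_add (is_derive_cst (w a) s (1 : R)) (is_derive1_translate (d0 (s + a))))))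
      (is_derive1_sub (is_derive1_translate (dP (s + a) (addr_ge0 s0 a0))) (is_derive_cst (P a) s (1 : R))).
    by rewrite add0r mulr1 subr0.
  have dm (s : R) : 0 <= s ->
      is_derive s 1 (fun s => 2^-1 * (s * w1 (s + a) + (w a + w (s + a))) - w (s + a))
      (2^-1 * (s * w2 (s + a))).
    move=> s0; have dw := is_derive1_translate (d0 (s + a)).
    have dw1 := is_derive1_translate (d1 (s + a)).
    have := is_derive1_sub (is_derive1_scale 2^-1 (is_derive1_add
      (is_derive1_mul (is_derive_id s (1 : R)) dw1)
      (is_derive1_add (is_derive_cst (w a) s (1 : R)) dw))) dw.
    set D := (X in is_derive _ _ _ X -> _); have -> // : D = 2^-1 * (s * w2 (s + a)).
    by rewrite /D add0r mulr1; move: (w1 _) (w2 _) => p q; field.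
  have b20 : 0 <= b / 2 by rewrite divr_ge0.
  apply: (derive_power_bound dk _ b20 _ (ltW h0) (lexx h)).
    by rewrite !add0r mul0r mulr0 !subrr.
  apply: (derive_power_bound dm _ b20 _).
    by rewrite !add0r mul0r add0r; field.
  move=> s s0 _; rewrite normrM (ger0_norm (_ : 0 <= 2^-1)) ?invr_ge0// normrM (ger0_norm s0) expr1.
  by have := ler_wpM2l s0 (wb (s + a)); move: (`|w2 _|) => p ?; lra.
have xM : x M = L by rewrite /x hM.
have x00 : x 0%N = 0 by rewrite /x mul0r.
have PE : P L - P 0 = \sum_(j < M) (P (x j.+1) - P (x j)).
  by rewrite (sum_telescope M (fun j => P (x j))) xM x00.
rewrite (Iint_FTC2 L0 cw dP) PE.
(* As w L = w 0, the sums over left and right endpoints agree, so the right-endpoint rule of the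
   mesh is the trapezoid rule. *)
have -> : \sum_(j < M) w (j.+1%:R * h) = \sum_(j < M) 2^-1 * (w (x j) + w (x j.+1)).
  have := sum_telescope M (fun j => w (x j)).
  rewrite xM x00 wL subrr sumrB -mulr_sumr big_split /= -/(x _).
  set A := \sum_(j < M) w (x j.+1); set B := \sum_(j < M) w (x j) => /eqP.
  by rewrite subr_eq0 => /eqP <-; rewrite -/A; field.
rewrite mulr_sumr -sumrB.
have -> : b / 2 * L * h ^+ 2 = \sum_(j < M) b / 2 * h ^+ 3.
  by rewrite sumr_const card_ord -mulr_natl -{1}hM; ring.
apply: le_trans (ler_norm_sum _ _ _) _; apply: ler_sum => j _.
rewrite distrC; have := cell (x j) (x0 j); rewrite -xS.
by have -> : 2^-1 * (h * (w (x j) + w (x j.+1))) = h * (2^-1 * (w (x j) + w (x j.+1))) by rewrite mulrCA.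
Qed.

(** On a cell starting at a, h f(a + h)^2 is the integral of the derivative f^2 + 2 s f f' of s f(s
    + a)^2, and 2 s f f' <= h (f^2 + f'^2). *)
Lemma discrete_trace (f f' : R -> R) :
  (forall x : R, is_derive x 1 f (f' x)) -> continuous f' ->
  h * \sum_(j < M) f (j.+1%:R * h) ^+ 2 <=
  (1 + h) * Iint L (fun x => f x ^+ 2) + h * Iint L (fun x => f' x ^+ 2).
Proof.
move=> df cf'; have cf : continuous f by move=> x; exact: is_derive_continuous (df x).
have sq (g : R -> R) : continuous g -> continuous (fun x => g x ^+ 2).
  by move=> cg x; exact: cvgM (cg x) (cg x).
have [P dP] := antiderivative (sq _ cf); have [Q dQ] := antiderivative (sq _ cf').
pose S x := (1 + h) * P x + h * Q x.
pose x (j : nat) := j%:R * h.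
have x0 j : 0 <= x j by rewrite mulr_ge0// ltW.
have xS j : x j.+1 = h + x j by rewrite /x -natr1 mulrDl mul1r addrC.
have cell (a : R) : 0 <= a -> h * f (h + a) ^+ 2 <= S (h + a) - S a.
  move=> a0.
  have dk (s : R) : 0 <= s ->
      is_derive s 1 (fun s => s * (f (s + a) * f (s + a)) - (1 + h) * P (s + a) - h * Q (s + a))
      (2 * s * (f (s + a) * f' (s + a)) - h * (f (s + a) ^+ 2 + f' (s + a) ^+ 2)).
    move=> s0.
    have ft := is_derive1_translate (df (s + a)).
    have := is_derive1_sub (is_derive1_sub (is_derive1_mul (is_derive_id s (1 : R))
      (is_derive1_mul ft ft))
      (is_derive1_scale (1 + h) (is_derive1_translate (dP (s + a) (addr_ge0 s0 a0)))))
      (is_derive1_scale h (is_derive1_translate (dQ (s + a) (addr_ge0 s0 a0)))).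
    set D := (X in is_derive _ _ _ X -> _).
    set E := (X in _ -> is_derive _ _ _ X); have -> // : D = E.
    by rewrite /D /E; move: (f _) (f' _) => p q; ring.
  set k := (fun s => _ : R) in dk.
  have ck : {within `[0, h], continuous k}.
    apply: continuous_in_subspaceT => s; rewrite inE /= in_itv /= => /andP[s0 _].
    exact: is_derive_continuous (dk s s0).
  set k' := (fun s => 2 * s * (f (s + a) * f' (s + a)) - h * (f (s + a) ^+ 2 + f' (s + a) ^+ 2)).
  have dk' s : s \in `]0, h[%R -> is_derive s 1 k (k' s).
    by rewrite in_itv /= => /andP[s0 _]; exact: dk (ltW s0).
  have [c] := MVT_segment (ltW h0) dk' ck.
  rewrite in_itv /= => /andP[c0 ch] E.
  have k'0 : k' c * (h - 0) <= 0.
    rewrite subr0; apply: mulr_le0_ge0; last exact: ltW.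
    rewrite /k'; move: (f _) (f' _) => p q.
    have : c * (p ^+ 2 + q ^+ 2) <= h * (p ^+ 2 + q ^+ 2).
      by rewrite ler_wpM2r// addr_ge0 ?sqr_ge0.
    have := mulr_ge0 c0 (sqr_ge0 (p - q)); lra.
  rewrite -E /k add0r mul0r in k'0.
  rewrite /S expr2; move: k'0.
  move: (f _) (P (h + a)) (P a) (Q (h + a)) (Q a) => f0 p1 p0 q1 q0.
  by move=> ?; lra.
have xM : x M = L by rewrite /x hM.
have x00 : x 0%N = 0 by rewrite /x mul0r.
rewrite (Iint_FTC2 L0 (sq _ cf) dP) (Iint_FTC2 L0 (sq _ cf') dQ).
have -> : (1 + h) * (P L - P 0) + h * (Q L - Q 0) = S (x M) - S (x 0%N).
  by rewrite xM x00 /S; ring.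
rewrite -(sum_telescope M (fun j => S (x j))) mulr_sumr.
by apply: ler_sum => j _; have := cell (x j) (x0 j); rewrite -xS.
Qed.

End one_dimension.

Lemma integral_OmegaE L (v : R -> R -> R) : integral_Omega L v = Iint L (fun x => Iint L (v x)).
Proof. by []. Qed.

Section two_dimensions.
Variables (I : Type) (u : I -> R -> R -> R).

Lemma Sb_continuous_x k : Sb k.+1 u -> forall i y, continuous (fun x => u i x y).
Proof.
by move=> Su i y x; have [dx _ _ _] := Sb_partial Su; exact: is_derive_continuous (dx i x y).
Qed.

Lemma Sb_continuous_y k : Sb k.+1 u -> forall i x, continuous (u i x).
Proof.
by move=> Su i x y; have [_ dy _ _] := Sb_partial Su; exact: is_derive_continuous (dy i x y).
Qed.

Lemma is_derive_lipschitz (f f' : R -> R) B :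
  (forall x : R, is_derive x 1 f (f' x)) -> (forall x, `|f' x| <= B) ->
  forall x y, `|f x - f y| <= B * `|x - y|.
Proof.
move=> df bf x y; wlog xy : x y / y <= x => [H|].
  by case: (leP y x) => [/H//|/ltW/H]; rewrite distrC (distrC y).
have cf : {within `[y, x], continuous f}.
  by apply: continuous_subspaceT => z; exact: is_derive_continuous (df z).
have [c _ ->] := MVT_segment xy (fun z _ => df z) cf.
by rewrite normrM ler_wpM2r.
Qed.

Lemma Iint_continuous L k : 0 < L -> Sb k.+1 u -> forall i, continuous (fun x => Iint L (u i x)).
Proof.
move=> L0 Su i; have [dx _ Sx _] := Sb_partial Su.
have [B B0 xB] := Sb_bounded Sx; have cy := Sb_continuous_y Su.
apply: (@lipschitz_continuous R _ (L * B)) => x x'.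
have -> : Iint L (u i x) - Iint L (u i x') = Iint L (fun y => u i x y + -1 * u i x' y).
  rewrite IintD// ?IintZ//; first by rewrite mulN1r.
  by move=> y; exact: cvgM (cvg_cst _) (cy i x' y).
rewrite -mulrA; apply: Iint_abs_le => // [y|y _ _].
  exact: cvgD (cy i x y) (cvgM (cvg_cst _) (cy i x' y)).
rewrite mulN1r; exact: (is_derive_lipschitz (fun x => dx i x y) (fun x => xB i x y)).
Qed.

(** The trapezoid rule is used in y under the x-integral, then in x along each mesh line; the
    intermediate quantity sums over y and integrates over x. *)
Lemma quadrature_error (L : R) : 0 < L -> Sb 2 u -> exists2 C, 0 <= C &
  forall i M h, (0 < M)%N -> h = L / M%:R -> Defs.periodic L (u i) ->
  `|integral_Omega L (u i) - h ^+ 2 * \sum_(a < M) \sum_(b < M) u i (a.+1%:R * h) (b.+1%:R * h)|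
    <= C * h ^+ 2.
Proof.
move=> L0 Su; have [dx dy Sx Sy] := Sb_partial Su.
have [dxx _ Sxx _] := Sb_partial Sx; have [_ dyy _ Syy] := Sb_partial Sy.
have [B1 B10 b1] := Sb_bounded Sxx; have [B2 B20 b2] := Sb_bounded Syy.
exists (L * (B2 / 2 * L) + L * (B1 / 2 * L)).
  by have L0' := ltW L0; apply: addr_ge0; apply: mulr_ge0 => //; apply: mulr_ge0 => //; lra.
move=> i M h M0 hE per.
have h0 : 0 < h by rewrite hE divr_gt0// ltr0n.
have hM : M%:R * h = L by rewrite hE mulrC divfK// pnatr_eq0 -lt0n.
have cx := Sb_continuous_x Su; have cy := Sb_continuous_y Su.
pose y (b : 'I_M) := b.+1%:R * h.
have per_y x : u i x L = u i x 0 by have [_] := per x 0; rewrite add0r.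
have per_x z : u i L z = u i 0 z by have [+ _] := per 0 z; rewrite add0r.
have Ty x := trapezoid_error L0 M0 B20 (dy i x) (dyy i x) (b2 i x) (per_y x).
rewrite -hE in Ty.
have Tx z := trapezoid_error L0 M0 B10 (fun x => dx i x z) (fun x => dxx i x z) (fun x => b1 i x z) (per_x z).
rewrite -hE in Tx.
have cF b : continuous (fun x => - h * u i x (y b)).
  by move=> x; exact: cvgM (cvg_cst _) (cx i (y b) x).
have [cS ES] := Iint_sum L0 cF.
have cG : continuous (fun x => Iint L (u i x)) := @Iint_continuous L 1 L0 Su i.
have A1 : `|integral_Omega L (u i) - h * \sum_(b < M) Iint L (fun x => u i x (y b))|
    <= L * (B2 / 2 * L * h ^+ 2).
  have -> : integral_Omega L (u i) - h * \sum_(b < M) Iint L (fun x => u i x (y b))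
      = Iint L (fun x => Iint L (u i x) + \sum_(b < M) - h * u i x (y b)).
    rewrite IintD// ES integral_OmegaE -mulNr mulr_sumr; congr (_ + _).
    by apply: eq_bigr => b _; rewrite IintZ.
  apply: Iint_abs_le => // [x|x _ _]; first exact: cvgD (cG x) (cS x).
  by rewrite -mulr_sumr mulNr; exact: Ty.
have A2 : `|h * \sum_(b < M) Iint L (fun x => u i x (y b))
     - h ^+ 2 * \sum_(a < M) \sum_(b < M) u i (a.+1%:R * h) (y b)| <= L * (B1 / 2 * L * h ^+ 2).
  rewrite exchange_big /= expr2 -mulrA -mulrBr normrM (gtr0_norm h0) mulr_sumr -sumrB.
  have -> e : L * e = h * (M%:R * e) by rewrite mulrA [h * _]mulrC hM.
  rewrite ler_pM2l// mulr_natl.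
  apply: le_trans (ler_norm_sum _ _ _) _.
  apply: (@le_trans _ _ (\sum_(b < M) B1 / 2 * L * h ^+ 2)).
    by apply: ler_sum => b _; exact: Tx.
  by rewrite sumr_const card_ord.
rewrite -(subrKA (h * \sum_(b < M) Iint L (fun x => u i x (y b)))).
apply: le_trans (ler_normD _ _) (le_trans (lerD A1 A2) _); lra.
Qed.

End two_dimensions.
End quadrature.

(** * Fubini's theorem for smooth periodic functions and the discrete Sobolev inequality *)

Section sobolev.
Variable R : realType.

Lemma periodic_partial_x (L : R) (v : R -> R -> R) :
  (forall x y, derivable (fun s => v s y) x 1) -> Defs.periodic L v ->
  Defs.periodic L (partial_x v).
Proof.
move=> dv per x y; split; last first.
  by rewrite /partial_x; congr derive1; apply/funext => s; have [_ ->] := per s y.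
have := is_derive1_translate (derivable_is_derive (dv (x + L) y)).
have -> : (fun s => v (s + L) y) = (fun s => v s y).
  by apply/funext => s; have [-> _] := per s y.
by move=> D; exact/esym/(is_derive_derive1 D).
Qed.

Lemma periodic_partial_y (L : R) (v : R -> R -> R) :
  (forall x y, derivable (v x) y 1) -> Defs.periodic L v ->
  Defs.periodic L (partial_y v).
Proof.
move=> dv per x y; split.
  by rewrite /partial_y; congr derive1; apply/funext => s; have [-> _] := per x s.
have := is_derive1_translate (derivable_is_derive (dv x (y + L))).
have -> : (fun s => v x (s + L)) = v x.
  by apply/funext => s; have [_ ->] := per x s.
by move=> D; exact/esym/(is_derive_derive1 D).
Qed.

Section families.
Variable I : Type.
Implicit Types (u v : I -> R -> R -> R).

Lemma SbM k u v : Sb k u -> Sb k v -> Sb k (fun i x y => u i x y * v i x y).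
Proof.
have bM k' (w3 w4 : I -> R -> R -> R) : Sb k' w3 -> Sb k' w4 ->
    exists B, forall i x y, `|w3 i x y * w4 i x y| <= B.
  move=> /Sb_bounded[B1 _ b1] /Sb_bounded[B2 _ b2].
  by exists (B1 * B2) => i x y; rewrite normrM ler_pM.
elim: k u v => [|k IH] u v Hu Hv; first by split=> //; exact: (bM 0%N u v Hu Hv).
have [Cu Cv] := (SbS Hu, SbS Hv); split; first exact: (bM k.+1 u v Hu Hv).
have [dx dy Sx Sy] := Sb_partial Hu; have [dx' dy' Sx' Sy'] := Sb_partial Hv.
exists (fun i x y => u i x y * partial_x (v i) x y + v i x y * partial_x (u i) x y).
exists (fun i x y => u i x y * partial_y (v i) x y + v i x y * partial_y (u i) x y).
split.
- by move=> i x y; exact: is_derive1_mul (dx i x y) (dx' i x y).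
- by move=> i x y; exact: is_derive1_mul (dy i x y) (dy' i x y).
- exact: (SbD (IH _ _ Cu Sx') (IH _ _ Cv Sx)).
- exact: (SbD (IH _ _ Cu Sy') (IH _ _ Cv Sy)).
Qed.

Lemma Sb_sqr k u : Sb k u -> Sb k (fun i x y => u i x y ^+ 2).
Proof. by move=> Su; exact: SbM. Qed.

Lemma Sb_transpose k u : Sb k u -> Sb k (fun i x y => u i y x).
Proof.
elim: k u => [|k IH] u Su; first by split => //; have [B _ b] := Sb_bounded Su; exists B.
split; first by have [B _ b] := Sb_bounded Su; exists B.
have [dx dy Sx Sy] := Sb_partial Su.
exists (fun i x y => partial_y (u i) y x), (fun i x y => partial_x (u i) y x).
by split; [move=> i x y; exact: dy|move=> i x y; exact: dx|exact: IH|exact: IH].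
Qed.

Lemma Sb_derivable k u : Sb k.+1 u ->
  (forall i x y, derivable (fun s => u i s y) x 1) /\ (forall i x y, derivable (u i x) y 1).
Proof.
move=> Su; have [dx dy _ _] := Sb_partial Su; split => i x y.
  by have [] := dx i x y.
by have [] := dy i x y.
Qed.

Lemma periodic_partial k u L i : Sb k.+1 u -> Defs.periodic L (u i) ->
  Defs.periodic L (partial_x (u i)) /\ Defs.periodic L (partial_y (u i)).
Proof.
move=> /Sb_derivable[dx dy] per.
by split; [exact: periodic_partial_x|exact: periodic_partial_y].
Qed.

End families.

Lemma periodic_sqr L (v : R -> R -> R) : Defs.periodic L v -> Defs.periodic L (fun x y => v x y ^+ 2).
Proof. by move=> per x y; have [-> ->] := per x y. Qed.

Lemma small_eq (x y C L : R) : 0 <= C ->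
  (forall M, (0 < M)%N -> `|x - y| <= C * (L / M%:R) ^+ 2) -> x = y.
Proof.
move=> C0 H; apply/eqP; rewrite -subr_eq0 -normr_le0 leNgt; apply/negP => d0.
(* M exceeds C L^2 / |x - y|, and therefore so does M^2. *)
pose M := (Num.truncn ((C * L ^+ 2) / `|x - y|)).+1.
have M0 : (0 < M)%N by [].
have := H M M0; apply/negP; rewrite -ltNge.
have Mr : (1 : R) <= M%:R by rewrite ler1n.
have M1 : (0 : R) < M%:R by rewrite ltr0n.
rewrite exprMn exprVn mulrA ltr_pdivrMr ?exprn_gt0//.
have : C * L ^+ 2 / `|x - y| < M%:R by exact: truncnS_gt.
rewrite ltr_pdivrMr// => h.
have M2 : M%:R <= M%:R ^+ 2 :> R by rewrite expr2 ler_peMl// ltW.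
have := ler_wpM2r (ltW d0) M2; rewrite [_ * `|x - y|]mulrC [X in _ <= X -> _]mulrC.
by apply: lt_le_trans; rewrite mulrC.
Qed.

(* Both iterated integrals are limits of the same grid sums. *)
Lemma fubini_periodic L (v : R -> R -> R) : 0 < L -> Sb 2 (fun _ : unit => v) ->
  Defs.periodic L v ->
  Iint L (fun y => Iint L (fun x => v x y)) = integral_Omega L v.
Proof.
move=> L0 Sv per.
have perT : Defs.periodic L (fun x y => v y x) by move=> x y; have [-> ->] := per y x.
have [C1 C10 H1] := quadrature_error L0 Sv.
have [C2 C20 H2] := quadrature_error L0 (Sb_transpose Sv).
apply: (@small_eq _ _ (C1 + C2) L); first exact: addr_ge0.
move=> M M0; have b1 := H1 tt M _ M0 erefl per; have := H2 tt M _ M0 erefl perT.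
rewrite exchange_big /= integral_OmegaE => b2.
rewrite distrC in b1; rewrite [(C1 + C2) * _]mulrDl [X in _ <= X]addrC.
move: b1 b2; set q := _ ^+ 2 * \sum_(a < M) _ => b1 b2; rewrite -(subrKA q).
exact: le_trans (ler_normD _ _) (lerD b2 b1).
Qed.

Lemma Iint_ge0 L (f : R -> R) : 0 < L -> continuous f -> (forall x, 0 <= f x) -> 0 <= Iint L f.
Proof.
move=> L0 cf f0; rewrite -(mulr0 L) -(Iint_cst 0 L0); apply: Iint_le => //.
by move=> x; exact: cvg_cst.
Qed.

Lemma integral_Omega_sqr_ge0 L (v : R -> R -> R) : 0 < L -> Sb 1 (fun _ : unit => v) ->
  0 <= integral_Omega L (fun x y => v x y ^+ 2).
Proof.
move=> L0 /Sb_sqr Sv; rewrite integral_OmegaE; apply: Iint_ge0 => //.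
  exact: (@Iint_continuous R _ _ L 0 L0 Sv tt).
move=> x; apply: Iint_ge0 => // [|y]; last exact: sqr_ge0.
exact: (@Sb_continuous_y R _ _ 0 Sv tt x).
Qed.

Lemma trace_weights_le (t a b c d : R) : 0 <= t -> 0 <= a -> 0 <= b -> 0 <= c -> 0 <= d ->
  (1 + t) * ((1 + t) * a + t * b) + t * ((1 + t) * c + t * d) <= (1 + t) ^+ 2 * (a + b + c + d).
Proof.
move=> t0 a0 b0 c0 d0; have := mulr_ge0 t0 b0; have := mulr_ge0 t0 c0.
have := mulr_ge0 t0 d0; lra.
Qed.

Section discrete_sobolev.
Variables (L : R) (M : nat).
Hypotheses (L0 : 0 < L) (M0 : (0 < M)%N).
Let h : R := L / M%:R.
Let h0 : 0 < h. Proof. by rewrite divr_gt0// ltr0n. Qed.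

(** The trace inequality acts in x, the outer variable of [integral_Omega]; swapping the integrals
    allows it to be applied for each y. *)
Lemma discrete_trace_sum (w : R -> R -> R) : Sb 3 (fun _ : unit => w) -> Defs.periodic L w ->
  h * \sum_(a < M) Iint L (fun y => w (a.+1%:R * h) y ^+ 2) <=
  (1 + h) * integral_Omega L (fun x y => w x y ^+ 2)
  + h * integral_Omega L (fun x y => partial_x w x y ^+ 2).
Proof.
move=> Sw per; have [dx dy Sx Sy] := Sb_partial Sw.
have [perx pery] := periodic_partial (i := tt) Sw per.
have S2 := Sb_sqr (SbS Sw); have Sx2 := Sb_sqr Sx.
rewrite -!(fubini_periodic L0 _ (periodic_sqr _))//.
have cZ c (g : R -> R) : continuous g -> continuous (fun y => c * g y).
  by move=> cg y; exact: cvgM (cvg_cst _) (cg y).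
have cF (a : 'I_M) : continuous (fun y => h * w (a.+1%:R * h) y ^+ 2).
  exact: (cZ _ _ (@Sb_continuous_y R _ _ 1 S2 tt _)).
have [cS ES] := Iint_sum L0 cF.
have cG1 : continuous (fun y => Iint L (fun x => w x y ^+ 2)).
  exact: (@Iint_continuous R _ _ L 1 L0 (Sb_transpose S2) tt).
have cG2 : continuous (fun y => Iint L (fun x => partial_x w x y ^+ 2)).
  exact: (@Iint_continuous R _ _ L 1 L0 (Sb_transpose Sx2) tt).
have -> : h * \sum_(a < M) Iint L (fun y => w (a.+1%:R * h) y ^+ 2) =
    Iint L (fun y => \sum_(a < M) h * w (a.+1%:R * h) y ^+ 2).
  rewrite ES mulr_sumr; apply: eq_bigr => a _; rewrite IintZ//.
  exact: (@Sb_continuous_y R _ _ 1 S2 tt _).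
rewrite -!IintZ// -IintD//; [|exact: cZ|exact: cZ].
apply: Iint_le => // [y|y _ _]; first exact: cvgD (cZ _ _ cG1 y) (cZ _ _ cG2 y).
rewrite -mulr_sumr.
apply: (discrete_trace L0 M0 (fun x => dx tt x y)).
exact: (@Sb_continuous_x R _ _ 1 Sx tt y).
Qed.

(** One trace inequality in y, then one in x for both v and its y-derivative. The second use
    produces the mixed derivative, so H^2 rather than H^1 bounds the mesh values. *)
Lemma discrete_sobolev (v : R -> R -> R) : Sb 4 (fun _ : unit => v) -> Defs.periodic L v ->
  h ^+ 2 * \sum_(a < M) \sum_(b < M) v (a.+1%:R * h) (b.+1%:R * h) ^+ 2 <=
  (1 + h) ^+ 2 * (integral_Omega L (fun x y => v x y ^+ 2)
    + integral_Omega L (fun x y => partial_x v x y ^+ 2)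
    + integral_Omega L (fun x y => partial_y v x y ^+ 2)
    + integral_Omega L (fun x y => partial_x (partial_y v) x y ^+ 2)).
Proof.
move=> Sv per; have [dx dy Sx Sy] := Sb_partial Sv.
have [perx pery] := periodic_partial (i := tt) Sv per.
have [_ _ Sxy _] := Sb_partial Sy.
have T1 := discrete_trace_sum (SbS Sv) per.
have T2 := discrete_trace_sum Sy pery.
have step : h ^+ 2 * \sum_(a < M) \sum_(b < M) v (a.+1%:R * h) (b.+1%:R * h) ^+ 2 <=
    (1 + h) * (h * \sum_(a < M) Iint L (fun y => v (a.+1%:R * h) y ^+ 2))
    + h * (h * \sum_(a < M) Iint L (fun y => partial_y v (a.+1%:R * h) y ^+ 2)).
  rewrite expr2 -mulrA [in leRHS]mulrCA -mulrDr ler_pM2l// !mulr_sumr -big_split /=.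
  apply: ler_sum => a _; apply: (discrete_trace L0 M0 (fun y => dy tt (a.+1%:R * h) y)).
  exact: (@Sb_continuous_y R _ _ 2 Sy tt _).
apply: le_trans step _.
have p1 := integral_Omega_sqr_ge0 L0 (Sb_le (isT : (1 <= 4)%N) Sv).
have p2 := integral_Omega_sqr_ge0 L0 (Sb_le (isT : (1 <= 3)%N) Sx).
have p3 := integral_Omega_sqr_ge0 L0 (Sb_le (isT : (1 <= 3)%N) Sy).
have p4 := integral_Omega_sqr_ge0 L0 (Sb_le (isT : (1 <= 2)%N) Sxy).
have h1 : 0 <= 1 + h by rewrite addr_ge0// ltW.
have U1 := ler_wpM2l h1 T1; have U2 := ler_wpM2l (ltW h0) T2.
apply: le_trans (lerD U1 U2) _.
exact: (trace_weights_le (ltW h0) p1 p2 p3 p4).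
Qed.

End discrete_sobolev.
End sobolev.

(** * Smooth space-time functions *)

Section slab.
Variable R : realType.
Implicit Types (L T : R) (u : R -> R -> R -> R).

(** Serves as the index type of the families, so that bounds are uniform over exactly the times at
    which u is controlled. *)
Definition slab_time T := {t : R | 0 <= t <= T}.

Lemma periodic_representative L (f : R -> R) x : 0 < L -> (forall s, f (s + L) = f s) ->
  exists2 x', 0 <= x' <= L & f x = f x'.
Proof.
move=> L0 per.
have pern n s : f (s + n%:R * L) = f s.
  elim: n => [|n IH]; first by rewrite mul0r addr0.
  by rewrite -natr1 mulrDl mul1r addrA per.
have perz (z : int) s : f (s + z%:~R * L) = f s.
  case: z => n; first exact: pern.
  by rewrite NegzE -(pern n.+1) -addrA -mulrDl mulrNz addNr mul0r addr0.
pose z := Num.floor (x / L).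
exists (x - z%:~R * L); last first.
  by rewrite -mulNr -mulrNz perz.
have /andP[z1 z2] := floor_itv (x / L); rewrite -/z in z1 z2.
rewrite ler_pdivlMr// in z1; rewrite ltr_pdivrMr// intrD mulrDl mul1r in z2.
by apply/andP; split; lra.
Qed.

(** Compactness of [0,T] x [0,L]^2 bounds one period, and periodicity carries the bound to the
    plane. *)
Lemma slab_bounded L T u : 0 < L -> (forall t, 0 <= t <= T -> Defs.periodic L (u t)) ->
  {within [set p : R * R * R | 0 <= p.1.1 <= T], continuous (fun p => u p.1.1 p.1.2 p.2)} ->
  exists B, forall (t : slab_time T) x y, `|u (sval t) x y| <= B.
Proof.
move=> L0 per cu.
pose K := (`[0, T]%classic `*` `[0, L]%classic) `*` `[0, L]%classic : set (R * R * R).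
have cK : compact K.
  have cL := @segment_compact _ 0 L.
  exact: (compact_setX (compact_setX (@segment_compact _ 0 T) cL) cL).
have cuK : {within K, continuous (fun p : R * R * R => u p.1.1 p.1.2 p.2)}.
  apply: continuous_subspaceW cu => -[[t x] y] [[/= + _] _].
  by rewrite in_itv.
have := compact_bounded (continuous_compact cuK cK).
move=> [N [_ bnd]]; exists (N + 1) => -[t tT] x y /=.
have [perx pery] : (forall x y, u t (x + L) y = u t x y) /\ (forall x y, u t x (y + L) = u t x y).
  by split => x' y'; have [] := per t tT x' y'.
have [x' x'L ->] := periodic_representative (f := fun x => u t x y) x L0 (fun s => perx s y).
have [y' y'L ->] := periodic_representative (f := u t x') y L0 (pery x').
apply: (bnd (N + 1)); first by rewrite ltrDl.
by exists (t, x', y') => //; do !split; rewrite /= in_itv.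
Qed.

Lemma slab_Sb L T k u : 0 < L -> (forall t, 0 <= t <= T -> Defs.periodic L (u t)) ->
  classCk_slab T k u -> Sb k (fun t : slab_time T => u (sval t)).
Proof.
move=> L0; elim: k u => [|k IH] u per [cu Hu].
  by split => //; exact: slab_bounded per cu.
split; first exact: slab_bounded per cu.
case: Hu => dx dy Cx Cy _.
exists (fun t => partial_x (u (sval t))), (fun t => partial_y (u (sval t))); split.
- by move=> [t tT] x y; apply: derivable_is_derive; exact: dx.
- by move=> [t tT] x y; apply: derivable_is_derive; exact: dy.
- apply: (IH (fun t => partial_x (u t))) => // t tT.
  by apply: periodic_partial_x (per t tT) => x y; exact: dx.
- apply: (IH (fun t => partial_y (u t))) => // t tT.
  by apply: periodic_partial_y (per t tT) => x y; exact: dy.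
Qed.

Lemma pair_section_cvg (t x y : R) : (fun s : R => (s, x, y)) @ nbhs t --> nbhs (t, x, y).
Proof.
have H1 : (fun s : R => (s, x)) @ nbhs t --> nbhs (t, x).
  exact: (@cvg_pair R R R (nbhs t) (nbhs t) (nbhs x) _ _ _ id (fun _ => x)
    (@cvg_id _ _) (@cvg_cst _ _ _ _ _)).
exact: (@cvg_pair R (R * R)%type R (nbhs t) (nbhs (t, x)) (nbhs y) _ _ _
  (fun s => (s, x)) (fun _ => y) H1 (@cvg_cst _ _ _ _ _)).
Qed.

Lemma slab_time_continuous T u x y :
  {within [set p : R * R * R | 0 <= p.1.1 <= T], continuous (fun p => u p.1.1 p.1.2 p.2)} ->
  {within `[0, T], continuous (fun t => u t x y)}.
Proof.
move=> /subspace_continuousP cu; apply/subspace_continuousP => t /=; rewrite in_itv /= => tT.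
have := cu (t, x, y) tT => /= H.
have phi : (fun s : R => (s, x, y)) @ within `[0, T]%classic (nbhs t) -->
    within [set p : R * R * R | 0 <= p.1.1 <= T] (nbhs (t, x, y)).
  move=> P HP; have c : (fun s : R => (s, x, y)) @ nbhs t --> nbhs (t, x, y).
    exact: pair_section_cvg.
  have H2 : nbhs t (fun s => 0 <= s <= T -> P (s, x, y)) by exact: c HP.
  suff : nbhs t (fun s => `[0, T]%classic s -> P (s, x, y)) by [].
  by apply: filterS H2 => s Hs; rewrite /= in_itv /=; exact: Hs.
exact: (cvg_comp _ _ phi H).
Qed.

Section within_continuous.
Variable A : set R.
Implicit Types f g : R -> R.

Lemma within_continuousD f g : {within A, continuous f} -> {within A, continuous g} ->
  {within A, continuous (fun t => f t + g t)}.
Proof.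
move=> /subspace_continuousP cf /subspace_continuousP cg.
by apply/subspace_continuousP => t At; exact: cvgD (cf t At) (cg t At).
Qed.

Lemma within_continuous_cst (c : R) : {within A, continuous (fun _ => c)}.
Proof. by apply/subspace_continuousP => t At; exact: cvg_cst. Qed.

Lemma within_continuousZ c f : {within A, continuous f} ->
  {within A, continuous (fun t => c * f t)}.
Proof.
move=> /subspace_continuousP cf.
by apply/subspace_continuousP => t At; exact: cvgM (cvg_cst c) (cf t At).
Qed.

Lemma within_continuousB f g : {within A, continuous f} -> {within A, continuous g} ->
  {within A, continuous (fun t => f t - g t)}.
Proof.
move=> /subspace_continuousP cf /subspace_continuousP cg.
by apply/subspace_continuousP => t At; exact: cvgB (cf t At) (cg t At).
Qed.

Lemma within_continuous_abs f : {within A, continuous f} ->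
  {within A, continuous (fun t => `|f t|)}.
Proof.
move=> /subspace_continuousP cf.
by apply/subspace_continuousP => t At; exact: cvg_norm (cf t At).
Qed.

Lemma within_continuous_ln f : {within A, continuous f} -> (forall t, A t -> 0 < f t) ->
  {within A, continuous (fun t => ln (f t))}.
Proof.
move=> /subspace_continuousP cf f0; apply/subspace_continuousP => t At.
exact: (cvg_comp _ _ (cf t At) (continuous_ln (f0 t At))).
Qed.

Lemma within_continuous_sum n (F : 'I_n -> R -> R) :
  (forall i, {within A, continuous (F i)}) ->
  {within A, continuous (fun t => \sum_i F i t)}.
Proof.
elim: n F => [|n IH] F cF.
  under [X in continuous X]eq_fun do rewrite big_ord0.
  exact: within_continuous_cst.
under [X in continuous X]eq_fun do rewrite big_ord_recl.
by apply: within_continuousD => //; exact: IH.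
Qed.

End within_continuous.

(** The equation holds only for 0 < t < T, but the first time step starts at t = 0; bounds on the
    defect reach the endpoints in this way. *)
Lemma within_closed_le T (g : R -> R) c : 0 < T -> {within `[0, T], continuous g} ->
  (forall t, 0 < t < T -> g t <= c) -> forall t, 0 <= t <= T -> g t <= c.
Proof.
move=> T0 /subspace_continuousP cg gc t tT; rewrite leNgt; apply/negP => ct.
have tI : `[0, T]%classic t by rewrite /= in_itv.
have H2 : nbhs t (fun s => `[0, T]%classic s -> c < g s) by exact: (cvgr_gt (g t) (cg t tI) c ct).
have [e /= e0 H] := (nbhs_ballP _ _).1 H2.
have [t0 tT'] := andP tT.
pose n := Num.min 1 (e / T).
have n0 : 0 < n by rewrite lt_min ltr01 divr_gt0.
have n1 : n <= 1 by rewrite ge_min lexx.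
have nT : n * T <= e by rewrite -ler_pdivlMr// ge_min lexx orbT.
(* Moving a fraction n of the way towards the midpoint reaches the open interval while staying
   within distance e of t. *)
pose s := t + n * (T / 2 - t).
have nt : n * t <= t by rewrite ler_piMl.
have nT' : n * (T - t) <= T - t by rewrite ler_piMl// subr_ge0.
have nT0 : 0 < n * T by rewrite mulr_gt0.
have nt0 : 0 <= n * t by rewrite mulr_ge0// ltW.
have ntT : n * t <= n * T by rewrite ler_pM2l.
have s0 : 0 < s by rewrite /s; lra.
have sT : s < T by rewrite /s; lra.
have : c < g s.
  apply: H; last by rewrite /= in_itv /= !ltW.
  rewrite /ball /= /s opprD addrA subrr sub0r normrN ltr_norml; apply/andP; split; lra.
by rewrite ltNge gc// s0 sT.
Qed.

Lemma within_closed_eq T (g : R -> R) c : 0 < T -> {within `[0, T], continuous g} ->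
  (forall t, 0 < t < T -> g t = c) -> forall t, 0 <= t <= T -> g t = c.
Proof.
move=> T0 cg gc t tT; apply/eqP; rewrite eq_le; apply/andP; split.
  by apply: within_closed_le tT => // s /gc ->.
rewrite -lerN2; apply: (@within_closed_le T (fun t => - g t)) tT => //.
  by move=> s; apply: cvgN; exact: cg.
by move=> s /gc ->.
Qed.

Lemma classCk_slab_continuous T k u : classCk_slab T k u ->
  {within [set p : R * R * R | 0 <= p.1.1 <= T], continuous (fun p => u p.1.1 p.1.2 p.2)}.
Proof. by case: k => [|k] []. Qed.

Lemma classCk_slab_time T k u : classCk_slab T k.+1 u -> exists ut : R -> R -> R -> R,
  (forall t x y : R, 0 < t < T -> is_derive t 1 (fun s => u s x y) (ut t x y)) /\
  classCk_slab T k ut.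
Proof. by case=> _ []. Qed.

(* The time derivative inherits the periodicity of u on the open interval, and
   by continuity at both ends. *)
Lemma time_derivative_periodic L T u ut : 0 < T ->
  (forall t, 0 <= t <= T -> Defs.periodic L (u t)) ->
  (forall t x y, 0 < t < T -> is_derive t 1 (fun s => u s x y) (ut t x y)) ->
  {within [set p : R * R * R | 0 <= p.1.1 <= T], continuous (fun p => ut p.1.1 p.1.2 p.2)} ->
  forall t, 0 <= t <= T -> Defs.periodic L (ut t).
Proof.
move=> T0 per dt cut.
have nearE (v w : R -> R) : (forall t, 0 <= t <= T -> v t = w t) ->
    forall t, 0 < t < T -> \near t, v t = w t.
  move=> vw t tT; have tI : t \in `]0, T[%R by rewrite in_itv.
  have := near_in_itvoo tI; apply: filterS => s; rewrite in_itv /= => /andP[s0 sT].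
  by apply: vw; rewrite !ltW.
have open_eq t x y x' y' : (forall t, 0 <= t <= T -> u t x y = u t x' y') ->
    0 < t < T -> ut t x y = ut t x' y'.
  move=> E tT; rewrite -(is_derive_derive1 (dt t x y tT)).
  by apply: is_derive_derive1; apply: near_eq_is_derive (dt t x' y' tT); apply: nearE => // s /E.
have closed_eq x y x' y' : (forall t, 0 <= t <= T -> u t x y = u t x' y') ->
    forall t, 0 <= t <= T -> ut t x y = ut t x' y'.
  move=> E t tT; apply/eqP; rewrite -subr_eq0; apply/eqP.
  apply: (@within_closed_eq T (fun t => ut t x y - ut t x' y')) tT => // [|s sT].
    exact: (within_continuousB (@slab_time_continuous T ut x y cut) (@slab_time_continuous T ut x' y' cut)).
  by rewrite (open_eq s x y x' y')// subrr.
move=> t tT x y; split; apply: closed_eq tT => s sT.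
  by have [] := per s sT x y.
by have [] := per s sT x y.
Qed.

End slab.

(** * Error of the initial data *)

Section initial_error.
Variable R : realType.

Lemma Sb_cst (I : Type) k (c : R) : Sb k (fun (_ : I) _ _ => c).
Proof.
elim: k c => [|k IH] c; first by split => //; exists `|c|.
split; first by exists `|c|.
by exists (fun _ _ _ => 0), (fun _ _ _ => 0); split => // i x y; exact: is_derive_cst.
Qed.

Lemma Sb_sum (I : Type) k n (F : 'I_n -> I -> R -> R -> R) : (forall j, Sb k (F j)) ->
  Sb k (fun i x y => \sum_j F j i x y).
Proof.
elim: n F => [|n IH] F SF.
  have -> : (fun i x y => \sum_(j < 0) F j i x y) = (fun i x y => 0).
    by apply/funext => i; apply/funext => x; apply/funext => y; rewrite big_ord0.
  exact: Sb_cst.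
have -> : (fun i x y => \sum_(j < n.+1) F j i x y) =
    (fun i x y => F ord0 i x y + \sum_(j < n) F (lift ord0 j) i x y).
  by apply/funext => i; apply/funext => x; apply/funext => y; rewrite big_ord_recl.
exact: SbD (SF _) (IH _ (fun j => SF _)).
Qed.

Lemma is_derive_affine (a b x : R) : is_derive x 1 (fun s => a * s + b) a.
Proof.
have := is_derive1_add (is_derive1_scale a (is_derive_id x (1 : R))) (is_derive_cst b x (1 : R)).
by rewrite mulr1 addr0.
Qed.

Lemma is_derive_cos_affine (a b x : R) :
  is_derive x 1 (fun s => cos (a * s + b)) (- a * sin (a * x + b)).
Proof.
have := @is_derive1_comp R cos (fun s => a * s + b) x _ _ (is_derive_cos _) (is_derive_affine a b x).
by have -> : - sin (a * x + b) * a = - a * sin (a * x + b) by rewrite mulNr mulrC mulNr.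
Qed.

Lemma is_derive_sin_affine (a b x : R) :
  is_derive x 1 (fun s => sin (a * s + b)) (a * cos (a * x + b)).
Proof.
have := @is_derive1_comp R sin (fun s => a * s + b) x _ _ (is_derive_sin _) (is_derive_affine a b x).
by rewrite mulrC.
Qed.

(** Differentiation exchanges the two families, so they share one induction. *)
Lemma Sb_cos_sin k (a b : R) :
  Sb k (fun (_ : unit) x y => cos (a * x + b * y)) /\
  Sb k (fun (_ : unit) x y => sin (a * x + b * y)).
Proof.
have cb : exists B, forall (i : unit) x y, `|cos (a * x + b * y)| <= B.
  by exists 1 => _ x y; exact: cos_max.
have sb : exists B, forall (i : unit) x y, `|sin (a * x + b * y)| <= B.
  by exists 1 => _ x y; exact: sin_max.
have swap (f : R -> R) x : (fun y => f (a * x + b * y)) = (fun y => f (b * y + a * x)).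
  by apply/funext => s; rewrite addrC.
elim: k => [|k [IHc IHs]]; first by split; split.
split; split => //.
  exists (fun _ x y => - a * sin (a * x + b * y)), (fun _ x y => - b * sin (a * x + b * y)).
  split; [| |exact: SbZ IHs|exact: SbZ IHs] => _ x y; first exact: is_derive_cos_affine.
  by rewrite swap (addrC (a * x)); exact: is_derive_cos_affine.
exists (fun _ x y => a * cos (a * x + b * y)), (fun _ x y => b * cos (a * x + b * y)).
split; [| |exact: SbZ IHc|exact: SbZ IHc] => _ x y; first exact: is_derive_sin_affine.
by rewrite swap (addrC (a * x)); exact: is_derive_sin_affine.
Qed.

Lemma phaseE (L k l x y : R) : phase L k l x y = 2 * pi * k / L * x + 2 * pi * l / L * y.
Proof. by rewrite /phase; ring. Qed.

Lemma fourier_proj_Sb k (L : R) N (v : R -> R -> R) : Sb k (fun _ : unit => fourier_proj L N v).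
Proof.
rewrite /fourier_proj; apply: (Sb_sum (I := unit)) => i; apply: (Sb_sum (I := unit)) => j.
have [Sc Ss] := Sb_cos_sin k (2 * pi * freq R i / L) (2 * pi * freq R j / L).
have phE (f : R -> R) : (fun (_ : unit) x y => f (2 * pi * freq R i / L * x + 2 * pi * freq R j / L * y)) =
    (fun _ x y => f (phase L (freq R i) (freq R j) x y)).
  by apply/funext => s; apply/funext => x; apply/funext => y; rewrite phaseE.
rewrite !phE in Sc Ss.
exact: (SbD (SbZ _ Sc) (SbZ _ Ss)).
Qed.

Lemma cos_sin_shift (n m : nat) (a : R) :
  cos (a + 2 * pi * (n%:R - m%:R)) = cos a /\ sin (a + 2 * pi * (n%:R - m%:R)) = sin a.
Proof.
(* The frequency n - m may be negative, while periodicity is iterated a natural number of times: m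
   periods are added to b and n to a. *)
set b := a + _; have E : b + (pi *+ 2) *+ m = a + (pi *+ 2) *+ n.
  have piE q : (pi *+ 2) *+ q = 2 * pi * q%:R :> R by rewrite -mulrnA -[LHS]mulr_natr natrM; ring.
  by rewrite !piE /b; ring.
split.
  by rewrite -(periodicn (@cosD2pi R) m b) E (periodicn (@cosD2pi R)).
by rewrite -(periodicn (@sinD2pi R) m b) E (periodicn (@sinD2pi R)).
Qed.

Lemma fourier_proj_periodic (L : R) N (v : R -> R -> R) : 0 < L -> Defs.periodic L (fourier_proj L N v).
Proof.
move=> L0 x y; have L0' : L != 0 by rewrite gt_eqF.
split; apply: eq_bigr => i _; apply: eq_bigr => j _ /=.
  have -> : phase L (freq R i) (freq R j) (x + L) y =
      phase L (freq R i) (freq R j) x y + 2 * pi * ((i : nat)%:R - N%:R).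
    by rewrite /phase -/(freq R i); field.
  by have [-> ->] := cos_sin_shift i N (phase L (freq R i) (freq R j) x y).
have -> : phase L (freq R i) (freq R j) x (y + L) =
    phase L (freq R i) (freq R j) x y + 2 * pi * ((j : nat)%:R - N%:R).
  by rewrite /phase -/(freq R j); field.
by have [-> ->] := cos_sin_shift j N (phase L (freq R i) (freq R j) x y).
Qed.

Lemma Sb_iter_partial (I : Type) k i j (u : I -> R -> R -> R) : Sb (i + j + k) u ->
  Sb k (fun t => iter i (@partial_x R) (iter j (@partial_y R) (u t))).
Proof.
elim: i k => [|i IH] k; last first.
  move=> Su; have Su' : Sb (i + j + k.+1) u by rewrite addnS -!addSn.
  by have [_ _ Sx _] := Sb_partial (IH _ Su').
elim: j k => [|j IH] k; first by rewrite add0n.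
move=> Su; have Su' : Sb (0 + j + k.+1) u by rewrite addnS -addSn.
by have [_ _ _ Sy] := Sb_partial (IH _ Su').
Qed.

Lemma integral_Omega_bounded (I : Type) L (w : I -> R -> R -> R) : 0 < L -> Sb 1 w ->
  exists B, forall t, integral_Omega L (w t) <= B.
Proof.
move=> L0 Sw; have [B B0 wB] := Sb_bounded Sw; exists (L * (L * B)) => t.
rewrite integral_OmegaE; apply: le_trans (ler_norm _) _; apply: Iint_abs_le => //.
  exact: (@Iint_continuous R _ _ L 0 L0 Sw t).
move=> x _ _; apply: Iint_abs_le => //; exact: (@Sb_continuous_y R _ _ 0 Sw t x).
Qed.

Lemma sum_bounded (I : Type) n (P : pred 'I_n) (F : 'I_n -> I -> R) :
  (forall j, P j -> exists B, forall t, F j t <= B) -> exists B, forall t, \sum_(j | P j) F j t <= B.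
Proof.
move=> FB; have /choice[f fP] : forall j, exists B, P j -> forall t, F j t <= B.
  by move=> j; case: (boolP (P j)) => [/FB[B ?]|_]; [exists B|exists 0].
by exists (\sum_(j | P j) f j) => t; apply: ler_sum => j Pj; exact: fP.
Qed.

Lemma Hnorm_bounded (I : Type) L k (u : I -> R -> R -> R) : 0 < L -> Sb k.+1 u ->
  exists B, forall t, Hnorm L k (u t) <= B.
Proof.
move=> L0 Su.
have [B uB] : exists B, forall t, \sum_(i < k.+1) \sum_(j < k.+1 | (i + j <= k)%N)
    integral_Omega L (fun x y => (iter i (@partial_x R) (iter j (@partial_y R) (u t))) x y ^+ 2) <= B.
  apply: sum_bounded => i _; apply: sum_bounded => j ijk.
  apply: (@integral_Omega_bounded _ L _ L0); apply: Sb_sqr.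
  by apply: (@Sb_iter_partial _ 1 i j); apply: Sb_le Su; rewrite addn1.
exists (Num.sqrt B) => t; exact: ler_wsqrtr.
Qed.

Lemma sum_order2_ge (f : nat -> nat -> R) : 0 <= f 2%N 0%N -> 0 <= f 0%N 2%N ->
  f 0%N 0%N + f 1%N 0%N + f 0%N 1%N + f 1%N 1%N
    <= \sum_(i < 3) \sum_(j < 3 | (i + j <= 2)%N) f i j.
Proof.
move=> f20 f02; under eq_bigr do rewrite big_mkcond.
rewrite !big_ord_recl !big_ord0 /=; lra.
Qed.

Lemma Sb_reindex (I J : Type) k (u : I -> R -> R -> R) (r : J -> I) :
  Sb k u -> Sb k (fun j => u (r j)).
Proof.
elim: k u => [|k IH] u Su; have [B _ uB] := Sb_bounded Su.
  by split => //; exists B => j; exact: uB.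
have [dx dy Sx Sy] := Sb_partial Su; split; first by exists B => j; exact: uB.
exists (fun j => partial_x (u (r j))), (fun j => partial_y (u (r j))).
by split; [move=> j; exact: dx|move=> j; exact: dy|exact: (IH _ Sx)|exact: (IH _ Sy)].
Qed.

Lemma Hnorm2_ge (L : R) (v : R -> R -> R) : 0 < L -> Sb 4 (fun _ : unit => v) ->
  integral_Omega L (fun x y => v x y ^+ 2)
    + integral_Omega L (fun x y => partial_x v x y ^+ 2)
    + integral_Omega L (fun x y => partial_y v x y ^+ 2)
    + integral_Omega L (fun x y => partial_x (partial_y v) x y ^+ 2) <= Hnorm L 2 v ^+ 2.
Proof.
move=> L0 Sv.
have pos i j : (i + j <= 2)%N ->
    0 <= integral_Omega L (fun x y => (iter i (@partial_x R) (iter j (@partial_y R) v)) x y ^+ 2).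
  move=> ij; apply: integral_Omega_sqr_ge0 => //.
  by apply: (@Sb_iter_partial unit 1 i j (fun _ => v)); apply: Sb_le Sv; rewrite addn1 ltnS (leq_trans ij).
have p00 := pos 0%N 0%N isT; have p01 := pos 0%N 1%N isT; have p02 := pos 0%N 2%N isT.
have p10 := pos 1%N 0%N isT; have p11 := pos 1%N 1%N isT; have p20 := pos 2%N 0%N isT.
rewrite /Hnorm sqr_sqrtr; last by apply: sumr_ge0 => i _; apply: sumr_ge0 => j; exact: pos.
exact: (@sum_order2_ge (fun i j => integral_Omega L
  (fun x y => (iter i (@partial_x R) (iter j (@partial_y R) v)) x y ^+ 2)) p20 p02).
Qed.

Lemma initial_error (L T : R) (m : nat) (deg : nat -> nat) (u : R -> R -> R -> R) :
  0 < L -> 0 <= T -> (5 <= m)%N -> Sb m (fun t : slab_time T => u (sval t)) ->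
  Defs.periodic L (u 0) -> projection_estimate L T m deg u ->
  exists2 C, 0 <= C & forall M h, (0 < M)%N -> h = L / M%:R ->
    grid_norm h (grid_restrict M h (fourier_proj L (deg M) (u 0)) - grid_restrict M h (u 0))
      <= C * h ^+ 2.
Proof.
move=> L0 T0 m5 Su per est.
(* k = 2 is the norm in the discrete Sobolev inequality, and l = 4 yields the order h^(4-2). The H^4
   norm is bounded with a fifth derivative, which makes the integrands continuous. *)
have [C C0 H] := est 2%N 4%N isT (leq_trans (isT : (4 <= 5)%N) m5).
have [K uK] := Hnorm_bounded L0 (Sb_le m5 Su).
have T00 : 0 <= (0 : R) <= T by rewrite lexx.
have K0 : 0 <= K by apply: le_trans (uK (exist _ 0 T00)); exact: sqrtr_ge0.
have supK : (LinftyHnorm L T 4 u <= K%:E)%E.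
  apply: ge_ereal_sup => e [t /=]; rewrite in_itv /= => tT <-.
  by rewrite lee_fin; exact: (uK (exist _ t tT)).
have CK0 : 0 <= (1 + L) * (C * K).
  by apply: mulr_ge0; [rewrite addr_ge0// ltW|apply: mulr_ge0 => //; exact: ltW].
exists ((1 + L) * (C * K)) => //.
move=> M h M0 hE; have h0 : 0 < h by rewrite hE divr_gt0// ltr0n.
have hL : h <= L.
  by rewrite hE ler_pdivrMr ?ltr0n// ler_peMr ?ler1n// ltW.
pose v x y := fourier_proj L (deg M) (u 0) x y - u 0 x y.
have Sv : Sb 4 (fun _ : unit => v).
  have Su0 : Sb 4 (fun _ : unit => u 0).
    have := Sb_le (leq_trans (isT : (4 <= 5)%N) m5) Su.
    exact: (@Sb_reindex _ _ 4 _ (fun _ => exist _ 0 T00)).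
  have := SbD (fourier_proj_Sb 4 L (deg M) (u 0)) (SbZ (-1) Su0).
  have -> // : (fun _ x y => fourier_proj L (deg M) (u 0) x y + -1 * u 0 x y) = (fun _ : unit => v).
  by apply/funext => s; apply/funext => x; apply/funext => y; rewrite mulN1r.
have perv : Defs.periodic L v.
  move=> x y; rewrite /v; have [-> ->] := per x y.
  by have [-> ->] := fourier_proj_periodic (deg M) (u 0) L0 x y.
have Hv : Hnorm L 2 v <= C * h ^+ 2 * K.
  have C2 : 0 <= C * h ^+ 2 by apply: mulr_ge0; [exact: ltW|exact: sqr_ge0].
  rewrite -lee_fin EFinM; apply: le_trans (lee_wpmul2l _ supK); last by rewrite lee_fin.
  have := H M M0; rewrite -hE; apply: le_trans.
  by apply: ereal_sup_ubound; exists 0 => //=; rewrite in_itv.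
have Hv0 : 0 <= Hnorm L 2 v by exact: sqrtr_ge0.
have Ch0 : 0 <= (1 + L) * (C * K) * h ^+ 2.
  by apply: mulr_ge0 => //; exact: sqr_ge0.
rewrite -(@ler_sqr R) ?nnegrE ?grid_norm_ge0// grid_norm_sqr.
have -> : gsum (grid_restrict M h (fourier_proj L (deg M) (u 0)) - grid_restrict M h (u 0))
    (grid_restrict M h (fourier_proj L (deg M) (u 0)) - grid_restrict M h (u 0)) =
    \sum_(a < M) \sum_(b < M) v (a.+1%:R * h) (b.+1%:R * h) ^+ 2.
  by apply: eq_bigr => a _; apply: eq_bigr => b _; rewrite !mxE expr2.
have := discrete_sobolev L0 M0 Sv perv; rewrite -hE => sob.
apply: le_trans sob _.
apply: le_trans (ler_wpM2l (sqr_ge0 (1 + h)) (Hnorm2_ge L0 Sv)) _.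
have h1 : 0 <= 1 + h by rewrite addr_ge0// ltW.
rewrite -exprMn ler_sqr ?nnegrE; [|exact: mulr_ge0|exact: Ch0].
have -> : (1 + L) * (C * K) * h ^+ 2 = (1 + L) * (C * h ^+ 2 * K) by ring.
by apply: ler_pM => //; rewrite lerD2l.
Qed.

End initial_error.

(** * Consistency of the exact solution *)

Section consistency.
Variable R : realType.

Section mesh_restriction.
Variables (L : R) (M : nat) (h : R).
Hypotheses (M0 : (0 < M)%N) (hE : h = L / M%:R).

Lemma mesh_length : M%:R * h = L.
Proof. by rewrite hE mulrC divfK// pnatr_eq0 -lt0n. Qed.

(** The mesh runs from h to L, so the successor of the last point is h and stands for L + h. *)
Lemma periodic_ordS (g : R -> R) (i : 'I_M) : (forall s, g (s + L) = g s) ->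
  g ((ordS i).+1%:R * h) = g (i.+1%:R * h + h).
Proof.
move=> per /=; have [iM|iM] := eqVneq i.+1 M.
  by rewrite iM modnn mesh_length mul1r addrC per.
rewrite modn_small; first by rewrite -[i.+2%:R]natr1 mulrDl mul1r.
by rewrite ltn_neqAle iM ltn_ord.
Qed.

Lemma periodic_ord_pred (g : R -> R) (i : 'I_M) : (forall s, g (s + L) = g s) ->
  g ((ord_pred i).+1%:R * h) = g (i.+1%:R * h - h).
Proof.
move=> per /=; have -> : i.+1%:R * h - h = i%:R * h.
  by rewrite -natr1 mulrDl mul1r addrK.
have [i0|i0] := posnP (val i).
  rewrite i0 add0n modn_small ?prednK// mesh_length mul0r.
  by have := per 0; rewrite add0r.
have -> : (i + M).-1 = (i.-1 + M)%N by rewrite -{1}(prednK i0).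
by rewrite modnDr modn_small ?prednK//; exact: ltnW (ltn_ord i).
Qed.

Lemma grid_restrict_laph (f : R -> R -> R) : Defs.periodic L f ->
  grid_laplacian h (grid_restrict M h f) = grid_restrict M h (laph h f).
Proof.
move=> per; apply/matrixP => i j; rewrite !mxE /laph.
have px y s : f (s + L) y = f s y by have [] := per s y.
have py x s : f x (s + L) = f x s by have [] := per x s.
rewrite (periodic_ordS (g := fun s => f s _) i (px _)).
rewrite (periodic_ord_pred (g := fun s => f s _) i (px _)).
by rewrite (periodic_ordS (g := f _) j (py _)) (periodic_ord_pred (g := f _) j (py _)).
Qed.

Lemma periodic_laph (f : R -> R -> R) : Defs.periodic L f -> Defs.periodic L (laph h f).
Proof.
move=> per x y; rewrite /laph.
have px s z : f (s + L) z = f s z by have [] := per s z.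
have py s z : f s (z + L) = f s z by have [] := per s z.
split; congr (_ * _).
  by rewrite !(addrAC x L) !px.
by rewrite !(addrAC y L) !py.
Qed.

(** The stabilization cancels between [F_op] and [Lh_op], leaving the flux with kappa = 0: a direct
    discretization of the equation. *)
Lemma residualE eps sigma theta thetac kappa (v : R -> R -> R) (i j : 'I_M) :
  Defs.periodic L v ->
  (F_op theta thetac kappa sigma h (grid_restrict M h v)
   - Lh_op eps kappa sigma h (grid_restrict M h v)) i j =
  laph h (fun x y => flux 0 theta thetac (v x y)) (i.+1%:R * h) (j.+1%:R * h)
  - eps ^+ 2 * laph h (laph h v) (i.+1%:R * h) (j.+1%:R * h)
  + sigma * (grid_mean (grid_restrict M h v) - v (i.+1%:R * h) (j.+1%:R * h)).
Proof.
move=> per; rewrite F_opE /Lh_op.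
have -> : map_mx (flux kappa theta thetac) (grid_restrict M h v) =
    grid_restrict M h (fun x y => flux 0 theta thetac (v x y)) - kappa *: grid_restrict M h v.
  by apply/matrixP => a b; rewrite !mxE /flux; ring.
rewrite grid_laplacianB grid_laplacianZ !grid_restrict_laph//; last 2 first.
- exact: periodic_laph.
- by move=> x y; have [-> ->] := per x y.
move: (grid_mean _) => g.
move: (laph h (fun x y => flux 0 theta thetac (v x y))) (laph h (laph h v)) (laph h v) => a b c.
by rewrite !mxE; ring.
Qed.

End mesh_restriction.

Section laplacian_linearity.

(** Regularity shared by the three parts of the chemical potential: the flux is known only through
    pure derivatives, and psi is only of class C^2. *)
Definition twice_derivable (v : R -> R -> R) : Prop :=
  [/\ forall x y, derivable (fun s => v s y) x 1, forall x y, derivable (v x) y 1,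
      forall x y, derivable (fun s => partial_x v s y) x 1 &
      forall x y, derivable (partial_y v x) y 1].

Lemma laplacian_lincomb (a b c : R -> R -> R) (s t : R) x y :
  twice_derivable a -> twice_derivable b -> twice_derivable c ->
  laplacian (fun x y => a x y + s * b x y + t * c x y) x y =
  laplacian a x y + s * laplacian b x y + t * laplacian c x y.
Proof.
move=> [ax ay axx ayy] [bx by' bxx byy] [cx cy cxx cyy].
have lin (f g k : R -> R) z : derivable f z 1 -> derivable g z 1 -> derivable k z 1 ->
    derive1 (fun q => f q + s * g q + t * k q) z = derive1 f z + s * derive1 g z + t * derive1 k z.
  move=> /derivable_is_derive df /derivable_is_derive dg /derivable_is_derive dk.
  exact: (is_derive_derive1 (is_derive1_add (is_derive1_add df (is_derive1_scale s dg))
    (is_derive1_scale t dk))).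
have Ex : partial_x (fun x y => a x y + s * b x y + t * c x y) =
    (fun x y => partial_x a x y + s * partial_x b x y + t * partial_x c x y).
  apply/funext => p; apply/funext => q.
  exact: (lin (fun z => a z q) (fun z => b z q) (fun z => c z q)).
have Ey : partial_y (fun x y => a x y + s * b x y + t * c x y) =
    (fun x y => partial_y a x y + s * partial_y b x y + t * partial_y c x y).
  by apply/funext => p; apply/funext => q; exact: (lin (a p) (b p) (c p)).
rewrite {1}/laplacian Ex Ey.
have -> : partial_x (fun x y => partial_x a x y + s * partial_x b x y + t * partial_x c x y) x y
    = partial_x (partial_x a) x y + s * partial_x (partial_x b) x y + t * partial_x (partial_x c) x y.
  exact: (lin (fun z => partial_x a z y) (fun z => partial_x b z y) (fun z => partial_x c z y)).
have -> : partial_y (fun x y => partial_y a x y + s * partial_y b x y + t * partial_y c x y) x y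
    = partial_y (partial_y a) x y + s * partial_y (partial_y b) x y + t * partial_y (partial_y c) x y.
  exact: (lin (partial_y a x) (partial_y b x) (partial_y c x)).
rewrite /laplacian.
move: (partial_x _ x y) (partial_x _ x y) (partial_x _ x y).
move: (partial_y _ x y) (partial_y _ x y) (partial_y _ x y).
by move=> ? ? ? ? ? ?; ring.
Qed.

Lemma XYb_twice_derivable (I : Type) k (u : I -> R -> R -> R) i : Xb k.+2 u -> Yb k.+2 u ->
  twice_derivable (u i).
Proof.
move=> Xu Yu.
have [dx X1] := @Cb_derive R _ k.+1 _ Xu; have [dy Y1] := @Cb_derive R _ k.+1 _ Yu.
have [dxx _] := @Cb_derive R _ k _ X1; have [dyy _] := @Cb_derive R _ k _ Y1.
split => x y.
- by have [] := dx (i, y) x.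
- by have [] := dy (i, x) y.
- by have [] := dxx (i, y) x.
- by have [] := dyy (i, x) y.
Qed.

Lemma classC2_twice_derivable (psi : R -> R -> R) : classCk 2 psi -> twice_derivable psi.
Proof. by move=> [_ [dx dy [_ [dxx _ _ _]] [_ [_ dyy _ _]]]]. Qed.

End laplacian_linearity.

Lemma Cb_flux (I : Type) k theta thetac delta (w : I -> R -> R) : 0 < delta ->
  (forall i x, `|w i x| <= 1 - delta) -> Cb k w ->
  Cb k (fun i x => flux 0 theta thetac (w i x)).
Proof.
move=> d0 wd Cw.
have Cc (c : R) : Cb k (fun (_ : I) _ => c) by apply: (@Cb_cst R I k (fun=> c) `|c|).
have Cp : Cb k (fun i x => ln (1 + w i x)).
  apply: (Cb_ln d0 _ (CbD (Cc 1) Cw)) => i x.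
  by have := wd i x; rewrite ler_norml => /andP[+ _]; lra.
have Cm : Cb k (fun i x => ln (1 - w i x)).
  apply: (Cb_ln d0 _ (CbD (Cc 1) (CbN Cw))) => i x.
  by have := wd i x; rewrite ler_norml => /andP[_]; lra.
exact: (CbD (CbM (Cc (theta / 2)) (CbD Cp (CbN Cm))) (CbN (CbM (Cc (thetac + 0)) Cw))).
Qed.

Lemma flux_family_bounded (I : Type) k theta thetac delta (u : I -> R -> R -> R) : 0 < delta ->
  (forall i x y, `|u i x y| <= 1 - delta) -> Sb k u ->
  Xb k (fun i x y => flux 0 theta thetac (u i x y)) /\
  Yb k (fun i x y => flux 0 theta thetac (u i x y)).
Proof.
move=> d0 ud Su; split.
  exact: (Cb_flux (w := fun (p : I * R) x => u p.1 x p.2) _ _ d0 _ (Sb_Xb Su)).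
exact: (Cb_flux (w := fun (p : I * R) y => u p.1 p.2 y) _ _ d0 _ (Sb_Yb Su)).
Qed.

End consistency.

(** * Defect, mean drift and time expansion of the exact solution *)

Section smooth_solution.
Variable R : realType.

Lemma MVT_abs_le (g g' : R -> R) a b B : a <= b -> {within `[a, b], continuous g} ->
  (forall t : R, a < t < b -> is_derive t 1 g (g' t)) -> (forall t, a < t < b -> `|g' t| <= B) ->
  `|g b - g a| <= B * (b - a).
Proof.
rewrite le_eqVlt => /predU1P[-> _ _ _|ab cg dg gB]; first by rewrite !subrr normr0 mulr0.
have dg' t : t \in `]a, b[%R -> is_derive t 1 g (g' t) by rewrite in_itv /=; exact: dg.
have [c] := MVT ab dg' cg; rewrite in_itv /= => cab ->.
by rewrite normrM (gtr0_norm (_ : 0 < b - a)) ?subr_gt0// ler_pM2r ?subr_gt0// gB.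
Qed.

Lemma is_derive1_sum n (F : 'I_n -> R -> R) (F' : 'I_n -> R) (t : R) :
  (forall i, is_derive t 1 (F i) (F' i)) ->
  is_derive t 1 (fun s => \sum_i F i s) (\sum_i F' i).
Proof.
elim: n F F' => [|n IH] F F' dF.
  have -> : (fun s => \sum_(i < 0) F i s) = fun=> 0 by apply/funext => s; rewrite big_ord0.
  by rewrite big_ord0; exact: is_derive_cst.
have -> : (fun s => \sum_(i < n.+1) F i s) =
    (fun s => F ord0 s + \sum_(i < n) F (lift ord0 i) s).
  by apply/funext => s; rewrite big_ord_recl.
by rewrite big_ord_recl; exact: is_derive1_add (dF _) (IH _ _ (fun i => dF _)).
Qed.

Lemma is_derive_grid_mean M (V : R -> 'M[R]_M) (V' : 'M[R]_M) (t : R) :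
  (forall i j, is_derive t 1 (fun s => V s i j) (V' i j)) ->
  is_derive t 1 (fun s => grid_mean (V s)) (grid_mean V').
Proof.
move=> dV; rewrite /grid_mean mulrC.
have -> : (fun s => (\sum_i \sum_j V s i j) / (M ^ 2)%:R) =
    (fun s => (M ^ 2)%:R^-1 * \sum_i \sum_j V s i j) by apply/funext => s; rewrite mulrC.
apply: is_derive1_scale.
exact: (is_derive1_sum (fun i => is_derive1_sum (dV i))).
Qed.

Lemma within_continuous_grid_mean M (A : set R) (V : R -> 'M[R]_M) :
  (forall i j, {within A, continuous (fun s => V s i j)}) ->
  {within A, continuous (fun s => grid_mean (V s))}.
Proof.
move=> cV; rewrite /grid_mean.
have -> : (fun s => (\sum_i \sum_j V s i j) / (M ^ 2)%:R) =
    (fun s => (M ^ 2)%:R^-1 * \sum_i \sum_j V s i j) by apply/funext => s; rewrite mulrC.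
apply: within_continuousZ; apply: within_continuous_sum => i.
exact: within_continuous_sum.
Qed.

Lemma within_continuous_laph (A : set R) h (f : R -> R -> R -> R) :
  (forall x y, {within A, continuous (fun t => f t x y)}) ->
  forall x y, {within A, continuous (fun t => laph h (f t) x y)}.
Proof.
move=> cf x y; rewrite /laph; apply: within_continuousZ.
apply: within_continuousB; last exact: within_continuousZ.
by do 3 (apply: within_continuousD; last exact: cf); exact: cf.
Qed.

Lemma grid_mean_abs_le M (v : 'M[R]_M) B : (0 < M)%N ->
  (forall i j, `|v i j| <= B) -> `|grid_mean v| <= B.
Proof.
move=> M0 vB; have M2 : (0 : R) < (M ^ 2)%:R by rewrite ltr0n expn_gt0 M0.
rewrite /grid_mean normrM normfV (gtr0_norm M2) ler_pdivrMr//.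
apply: le_trans (ler_norm_sum _ _ _) _.
apply: (@le_trans _ _ (\sum_(i < M) \sum_(j < M) B)).
  apply: ler_sum => i _; apply: le_trans (ler_norm_sum _ _ _) _.
  by apply: ler_sum => j _.
by rewrite !sumr_const !card_ord -mulrnA -[leLHS]mulr_natr mulnn lexx.
Qed.

Section solution.
Variables (L T eps sigma theta thetac delta : R) (u ut : R -> R -> R -> R).
Hypotheses (L0 : 0 < L) (T0 : 0 < T) (delta0 : 0 < delta).
Hypothesis sol : nonlocal_CH_solution L T eps sigma theta thetac u.
Hypothesis Su : Sb 6 (fun t : slab_time T => u (sval t)).
Hypothesis sep : forall t x y, 0 <= t <= T -> `|u t x y| <= 1 - 2 * delta.
Hypothesis dut : forall t x y : R, 0 < t < T -> is_derive t 1 (fun s => u s x y) (ut t x y).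
Hypothesis cu : forall x y, {within `[0, T], continuous (fun t => u t x y)}.
Hypothesis cut : forall x y, {within `[0, T], continuous (fun t => ut t x y)}.

Let per t : 0 <= t <= T -> Defs.periodic L (u t). Proof. by case: sol => + _; exact. Qed.

Let sep' (t : slab_time T) x y : `|u (sval t) x y| <= 1 - delta.
Proof.
by case: t => t tT; apply: le_trans (sep x y tT) _; have d0 := delta0; lra.
Qed.

Lemma solution_flux_bounded :
  Xb 4 (fun t : slab_time T => fun x y => flux 0 theta thetac (u (sval t) x y)) /\
  Yb 4 (fun t : slab_time T => fun x y => flux 0 theta thetac (u (sval t) x y)).
Proof. exact: (flux_family_bounded theta thetac delta0 sep' (Sb_le (isT : (4 <= 6)%N) Su)). Qed.

(** Expanding the Laplacian of the chemical potential term by term lets [- laplacian psi] be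
    replaced by u minus its mean, so the auxiliary psi, which varies with t without any assumed
    regularity in time, disappears. *)
Lemma solution_pde t x y : 0 < t < T ->
  ut t x y = laplacian (fun x y => flux 0 theta thetac (u t x y)) x y
    - eps ^+ 2 * laplacian (laplacian (u t)) x y - sigma * (u t x y - mean L (u t)).
Proof.
move=> tT; have tT' : 0 <= t <= T by case/andP: tT => /ltW -> /ltW ->.
have [_ /(_ t tT) [psi [[Cpsi _ _ psiE] dmu]]] := sol.
rewrite -(is_derive_derive1 (dut x y tT)) (is_derive_derive1 (dmu x y)).
have -> : chemical_potential eps sigma theta thetac (u t) psi =
    (fun x y => flux 0 theta thetac (u t x y) + - eps ^+ 2 * laplacian (u t) x y + sigma * psi x y).
  apply/funext => a; apply/funext => b; rewrite /chemical_potential /flux.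
  by move: (laplacian _ a b) (ln _) (ln _) => p q r; ring.
have [Xf Yf] := solution_flux_bounded.
pose t' : slab_time T := exist _ t tT'.
have S4 := Sb_laplacian Su.
rewrite laplacian_lincomb.
- have := psiE x y; move: (laplacian psi x y) (laplacian (laplacian (u t)) x y) => p q E.
  have -> : p = - (u t x y - mean L (u t)) by rewrite -E opprK.
  by ring.
- exact: (@XYb_twice_derivable R _ 2 _ t' Xf Yf).
- exact: (@XYb_twice_derivable R _ 2 _ t' (Sb_Xb S4) (Sb_Yb S4)).
- exact: classC2_twice_derivable.
Qed.

Lemma consistency (kappa : R) : exists2 C, 0 <= C & forall M h, (0 < M)%N -> h = L / M%:R ->
  forall t, 0 <= t <= T -> forall i j,
  `|(grid_restrict M h (ut t) - (F_op theta thetac kappa sigma h (grid_restrict M h (u t))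
     - Lh_op eps kappa sigma h (grid_restrict M h (u t)))) i j| <= C * h ^+ 2.
Proof.
have [Xf Yf] := solution_flux_bounded.
have [C1 C10 H1] := laph_consistent Xf Yf.
have [C2 C20 H2] := biharmonic_consistent Su.
have [C3 C30 H3] := quadrature_error L0 (Sb_le (isT : (2 <= 6)%N) Su).
exists (C1 + eps ^+ 2 * C2 + `|sigma| * (C3 / L ^+ 2)).
  have L2 : 0 <= (L ^+ 2)^-1 by rewrite invr_ge0 sqr_ge0.
  by apply: addr_ge0; [apply: addr_ge0 => //|]; apply: mulr_ge0; rewrite ?sqr_ge0//; exact: mulr_ge0.
move=> M h M0 hE t tT i j.
have h0 : 0 < h by rewrite hE divr_gt0// ltr0n.
pose xi := i.+1%:R * h; pose yj := j.+1%:R * h.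
(* The defect at a fixed mesh point as a function of time: continuous on [0,T], it needs to be
   estimated only inside, where the equation holds. *)
pose g s := `|ut s xi yj - (laph h (fun x y => flux 0 theta thetac (u s x y)) xi yj
  - eps ^+ 2 * laph h (laph h (u s)) xi yj
  + sigma * (grid_mean (grid_restrict M h (u s)) - u s xi yj))|.
have gE s : 0 <= s <= T -> `|(grid_restrict M h (ut s)
     - (F_op theta thetac kappa sigma h (grid_restrict M h (u s))
     - Lh_op eps kappa sigma h (grid_restrict M h (u s)))) i j| = g s.
  move=> sT; rewrite mxE [X in _ + X]mxE.
  rewrite (@residualE R L M h M0 hE eps sigma theta thetac kappa (u s) i j (per sT)).
  by rewrite mxE.
rewrite gE//; apply: (@within_closed_le R T g) tT => //.
  apply: within_continuous_abs; apply: within_continuousB; first exact: cut.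
  apply: within_continuousD.
    apply: within_continuousB; last first.
      by apply: within_continuousZ; do 2 apply: within_continuous_laph; exact: cu.
    apply: within_continuous_laph => x y; rewrite /flux.
    apply: within_continuousB; last by apply: within_continuousZ; exact: cu.
    apply: within_continuousZ; apply: within_continuousB; apply: within_continuous_ln.
    + by apply: within_continuousD; [exact: within_continuous_cst|exact: cu].
    + move=> r /=; rewrite in_itv /= => rT; have d0 := delta0.
      by have := sep x y rT; rewrite ler_norml => /andP[? _]; lra.
    + by apply: within_continuousB; [exact: within_continuous_cst|exact: cu].
    + move=> r /=; rewrite in_itv /= => rT; have d0 := delta0.
      by have := sep x y rT; rewrite ler_norml => /andP[_ ?]; lra.
  apply: within_continuousZ; apply: within_continuousB; last exact: cu.
  apply: within_continuous_grid_mean => a b.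
  have -> : (fun r => grid_restrict M h (u r) a b) = (fun r => u r (a.+1%:R * h) (b.+1%:R * h)).
    by apply/funext => r; rewrite mxE.
  exact: cu.
move=> s sT; have sT' : 0 <= s <= T by case/andP: sT => /ltW -> /ltW ->.
pose s' : slab_time T := exist _ s sT'.
have B1 := H1 s' xi yj h h0; have B2 := H2 s' xi yj h h0.
have B3 := H3 s' M h M0 hE (per sT').
(* The scheme replaces the mean over the domain by the mesh mean; their difference is a quadrature
   error. *)
have B4 : `|mean L (u s) - grid_mean (grid_restrict M h (u s))| <= C3 / L ^+ 2 * h ^+ 2.
  have L2 : 0 < L ^+ 2 by rewrite exprn_gt0.
  have -> : grid_mean (grid_restrict M h (u s)) =
      (h ^+ 2 * \sum_(a < M) \sum_(b < M) u s (a.+1%:R * h) (b.+1%:R * h)) / L ^+ 2.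
    rewrite /grid_mean (eq_bigr (fun a : 'I_M => \sum_(b < M) u s (a.+1%:R * h) (b.+1%:R * h))).
      rewrite natrX hE; move: (\sum_(a < M) _) => q; field.
      by rewrite !gt_eqF// ltr0n.
    by move=> a _; apply: eq_bigr => b _; rewrite mxE.
  rewrite /mean -mulrBl normrM normfV (gtr0_norm L2) ler_pdivrMr//.
  by have -> : C3 / L ^+ 2 * h ^+ 2 * L ^+ 2 = C3 * h ^+ 2 by field; rewrite gt_eqF.
move: B1 B2 B4; rewrite /g (solution_pde xi yj sT) /=.
move: (laph h _ xi yj) (laplacian _ xi yj) (laph h _ xi yj) (laplacian _ xi yj).
move: (mean _ _) (grid_mean _) (u s xi yj) => m1 m2 q a1 a2 b1 b2 A1 A2 A3.
have -> : b2 - eps ^+ 2 * a2 - sigma * (q - m1) - (b1 - eps ^+ 2 * a1 + sigma * (m2 - q)) =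
    - (b1 - b2) + eps ^+ 2 * (a1 - a2) + sigma * (m1 - m2) by ring.
apply: le_trans (ler_normD _ _) _; rewrite [X in _ <= X]mulrDl; apply: lerD.
  apply: le_trans (ler_normD _ _) _; rewrite mulrDl normrN; apply: lerD => //.
  rewrite normrM (ger0_norm (sqr_ge0 eps)) -[leRHS]mulrA; apply: ler_wpM2l A2.
  exact: sqr_ge0.
by rewrite normrM -[leRHS]mulrA; exact: ler_wpM2l.
Qed.

Lemma grid_mean_drift : exists2 C, 0 <= C & forall M h, (0 < M)%N -> h = L / M%:R ->
  forall s t, 0 <= s -> s <= t -> t <= T ->
  `|grid_mean (grid_restrict M h (u t)) - grid_mean (grid_restrict M h (u s))|
    <= C * h ^+ 2 * (t - s).
Proof.
(* kappa cancels in the residual, so any value, here 1, describes the drift of the mean. *)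
have [C C0 H] := consistency 1; exists C => // M h M0 hE s t s0 st tT.
apply: (@MVT_abs_le (fun t => grid_mean (grid_restrict M h (u t)))
  (fun t => grid_mean (grid_restrict M h (ut t)))) => //.
- apply: within_continuous_grid_mean => a b.
  have -> : (fun r => grid_restrict M h (u r) a b) = (fun r => u r (a.+1%:R * h) (b.+1%:R * h)).
    by apply/funext => r; rewrite mxE.
  apply: (continuous_subspaceW _ (@cu (a.+1%:R * h) (b.+1%:R * h))) => r /=.
  rewrite !in_itv /= => /andP[sr rt].
  by rewrite (le_trans s0 sr) (le_trans rt tT).
- move=> r /andP[sr rt]; apply: is_derive_grid_mean => a b.
  have -> : (fun r => grid_restrict M h (u r) a b) = (fun r => u r (a.+1%:R * h) (b.+1%:R * h)).
    by apply/funext => q; rewrite mxE.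
  by rewrite mxE; apply: dut; rewrite (le_lt_trans s0 sr) (lt_le_trans rt tT).
- move=> r /andP[sr rt].
  have rT : 0 <= r <= T by rewrite (le_trans s0 (ltW sr)) (le_trans (ltW rt) tT).
  have := grid_mean_abs_le M0 (H M h M0 hE r rT).
  by rewrite grid_meanB grid_mean_residual// subr0.
Qed.

(** At t = 0 the value of [ut] is only a continuous extension. The mean value theorem asks for
    derivatives inside the interval alone, so it is applied to [ut], then to u minus its tangent
    line. *)
Lemma time_taylor utt : (forall t x y : R, 0 < t < T -> is_derive t 1 (fun s => ut s x y) (utt t x y)) ->
  (exists B, forall t x y, 0 <= t <= T -> `|utt t x y| <= B) ->
  exists2 B, 0 <= B & forall t tau x y, 0 <= t -> 0 <= tau -> t + tau <= T ->
    `|u (t + tau) x y - u t x y - tau * ut t x y| <= B * tau ^+ 2.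
Proof.
move=> dutt [B uttB]; exists `|B| => // t tau x y t0 tau0 tT.
have ttau : t <= t + tau by rewrite lerDl.
have sub (a b : R) : t <= a -> b <= t + tau -> `[a, b]%classic `<=` `[0, T]%classic.
  move=> ta btau r /=; rewrite !in_itv /= => /andP[ar rb].
  by rewrite (le_trans t0 (le_trans ta ar)) (le_trans rb (le_trans btau tT)).
have inner r : t < r < t + tau -> `|ut r x y - ut t x y| <= `|B| * tau.
  move=> /andP[tr rtau]; apply: (@le_trans _ _ (`|B| * (r - t))).
    apply: (@MVT_abs_le (fun s => ut s x y) (fun s => utt s x y)); first exact: ltW.
    - by apply: (continuous_subspaceW _ (@cut x y)); apply: sub => //; exact: ltW.
    - move=> s /andP[ts sr]; apply: dutt.
      by rewrite (le_lt_trans t0 ts) (lt_le_trans (lt_trans sr rtau) tT).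
    - move=> s /andP[ts sr]; apply: le_trans (ler_norm B); apply: uttB.
      by rewrite (le_trans t0 (ltW ts)) (le_trans (ltW (lt_trans sr rtau)) tT).
  by rewrite ler_wpM2l//; move: (ltW rtau); lra.
have := @MVT_abs_le (fun s => u s x y - ut t x y * s) (fun s => ut s x y - ut t x y)
  t (t + tau) (`|B| * tau) ttau.
have -> : u (t + tau) x y - ut t x y * (t + tau) - (u t x y - ut t x y * t) =
    u (t + tau) x y - u t x y - tau * ut t x y by ring.
have -> : `|B| * tau * (t + tau - t) = `|B| * tau ^+ 2 by ring.
apply => //.
- apply: within_continuousB; first by apply: (continuous_subspaceW _ (@cu x y)); exact: sub.
  by apply: within_continuousZ; apply: continuous_subspaceT => z; exact: cvg_id.
- move=> s /andP[ts sr]; have sT : 0 < s < T by rewrite (le_lt_trans t0 ts) (lt_le_trans sr tT).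
  have := is_derive1_sub (dut x y sT) (is_derive1_scale (ut t x y) (is_derive_id s (1 : R))).
  by rewrite mulr1.
Qed.

End solution.
End smooth_solution.

(** * Verification of the grid-level hypotheses for the exact solution *)

Section main_proof.
Variable R : realType.

Lemma Lh_restrict_bounded (L T eps sigma kappa : R) (v : R -> R -> R -> R) :
  0 < kappa -> 0 < sigma ->
  (forall t, 0 <= t <= T -> Defs.periodic L (v t)) ->
  Sb 4 (fun t : slab_time T => v (sval t)) -> 0 < L ->
  exists2 C, 0 <= C & forall M h, (0 < M)%N -> h = L / M%:R ->
  forall t, 0 <= t <= T -> forall i j,
  `|Lh_op eps kappa sigma h (grid_restrict M h (v t)) i j| <= C.
Proof.
move=> k0 s0 per Sv L0.
have [C1 C10 H1] := laph_laph_bounded Sv.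
have S2 := Sb_le (isT : (2 <= 4)%N) Sv.
have [C2 C20 H2] := laph_bounded (Sb_Xb S2) (Sb_Yb S2).
have [C3 C30 H3] := Sb_bounded Sv.
exists (eps ^+ 2 * C1 + kappa * C2 + sigma * C3).
  have e2 := sqr_ge0 eps; have [k0' s0'] := (ltW k0, ltW s0).
  by apply: addr_ge0; [apply: addr_ge0|]; exact: mulr_ge0.
move=> M h M0 hE t tT i j; have h0 : 0 < h by rewrite hE divr_gt0// ltr0n.
have perv := per t tT.
rewrite /Lh_op !(grid_restrict_laph M0 hE) //; last exact: periodic_laph.
pose t' : slab_time T := exist _ t tT.
have := H1 t' (i.+1%:R * h) (j.+1%:R * h) h h0.
have := H2 t' (i.+1%:R * h) (j.+1%:R * h) h h0.
have := H3 t' (i.+1%:R * h) (j.+1%:R * h).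
have entry (c : R) (f : R -> R -> R) :
    (c *: grid_restrict M h f) i j = c * f (i.+1%:R * h) (j.+1%:R * h) by rewrite !mxE.
rewrite /= mxE [X in X + _]mxE [X in _ + X + _]mxE !entry.
move: (laph h (laph h (v t)) _ _) (laph h (v t) _ _) (v t _ _) => a b c c3 b2 a1.
apply: le_trans (ler_normD _ _) _; apply: lerD.
  apply: le_trans (ler_normB _ _) _; apply: lerD.
    by rewrite normrM (ger0_norm (sqr_ge0 eps)); apply: ler_wpM2l a1; exact: sqr_ge0.
  by rewrite normrM (gtr0_norm k0) ler_pM2l.
by rewrite normrM (gtr0_norm s0) ler_pM2l.
Qed.

End main_proof.

Unset Implicit Arguments.

Theorem theorem4p1 (R : realType) :
  exists m : nat,
  forall (L T eps sigma theta thetac kappa delta : R)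
    (u : R -> R -> R -> R) (deg : nat -> nat),
  0 < L -> 0 < T -> 0 < eps -> 0 < sigma -> 0 < theta -> theta < thetac ->
  0 < kappa -> 0 < delta ->
  nonlocal_CH_solution L T eps sigma theta thetac u ->
  classCk_slab T m u ->
  (forall t x y, 0 <= t <= T -> `|u t x y| <= 1 - 2 * delta) ->
  projection_estimate L T m deg u ->
  quadrature_exact L T deg u ->
  exists C h0 : R, 0 < C /\ 0 < h0 /\
  forall (M : nat) (tau : R) (un : nat -> 'M[R]_M),
  let h := L / M%:R in
  (0 < M)%N -> h <= h0 -> 0 < tau -> tau <= 1 / 2 ->
  un 0%N = grid_restrict M h (fourier_proj L (deg M) (u 0)) ->
  is_PETD1 eps sigma theta thetac kappa delta h tau un ->
  forall n : nat, n%:R * tau <= T ->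
    grid_norm h (un n - grid_restrict M h (u (n%:R * tau)))
      <= C * (tau + h ^+ 2).
Proof.
(* Six is dictated by the biharmonic defect. It leaves five derivatives to [ut], of which bounding
   [Lh_op] takes four, and a continuous, hence bounded, [utt]. *)
exists 6%N => L T eps sigma theta thetac kappa delta u deg L0 T0 eps0 sigma0 theta0
  thetac1 kappa0 delta0 sol Cu sep est _.
have thetac0 : 0 < thetac := lt_trans theta0 thetac1.
have per t : 0 <= t <= T -> Defs.periodic L (u t) by case: sol => + _; exact.
have Su := slab_Sb L0 per Cu.
have [ut [dut Cut]] := classCk_slab_time Cu.
have [utt [dutt Cutt]] := classCk_slab_time Cut.
have cu := classCk_slab_continuous Cu; have cut := classCk_slab_continuous Cut.
have cutt := classCk_slab_continuous Cutt.
have perut := time_derivative_periodic T0 per dut cut.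
have Sut := slab_Sb L0 perut Cut.
have perutt := time_derivative_periodic T0 perut dutt cutt.
have [Bt uttB] := slab_bounded L0 perutt cutt.
have cu' x y := @slab_time_continuous R T u x y cu.
have cut' x y := @slab_time_continuous R T ut x y cut.
have [C1 C10 H1] := consistency L0 T0 delta0 sol Su sep dut cu' cut' kappa.
have [C2 C20 H2] := grid_mean_drift L0 T0 delta0 sol Su sep dut cu' cut'.
have [C3 C30 H3] := time_taylor dut cu' cut' dutt
  (ex_intro _ Bt (fun t x y tT => uttB (exist _ t tT) x y)).
have T00 : 0 <= (0 : R) <= T by rewrite lexx ltW.
have [C4 C40 H4] := initial_error L0 (ltW T0) (isT : (5 <= 6)%N) Su (per 0 T00) est.
have [C5 C50 H5] := Lh_restrict_bounded eps kappa0 sigma0 perut (Sb_le (isT : (4 <= 5)%N) Sut) L0.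
have C2T : 0 <= C2 * T by rewrite mulr_ge0// ltW.
have C4L : 0 <= C4 / L by rewrite divr_ge0// ltW.
(* The combination C4 / L + C2 T bounds the shift c_n: the mean of the initial error plus the drift
   accumulated up to time T. *)
have [B [B1 [B2 [B3 [B4 [B5 [B6 B0]]]]]]] : exists B, C1 <= B /\ C2 <= B /\ C3 <= B /\ C4 <= B /\ C5 <= B /\
    C4 / L + C2 * T <= B /\ 0 <= B.
  move: C10 C20 C30 C40 C50 C2T C4L; clear=> *.
  by exists (C1 + C2 + C2 * T + C3 + C4 + C4 / L + C5); do !split; lra.
have [C C0 conv] := grid_convergence T L0 eps0 sigma0 theta0 thetac0 kappa0 delta0 B0.
(* This gives h <= 1 and B h <= delta, hence B h^2 <= delta; the 1 in the denominator covers B = 0.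
   The bound on B h, not only on B h^2, is required by the inverse estimate for the initial data. *)
exists C, (Num.min 1 (delta / (B + 1))); split => //; split.
  by rewrite lt_min ltr01 divr_gt0// ltr_wpDl.
move=> M tau un h M0 hh0 tau0 tau12 un0 scheme.
have h0 : 0 < h by rewrite divr_gt0// ltr0n.
have [h1 Bh] : h <= 1 /\ B * h <= delta.
  move: hh0; rewrite le_min => /andP[h1]; rewrite ler_pdivlMr ?ltr_wpDl// => hd.
  by split => //; move: hd; rewrite mulrDr mulr1 mulrC; lra.
have h2 : 0 <= h ^+ 2 by exact: sqr_ge0.
have Bh2 : B * h ^+ 2 <= delta.
  by apply: le_trans Bh; rewrite ler_wpM2l// expr2 ler_piMl// ltW.
have init := H4 M h M0 erefl.
have init' : grid_norm h (un 0%N - grid_restrict M h (u 0)) <= B * h ^+ 2.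
  by rewrite un0; apply: le_trans init _; rewrite ler_wpM2r.
have time n : n%:R * tau <= T -> 0 <= n%:R * tau <= T.
  by move=> ->; rewrite andbT mulr_ge0// ltW.
apply: (conv M tau un (fun n => grid_restrict M h (u (n%:R * tau)))
  (fun n => grid_restrict M h (ut (n%:R * tau)))) => //.
- by lra.
(* The projected initial data satisfy no separation bound a priori: their mesh values are within B h
   <= delta of those of u(0), by the inverse estimate. *)
- move=> i j.
  have e : `|(un 0%N - grid_restrict M h (u 0)) i j| <= delta.
    have := le_trans (grid_norm_entry h (un 0%N - grid_restrict M h (u 0)) i j) init'.
    rewrite (gtr0_norm h0) expr2 mulrCA ler_pM2l// => H.
    exact: le_trans H Bh.
  have := sep 0 (i.+1%:R * h) (j.+1%:R * h) T00.
  move: e; rewrite !mxE; set a := un _ _ _; set b := u _ _ _ => e s.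
  have -> : a = (a - b) + b by rewrite subrK.
  by apply: le_trans (ler_normD _ _) (le_trans (lerD e s) _); lra.
- by rewrite mul0r.
- move=> n nT; split.
    by move=> i j; rewrite mxE; exact: sep (time n nT).
  have /andP[t0 tT] := time n nT.
  have := H2 M h M0 erefl 0 (n%:R * tau) (lexx 0) t0 tT; rewrite subr0 => drift.
  have m0 : `|grid_mean (un 0%N - grid_restrict M h (u 0))| <= C4 / L * h ^+ 2.
    have hM : h * M%:R = L by rewrite /h divfK// pnatr_eq0 -lt0n.
    have := @grid_mean_le R M h (un 0%N - grid_restrict M h (u 0)); rewrite hM => /(_ L0 M0) Hm.
    rewrite mulrAC ler_pdivlMr//; apply: le_trans Hm _.
    by rewrite un0.
  rewrite grid_meanB in m0.
  have dT : C2 * h ^+ 2 * (n%:R * tau) <= C2 * T * h ^+ 2.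
    by rewrite mulrAC ler_wpM2r// ler_wpM2l.
  have BT : (C4 / L + C2 * T) * h ^+ 2 <= B * h ^+ 2 by rewrite ler_wpM2r.
  rewrite -(subrKA (grid_mean (grid_restrict M h (u 0)))).
  apply: le_trans (ler_normD _ _) _.
  rewrite (distrC (grid_mean (grid_restrict M h (u 0)))).
  apply: le_trans (lerD m0 (le_trans drift dT)) _.
  by rewrite -mulrDl.
- move=> n nT; have nT' : n%:R * tau <= T.
    by apply: le_trans nT; rewrite ler_pM2r// ler_nat.
  have /andP[t0 tT] := time n nT'.
  have nS : n.+1%:R * tau = n%:R * tau + tau by rewrite -natr1 mulrDl mul1r.
  rewrite nS in nT *; split.
  + move=> i j; rewrite !mxE.
    apply: le_trans (H3 (n%:R * tau) tau _ _ t0 (ltW tau0) nT) _.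
    by rewrite ler_wpM2r ?sqr_ge0.
  + by move=> i j; apply: le_trans (H1 M h M0 erefl _ (time n nT') i j) _; rewrite ler_wpM2r.
  + by move=> i j; apply: le_trans (H5 M h M0 erefl _ (time n nT') i j) _.
  + apply: le_trans (H2 M h M0 erefl _ _ t0 _ nT) _; first by rewrite lerDl ltW.
    rewrite addrC addKr mulrAC; apply: ler_wpM2r => //.
    by apply: ler_wpM2r => //; exact: ltW.
Qed.
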